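(* The four-page index of the Hopf link $2^2_1$ is $\alpha_4(2^2_1)=4$, and the four-page index of the trefoil knot $3_1$ is $\alpha_4(3_1)=6$.
   Context: Four-page index. Consider the open book decomposition of $\mathbb{R}^3$ whose binding is a straight line (the binding axis) and whose pages are the half-planes bounded by it. A four-page presentation of a knot or link $K$ is an embedding of $K$ (in its ambient isotopy class) into the union of pages of this open book such that exactly four pages meet $K$, and each page contains finitely many pairwise disjoint properly embedded arcs of $K$ (with endpoints on the binding axis). The number of arcs equals the number of points where $K$ meets the binding axis. The four-page index $\alpha_4(K)$ is the minimal number of arcs among all four-page presentations of $K$. *)

(* Defs.v *)
From HB Require Import structures.
From mathcomp Require Import all_boot all_order all_algebra.
From mathcomp Require Import all_classical all_reals all_analysis.

Set Implicit Arguments.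
Unset Strict Implicit.
Unset Printing Implicit Defensive.

Import Order.TTheory GRing.Theory Num.Theory.
Import numFieldNormedType.Exports.

Local Open Scope classical_set_scope.
Local Open Scope ring_scope.

(* Euclidean 3-space, with the product topology; a point is ((x, y), z). *)
Notation E3 R := (R * R * R)%type.

Section FourPageIndex.
Context {R : realType}.
Implicit Types K L P A : set (E3 R).

Definition homeomorphism (f : E3 R -> E3 R) : Prop :=
  continuous f /\
  exists g : E3 R -> E3 R, [/\ continuous g, cancel f g & cancel g f].

Definition ambient_isotopic K L : Prop :=
  exists H : R * E3 R -> E3 R,
    [/\ {within `[0, 1]%classic `*` [set: E3 R], continuous H},
        forall t : R, 0 <= t <= 1 -> homeomorphism (fun p => H (t, p)),
        forall p : E3 R, H (0, p) = p
      & (fun p => H (1, p)) @` K = L].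

(* The open book of R^3: all lines are equivalent, and the binding is taken to
   be the z-axis; pages are closed half-planes, so they contain the binding. *)
Definition binding_axis : set (E3 R) := [set p | p.1.1 = 0 /\ p.1.2 = 0].

Definition page (theta : R) : set (E3 R) :=
  [set p | exists2 r : R, 0 <= r & p.1 = (r * cos theta, r * sin theta)].

Definition is_page P : Prop := exists theta : R, P = page theta.

Definition proper_arc P A : Prop :=
  exists gamma : R -> E3 R,
    [/\ {within `[0, 1], continuous gamma},
        {in `[0, 1] &, injective gamma},
        A = gamma @` `[0, 1]%classic,
        A `<=` P
      & forall t : R, 0 <= t <= 1 ->
          (binding_axis (gamma t) <-> t = 0 \/ t = 1)].

(* A presentation of K with n arcs: [pages] are the four pages that are met,
   and [pg i] is the page containing the i-th arc.  Since every page contains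
   the binding, a page is "met" when it carries at least one arc. Arcs in
   different pages may share endpoints; arcs in the same page may not. *)
Definition four_page_presentation K (n : nat) : Prop :=
  exists (pages : 'I_4 -> set (E3 R)) (pg : 'I_n -> 'I_4)
         (arc : 'I_n -> set (E3 R)),
    [/\ injective pages /\ (forall j, is_page (pages j)),
        forall j, exists i, pg i = j,
        forall i, proper_arc (pages (pg i)) (arc i),
        forall i k, i != k -> pg i = pg k -> arc i `&` arc k = set0
      & ambient_isotopic K (\bigcup_i arc i)].

(* The least number of arcs.  The default value 0 is never the number of arcs
   of a presentation, as each of the four pages carries an arc. *)
Definition four_page_index K : nat :=
  match pselect (exists n, `[< four_page_presentation K n >]) with
  | left ex_n => ex_minn ex_n
  | right _ => 0%N
  end.

(* Two round unit circles in perpendicular planes, each through the centre of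
   the other. *)
Definition hopf_link : set (E3 R) :=
  [set p | p.1.1 ^+ 2 + p.1.2 ^+ 2 = 1 /\ p.2 = 0] `|`
  [set p | (p.1.1 - 1) ^+ 2 + p.2 ^+ 2 = 1 /\ p.1.2 = 0].

(* The torus knot winding twice around the z-axis and three times around the
   core circle of radius 2.  It is the left-handed trefoil, as in the usual
   knot tables; reflecting R^3 in the plane z = 0 exchanges the two trefoils
   and preserves the pages, hence does not affect the index. *)
Definition trefoil_knot : set (E3 R) :=
  range (fun t : R => ((2 + cos (3 * t)) * cos (2 * t),
                       (2 + cos (3 * t)) * sin (2 * t),
                       sin (3 * t))).

End FourPageIndex.

Arguments hopf_link : clear implicits.
Arguments trefoil_knot : clear implicits.

(* Main.v *)
Require Import Defs.
From HB Require Import structures.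
From mathcomp Require Import all_boot all_order all_algebra.
From mathcomp Require Import all_classical all_reals all_analysis.
From mathcomp Require Import fingroup perm complex ring lra zify.

(* The upper bounds come from explicit ambient isotopies, composed of shears.

   A presentation has at least 4 arcs since each page carries one, so it remains
   to exclude presentations of the trefoil with 4 or 5 arcs. The roots of
   T^3 - 3 a T + 2 w, with the functions a and w chosen so that a^3 = w^2 exactly
   on the knot, form a threefold covering of the complement of the trefoil which
   has no global section and whose discriminant has no global square root: its
   monodromy fixes no root and is not even. An isotopy carries this covering to
   the complement of a presentation. The pages cut this complement into
   star-shaped wedges on which the covering is trivial, so the monodromy is
   generated by the transitions across the pages. By plane topology each
   transition already occurs at an axis point, and it only depends on the arcs of
   the page that span this point. Around an axis point the product of the four
   transitions is 1. For 4 or 5 arcs an enumeration of the arrangements shows that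
   these relations force the transitions to fix a common root or to be all even,
   a contradiction. *)

Set Implicit Arguments.
Unset Strict Implicit.
Unset Printing Implicit Defensive.

Import Order.TTheory GRing.Theory Num.Theory.
Import numFieldNormedType.Exports.

Local Open Scope classical_set_scope.
Local Open Scope ring_scope.

(** * Coverings with fibres in a metric space *)

(** The monodromy of this covering is the tricolouring of the trefoil, a map of the knot group onto
    the symmetric group of degree 3; the two alternatives to be excluded, a common fixed root or
    even transitions only, are exactly the cases of an abelian image. The obstacle is that the arcs
    of a presentation are arbitrary Jordan arcs in their pages, so that neither a polygonal diagram
    nor a van Kampen presentation is at hand. Everything is therefore expressed by continuous
    families of roots, and the separation properties of arcs in a page come from Eilenberg's
    criterion: a compact set does not separate two points of the plane if the difference of the
    arguments about them has a continuous branch on it. A covering defined by an explicit equation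
    also passes through a homeomorphism by mere composition. For the upper bounds, a shear deforms
    the whole space at once, so every deformation is written as the graph of a function and no
    isotopy of curves has to be extended. *)

Lemma connected_induction (T : topologicalType) (A : set T) (P : T -> Prop) a :
  connected A -> A a -> P a ->
  (forall x, A x -> P x -> \forall y \near x, A y -> P y) ->
  (forall x, A x -> ~ P x -> \forall y \near x, A y -> ~ P y) ->
  forall x, A x -> P x.
Proof.
move=> cA Aa Pa oP cP x Ax.
have : [set y | A y /\ P y] = A.
  apply: cA; first by exists a.
  - exists (interior [set y | A y -> P y]); first exact: open_interior.
    apply/seteqP; split=> y /= [Ay Py]; split => //; first exact: oP.
    exact: (nbhs_singleton Py Ay).
  - exists (~` interior [set y | A y -> ~ P y]).
      exact/open_closedC/open_interior.
    apply/seteqP; split=> y /= [Ay Py]; split => //.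
      by move=> /nbhs_singleton /(_ Ay).
    by apply: contrapT => nPy; apply: Py; exact: cP.
by move/seteqP => [_ /(_ x Ax)] /= [].
Qed.

Lemma near_comp (T U : topologicalType) (g : U -> T) (P : T -> Prop) x :
  continuous g -> (\forall b \near g x, P b) -> \forall y \near x, P (g y).
Proof. by move=> cg H; exact: (cg x _ H). Qed.

Section IntervalInduction.
Variable R : realType.

Lemma near_dist_lt (x e : R) : 0 < e -> \forall y \near x, `|y - x| < e.
Proof.
move=> e0; have := nbhsx_ballx x e e0; apply: filterS => y.
by rewrite /ball /= distrC.
Qed.

(** Takes the place of a Lebesgue number and a finite subdivision. The induction claims [G 0 t'] for
    all [t' <= t], so that it can be restarted from any point just below the current one. *)
Lemma subdivision_induction (G : R -> R -> Prop) :
  (forall s m t, s <= m -> m <= t -> G s m -> G m t -> G s t) ->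
  (forall x, 0 <= x <= 1 -> exists2 e : R, 0 < e &
     forall s t, 0 <= s -> s <= t -> t <= 1 -> `|s - x| < e -> `|t - x| < e -> G s t) ->
  G 0 1.
Proof.
move=> addG locG.
suff H : forall t, `[0, 1]%classic t -> forall t', 0 <= t' <= t -> G 0 t'.
  by apply: (H 1); rewrite /= ?in_itv /=; lra.
apply: (@connected_induction _ _ _ 0); first exact: segment_connected.
- by rewrite /= in_itv/=; lra.
- move=> t' t'0; have -> : t' = 0 by lra.
  have [|e e0 H] := locG 0; first lra.
  by apply: H; rewrite ?subrr ?normr0//; lra.
- move=> x; rewrite /= in_itv /= => x01 Px; have [e e0 H] := locG x x01.
  near=> y; rewrite /= in_itv/= => y01 t' t'y.
  have [t'x|xt'] := leP t' x; first by apply: Px; lra.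
  apply: (addG _ x); [lra|lra|apply: Px; lra|].
  have : `|y - x| < e by near: y; exact: near_dist_lt.
  rewrite ltr_norml => yx; apply: H; rewrite ?subrr ?normr0//; try lra.
  by rewrite ltr_norml; lra.
- move=> x; rewrite /= in_itv /= => x01 nPx; have [e e0 H] := locG x x01.
  near=> y; rewrite /= in_itv/= => y01 Py; apply: nPx => t' t'x.
  have [t'y|yt'] := leP t' y; first by apply: Py; lra.
  apply: (addG _ y); [lra|lra|apply: Py; lra|].
  have : `|y - x| < e by near: y; exact: near_dist_lt.
  rewrite ltr_norml => yx; apply: H; try (rewrite ltr_norml); lra.
Unshelve. all: by end_near. Qed.
End IntervalInduction.

Section Covering.
Variables (R : realType) (Y : Type) (d : Y -> Y -> R).
Hypothesis dxx : forall y, d y y = 0.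
Hypothesis dC : forall y z, d y z = d z y.
Hypothesis dD : forall y z t, d y t <= d y z + d z t.
Hypothesis d0 : forall y z, d y z <= 0 -> y = z.

Definition continuous_to (T : topologicalType) (D : set T) (f : T -> Y) :=
  forall b, D b -> forall e, 0 < e ->
    \forall b' \near b, D b' -> d (f b') (f b) < e.

(** [Q b] is the fibre over [b]. It varies continuously for the Hausdorff distance, and its points
    stay apart by a locally uniform distance. The pairs [(b, y)] with [Q b y] thus cover [D]; no
    total space is introduced. *)
Definition covering (T : topologicalType) (D : set T) (Q : T -> Y -> Prop) :=
  forall b, D b ->
    (forall e, 0 < e -> \forall b' \near b, D b' ->
       (forall y, Q b y -> exists2 y', Q b' y' & d y' y < e) /\
       (forall y', Q b' y' -> exists2 y, Q b y & d y' y < e)) /\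
    (exists2 e, 0 < e & \forall b' \near b, D b' ->
       forall y z, Q b' y -> Q b' z -> d y z < e -> y = z).

Definition lift_on (T : topologicalType) (D : set T) (Q : T -> Y -> Prop) f :=
  continuous_to D f /\ forall b, D b -> Q b (f b).

Lemma continuous_to_sub (T : topologicalType) (D D' : set T) f :
  D' `<=` D -> continuous_to D f -> continuous_to D' f.
Proof.
move=> D'D cf b /D'D Db e e0; move: (cf b Db e e0).
by apply: filterS => c /[swap] /D'D Dc /(_ Dc).
Qed.

Lemma lift_on_sub (T : topologicalType) (D D' : set T) Q f :
  D' `<=` D -> lift_on D Q f -> lift_on D' Q f.
Proof.
by move=> DD' [cf Qf]; split; [exact: continuous_to_sub cf|move=> b /DD' /Qf].
Qed.

Lemma continuous_to_comp (T U : topologicalType) (D : set T) (A : set U)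
    (g : U -> T) f :
  continuous g -> (forall x, A x -> D (g x)) -> continuous_to D f ->
  continuous_to A (f \o g).
Proof.
move=> cg gA cf x Ax e e0; have := near_comp cg (cf _ (gA x Ax) e e0).
by apply: filterS => y /= /[swap] /gA Dy /(_ Dy).
Qed.

Lemma covering_comp (T U : topologicalType) (D : set T) (A : set U)
    (g : U -> T) Q :
  continuous g -> (forall x, A x -> D (g x)) -> covering D Q ->
  covering A (Q \o g).
Proof.
move=> cg gA cQ x Ax; have [H1 [e e0 H2]] := cQ _ (gA x Ax); split.
  move=> e1 e10; have := near_comp cg (H1 e1 e10).
  by apply: filterS => y /= /[swap] /gA Dy /(_ Dy).
exists e => //; have := near_comp cg H2.
by apply: filterS => y /= /[swap] /gA Dy /(_ Dy).
Qed.

Lemma covering_sub (T : topologicalType) (D A : set T) Q :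
  A `<=` D -> covering D Q -> covering A Q.
Proof.
move=> AD cQ; suff : covering A (Q \o id) by [].
by apply: covering_comp AD cQ => x; exact: cvg_id.
Qed.

Lemma lift_comp (T U : topologicalType) (D : set T) (A : set U)
    (g : U -> T) Q f :
  continuous g -> (forall x, A x -> D (g x)) -> lift_on D Q f ->
  lift_on A (Q \o g) (f \o g).
Proof.
move=> cg gA [cf Qf]; split; first exact: continuous_to_comp cf.
by move=> x /gA /Qf.
Qed.

(** Lifts that agree at a point are close nearby, hence equal by separation of the fibre; lifts that
    differ at a point stay different by continuity. Agreement is open and closed. *)
Lemma lift_unique (T : topologicalType) (D : set T) Q f g a :
  covering D Q -> connected D -> lift_on D Q f -> lift_on D Q g ->
  D a -> f a = g a -> forall x, D x -> f x = g x.
Proof.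
move=> cQ cD [cf Qf] [cg Qg] Da fga.
apply: (@connected_induction _ _ (fun x => f x = g x) a) => // x Dx.
  move=> fgx; have [_ [e e0 He]] := cQ x Dx.
  have e20 : 0 < e / 2 by lra.
  move: (cf x Dx _ e20) (cg x Dx _ e20) He; apply: filterS3 => y fy gy H Dy.
  apply: (H Dy); [exact: Qf|exact: Qg|].
  apply: (le_lt_trans (dD _ (f x) _)); rewrite {2}fgx (dC (g x)).
  by move: (fy Dy) (gy Dy); lra.
move=> nfg; have e0 : 0 < d (f x) (g x) / 2.
  by rewrite divr_gt0// ltNge; apply/negP => /d0.
move: (cf x Dx _ e0) (cg x Dx _ e0); apply: filterS2 => y fy gy Dy fgy.
move: (fy Dy) (gy Dy) (dD (f x) (f y) (g x)).
by rewrite (dC (f x) (f y)) fgy; lra.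
Qed.

(** Near [b] every root lies within [e / 3] of a root over [b], and separation makes the root close
    to a given one unique; following it gives the section. [N] is chosen before [c] and [y], as the
    lifting of paths requires. *)
Lemma local_section (T : topologicalType) (D : set T) Q b :
  covering D Q -> D b ->
  exists (N : set T) (e : R), [/\ nbhs b N, 0 < e,
    (forall c, N c -> D c -> forall y z, Q c y -> Q c z -> d y z < e -> y = z) &
    forall c y, N c -> D c -> Q c y ->
      exists2 s, lift_on (N `&` D) Q s & s c = y].
Proof.
move=> cQ Db; have [H1 [e e0 H2]] := cQ b Db.
have e30 : 0 < e / 3 by lra.
exists ([set c | D c -> (forall y, Q b y -> exists2 y', Q c y' & d y' y < e / 3) /\
       (forall y', Q c y' -> exists2 y, Q b y & d y' y < e / 3)] `&`
        [set c | D c -> forall y z, Q c y -> Q c z -> d y z < e -> y = z]), e.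
split => //.
- by apply: filterI; [exact: H1|exact: H2].
- by move=> c [_].
move=> c y [Nc1 Nc'] Dc Qy; have [N1 N2] := Nc1 Dc; have [yb Qyb yyb] := N2 y Qy.
have /choice[s Hs] : forall x, exists z,
  (D x -> (forall y, Q b y -> exists2 y', Q x y' & d y' y < e / 3)) ->
  D x -> Q x z /\ d z yb < e / 3.
  move=> x; have [[Dx Nx]|nx] := pselect (D x /\
    forall y, Q b y -> exists2 y', Q x y' & d y' y < e / 3).
    by have [z Qz zy] := Nx yb Qyb; exists z.
  by exists y => H1' Dx; exfalso; apply: nx; split => //; exact: H1'.
have sP x : ([set c | D c -> (forall y, Q b y -> exists2 y', Q c y' & d y' y < e / 3) /\
       (forall y', Q c y' -> exists2 y, Q b y & d y' y < e / 3)]) x -> D x ->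
  Q x (s x) /\ d (s x) yb < e / 3.
  by move=> /= Nx Dx; apply: Hs => // Dx'; have [] := Nx Dx'.
exists s; last first.
  have [Qs sb] := sP c Nc1 Dc.
  apply: (Nc' Dc) => //; apply: (le_lt_trans (dD _ yb _)); rewrite (dC yb).
  by lra.
split; last by move=> x [[Nx _] Dx]; have [] := sP x Nx Dx.
move=> x [[Nx1 Nx2] Dx] e' e'0; have [Qx sx] := sP x Nx1 Dx.
pose m := Num.min e' (e / 3 - d (s x) yb).
have m0 : 0 < m by rewrite lt_min e'0 /= subr_gt0.
have [H3 _] := cQ x Dx; move: (H3 m m0); apply: filterS => z Hz [[Nz1 Nz2] Dz].
have [Hz1 _] := Hz Dz; have [z' Qz' z's] := Hz1 _ Qx.
have [Qsz sz] := sP z Nz1 Dz; have mm : m <= e / 3 - d (s x) yb by rewrite ge_min lexx orbT.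
have -> : s z = z'.
  apply: (Nz2 Dz) => //; apply: (le_lt_trans (dD _ yb _)).
  by move: (dD z' (s x) yb); rewrite (dC yb); lra.
by apply: (lt_le_trans z's); rewrite ge_min lexx.
Qed.

Definition path_lift (Q : R -> Y -> Prop) s t y z :=
  exists2 l, lift_on `[s, t] Q l & l s = y /\ l t = z.

Lemma path_lift_cat (Q : R -> Y -> Prop) s m t x y z : s <= m -> m <= t ->
  path_lift Q s m x y -> path_lift Q m t y z -> path_lift Q s t x z.
Proof.
move=> sm mt [l [cl Ql] [ls lm]] [k [ck Qk] [km kt]].
exists (fun u => if u <= m then l u else k u); last first.
  rewrite sm; split => //; case: (leP t m) => // tm.
  suff mt' : m = t by rewrite -mt' lm -km mt'.
  by lra.
split; last first.
  move=> u /=; rewrite in_itv /= => ut.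
  by case: ifP => um; [apply: Ql|apply: Qk]; rewrite /= in_itv/=; lra.
move=> u; rewrite /= in_itv /= => ut e e0.
case: (ltgtP u m) => um.
- have := cl u _ e e0; rewrite /= in_itv /= => /(_ ltac:(lra)) H.
  near=> v => vt.
  have -> : v <= m by apply/ltW; near: v; exact: lt_nbhsl.
  have : v \in `[s, m] -> d (l v) (l u) < e by near: v.
  apply; rewrite in_itv/=; move: vt; rewrite in_itv/= => /andP[-> _] /=.
  by apply/ltW; near: v; exact: lt_nbhsl.
- have := ck u _ e e0; rewrite /= in_itv /= => /(_ ltac:(lra)) H.
  near=> v => vt.
  have vm : m < v by near: v; exact: lt_nbhsr.
  rewrite leNgt vm /=.
  have : v \in `[m, t] -> d (k v) (k u) < e by near: v.
  by apply; rewrite in_itv/=; move: vt; rewrite in_itv/= => /andP[_ ->]; rewrite ltW.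
- have := cl u _ e e0; rewrite /= in_itv /= => /(_ ltac:(lra)) H.
  have := ck u _ e e0; rewrite /= in_itv /= => /(_ ltac:(lra)) H'.
  near=> v => vt; move: (vt); rewrite in_itv/= => vt'.
  case: (leP v m) => vm.
    have : v \in `[s, m] -> d (l v) (l u) < e by near: v.
    by apply; rewrite in_itv/=; lra.
  rewrite um lm -km -um.
  have : v \in `[m, t] -> d (k v) (k u) < e by near: v.
  by apply; rewrite in_itv/=; lra.
Unshelve. all: by end_near. Qed.

Lemma path_lift_exists (Q : R -> Y -> Prop) y :
  covering (`[0, 1]%classic : set R) Q -> Q 0 y -> exists z, path_lift Q 0 1 y z.
Proof.
move=> cQ; move: y.
apply: (subdivision_induction (G := fun s t => forall y, Q s y ->
  exists z, path_lift Q s t y z)).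
  move=> s m t sm mt H1 H2 y /H1[z yz].
  have Qz : Q m z by have [l [_ Ql] [_ <-]] := yz; apply: Ql; rewrite /= in_itv/= sm lexx.
  by have [w zw] := H2 z Qz; exists w; apply: path_lift_cat yz zw.
move=> x x01; have x01' : (`[0, 1]%classic : set R) x by rewrite /= in_itv /=.
have [N [e [Nx _ _ H]]] := local_section cQ x01'.
move/nbhs_ballP : Nx => [r /= r0 rN]; exists r => // s t s0 st t1 sx tx y Qy.
have subN u : s <= u <= t -> N u.
  move=> ut; apply: rN; rewrite /ball /= distrC.
  by move: sx tx; rewrite !ltr_norml; lra.
have [|||l ll ls] := H s y; rewrite /= ?in_itv/=.
- by apply: subN; lra.
- lra.
- by [].
exists (l t); exists l => //; apply: lift_on_sub ll => u /=.
by rewrite !in_itv /= => ut; split; [exact: subN|lra].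
Qed.

Lemma path_lift_sub (Q : R -> Y -> Prop) s t s' t' l : s <= s' -> t' <= t ->
  lift_on `[s, t] Q l -> lift_on `[s', t'] Q l.
Proof.
by move=> ss tt; apply: lift_on_sub => u /=; rewrite !in_itv /=; lra.
Qed.

Section Star.
Variables (V : normedModType R) (D : set V) (c : V) (Q : V -> Y -> Prop).
Hypothesis Dc : D c.
Hypothesis starD : forall p (s : R), D p -> 0 <= s <= 1 -> D (c + s *: (p - c)).
Hypothesis cQ : covering D Q.

Let seg p s := c + s *: (p - c).

Let seg_continuous : continuous (fun ps : V * R => seg ps.1 ps.2).
Proof.
move=> [p s]; apply: cvgD; first exact: cvg_cst.
apply: cvgZ; first exact: cvg_snd.
by apply: cvgB; [exact: cvg_fst|exact: cvg_cst].
Qed.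

Let segl p : continuous (seg p).
Proof.
move=> s; apply: cvgD; first exact: cvg_cst.
by apply: cvgZ; [exact: cvg_id|exact: cvg_cst].
Qed.

Let segr s : continuous (seg ^~ s).
Proof.
move=> p; apply: cvgD; first exact: cvg_cst.
apply: cvgZ; first exact: cvg_cst.
by apply: cvgB; [exact: cvg_id|exact: cvg_cst].
Qed.

Let seg0 p : seg p 0 = c. Proof. by rewrite /seg scale0r addr0. Qed.
Let seg1 p : seg p 1 = p. Proof. by rewrite /seg scale1r addrC subrK. Qed.

Let cover_seg p (s t : R) : D p -> 0 <= s -> t <= 1 ->
  covering `[s, t] (Q \o seg p).
Proof.
move=> Dp s0 t1; apply: (covering_comp (@segl p) _ cQ).
by move=> u; rewrite /= in_itv /= => ut; apply: starD => //; lra.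
Qed.

(** The end of a lifted segment depends continuously on the segment. Stability of the transport from
    [s] to [t], under small changes of [p] and of the initial root, composes along adjacent
    intervals, so a subdivision proves it. *)
Let path_good p : D p -> forall y y', path_lift (Q \o seg p) 0 1 y y' ->
  forall e', 0 < e' -> exists2 e, 0 < e & \forall p' \near p, D p' ->
    forall z, Q (seg p' 0) z -> d z y < e ->
    exists2 z', path_lift (Q \o seg p') 0 1 z z' & d z' y' < e'.
Proof.
move=> Dp; apply: (subdivision_induction (G := fun s t =>
  forall y y', path_lift (Q \o seg p) s t y y' ->
  forall e', 0 < e' -> exists2 e, 0 < e & \forall p' \near p, D p' ->
    forall z, Q (seg p' s) z -> d z y < e ->
    exists2 z', path_lift (Q \o seg p') s t z z' & d z' y' < e')).
  move=> s m t sm mt H1 H2 y y' [l ll [ls lt]] e' e'0.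
  have [|e1 e10 He1] := H2 (l m) y' _ e' e'0.
    by exists l => //; apply: path_lift_sub ll.
  have [|e2 e20 He2] := H1 y (l m) _ e1 e10.
    by exists l => //; apply: path_lift_sub ll.
  exists e2 => //; move: He1 He2; apply: filterS2 => p' He1 He2 Dp' z Qz zy.
  have [z' zz' z'm] := He2 Dp' z Qz zy.
  have Qz' : Q (seg p' m) z'.
    by have [k [_ Qk] [_ <-]] := zz'; apply: Qk; rewrite /= in_itv /= sm lexx.
  have [z'' z'z'' z''y] := He1 Dp' z' Qz' z'm.
  by exists z'' => //; apply: path_lift_cat zz' z'z''.
move=> x x01; have Dx : D (seg p x) by exact: starD.
have [N [e [Nx e0 sepN H]]] := local_section cQ Dx.
have [[/= A B] [/= pA xB] AB] := @seg_continuous (p, x) N Nx.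
move/nbhs_ballP : xB => [r /= r0 rB]; exists r => // s t s0 st t1 sx tx y y'.
move=> [l ll [ls lt]] e' e'0.
have subB u : s <= u <= t -> B u.
  move=> ut; apply: rB; rewrite /ball /= distrC.
  by move: sx tx; rewrite !ltr_norml; lra.
have subN p' u : A p' -> s <= u <= t -> N (seg p' u).
  by move=> Ap' ut; apply: (AB (p', u)); split => //=; exact: subB.
have Ap : A p by exact: nbhs_singleton pA.
have [| | |sg lsg sgs] := H (seg p s) y.
- by apply: subN => //; lra.
- by apply: starD => //; lra.
- by rewrite -ls; apply: (ll.2); rewrite /= in_itv /=; lra.
have lsgp p' : A p' -> D p' -> lift_on `[s, t] (Q \o seg p') (sg \o seg p').
  move=> Ap' Dp'; apply: lift_comp lsg => // u /=; rewrite in_itv /= => ut.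
  by split; [exact: subN|apply: starD => //; lra].
have sgt : sg (seg p t) = y'.
  rewrite -lt; apply: (@lift_unique _ (`[s, t]%classic : set R) (Q \o seg p) (sg \o seg p) l s).
  - by apply: cover_seg => //; lra.
  - exact: segment_connected.
  - exact: lsgp.
  - by [].
  - by rewrite /= in_itv/=; lra.
  - by rewrite /= sgs ls.
  - by rewrite /= in_itv/=; lra.
have e20 : 0 < e / 2 by lra.
exists (e / 2) => //.
have NDs : (N `&` D) (seg p s).
  by split; [apply: subN => //; lra|apply: starD => //; lra].
have NDt : (N `&` D) (seg p t).
  by split; [apply: subN => //; lra|apply: starD => //; lra].
have C1 := near_comp (@segr s) (lsg.1 _ NDs _ e20).
have C2 := near_comp (@segr t) (lsg.1 _ NDt _ e'0).
near=> p' => Dp' z Qz zy.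
have Ap' : A p' by near: p'.
have NDs' : (N `&` D) (seg p' s).
  by split; [apply: subN => //; lra|apply: starD => //; lra].
have NDt' : (N `&` D) (seg p' t).
  by split; [apply: subN => //; lra|apply: starD => //; lra].
exists (sg (seg p' t)).
  exists (sg \o seg p'); first exact: lsgp.
  split => //=; apply: (sepN _ NDs'.1 NDs'.2) => //; first exact: lsg.2.
  apply: (le_lt_trans (dD _ y _)); rewrite (dC y).
  have : (N `&` D) (seg p' s) -> d (sg (seg p' s)) (sg (seg p s)) < e / 2.
    by near: p'.
  by rewrite sgs => /(_ NDs'); lra.
have : (N `&` D) (seg p' t) -> d (sg (seg p' t)) (sg (seg p t)) < e'.
  by near: p'.
by rewrite sgt; exact.
Unshelve. all: by end_near. Qed.

Let star_lift_center y : Q c y ->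
  exists2 l, lift_on D Q l & forall p z, D p -> path_lift (Q \o seg p) 0 1 y z -> l p = z.
Proof.
move=> Qy.
have uniq p z z' : D p -> path_lift (Q \o seg p) 0 1 y z ->
    path_lift (Q \o seg p) 0 1 y z' -> z = z'.
  move=> Dp [l ll [l0 <-]] [k lk [k0 <-]].
  apply: (@lift_unique _ (`[0, 1]%classic : set R) (Q \o seg p) l k 0) => //.
  - exact: cover_seg.
  - exact: segment_connected.
  - by rewrite /= in_itv/=; lra.
  - by rewrite l0 k0.
  - by rewrite /= in_itv/=; lra.
have /choice[l Hl] : forall p, exists z, D p -> path_lift (Q \o seg p) 0 1 y z.
  move=> p; have [Dp|nDp] := pselect (D p); last by exists y.
  have [|z ?] := @path_lift_exists (Q \o seg p) y (cover_seg Dp (lexx 0) (lexx 1)).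
    by rewrite /= seg0.
  by exists z.
exists l; last by move=> p z Dp; apply: uniq => //; exact: Hl.
split; last first.
  move=> p Dp; have [k [_ Qk] [_ <-]] := Hl p Dp.
  by rewrite -{1}(seg1 p); apply: (Qk 1); rewrite /= in_itv/=; lra.
move=> p Dp e e0; have [e1 e10] := path_good Dp (Hl p Dp) e0.
apply: filterS => p' H Dp'; have [||z' yz' z'p] := H Dp' y.
- by rewrite seg0.
- by rewrite dxx.
by rewrite (uniq _ _ _ Dp' (Hl p' Dp') yz').
Qed.

(** The root over [p] is carried back to the centre along the reversed segment; the lift from there,
    formed by the ends of all lifted segments, returns to it. *)
Lemma star_lift p y : D p -> Q p y -> exists2 l, lift_on D Q l & l p = y.
Proof.
move=> Dp Qy.
have rev_c : continuous (fun u : R => 1 - u).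
  by move=> u; apply: cvgB; [exact: cvg_cst|exact: cvg_id].
have rev01 (u : R) : `[0, 1]%classic u -> `[0, 1]%classic (1 - u).
  by rewrite /= !in_itv /=; lra.
have cr : covering (`[0, 1]%classic : set R) (Q \o seg p \o (fun u => 1 - u)).
  by apply: covering_comp (cover_seg Dp (lexx 0) (lexx 1)).
have [|z [k lk [k0 k1]]] := path_lift_exists cr (y := y).
  by rewrite /= subr0 seg1.
have Qz : Q c z.
  rewrite -k1 -(seg0 p); have := lk.2 1; rewrite /= subrr; apply.
  by rewrite in_itv/=; lra.
have [l ll Hl] := star_lift_center Qz; exists l => //; apply: (Hl) => //.
exists (k \o (fun u => 1 - u)); last by rewrite /= subr0 subrr.
have := lift_comp rev_c rev01 lk; rewrite /comp; congr lift_on.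
by apply/funext => u; rewrite subKr.
Qed.
End Star.
End Covering.

(** * Angles in the plane *)

Section ContinuityAt.
Variables (R : realType) (T : topologicalType) (x : T).

Definition cont_at (U : topologicalType) (f : T -> U) := f @ x --> f x.

Lemma cont_at_cst (U : topologicalType) (c : U) : cont_at (fun _ => c).
Proof. exact: cvg_cst. Qed.

Lemma cont_at_id : @cont_at T (fun y => y).
Proof. exact: cvg_id. Qed.

Lemma cont_at_comp (U V : topologicalType) (g : U -> V) (f : T -> U) :
  continuous g -> cont_at f -> cont_at (fun y => g (f y)).
Proof. by move=> cg cf; apply: (cvg_comp _ _ cf); exact: cg. Qed.

Lemma cont_at_fst (U V : topologicalType) (f : T -> U * V) :
  cont_at f -> cont_at (fun y => (f y).1).
Proof. by apply: (cont_at_comp (g := fst)) => -[u v]; exact: cvg_fst. Qed.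

Lemma cont_at_snd (U V : topologicalType) (f : T -> U * V) :
  cont_at f -> cont_at (fun y => (f y).2).
Proof. by apply: (cont_at_comp (g := snd)) => -[u v]; exact: cvg_snd. Qed.

Lemma cont_at_pair (U V : topologicalType) (f : T -> U) (g : T -> V) :
  cont_at f -> cont_at g -> cont_at (fun y => (f y, g y)).
Proof. exact: cvg_pair. Qed.

Variables f g : T -> R.
Hypotheses (cf : cont_at f) (cg : cont_at g).

Lemma cont_at_add : cont_at (fun y => f y + g y). Proof. exact: cvgD. Qed.
Lemma cont_at_opp : cont_at (fun y => - f y). Proof. exact: cvgN. Qed.
Lemma cont_at_mul : cont_at (fun y => f y * g y). Proof. exact: cvgM. Qed.
Lemma cont_at_exp n : cont_at (fun y => f y ^+ n).
Proof. exact: (cont_at_comp (@exprn_continuous _ n) cf). Qed.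
Lemma cont_at_inv : f x != 0 -> cont_at (fun y => (f y)^-1).
Proof. by move=> a0; exact: cvgV. Qed.
Lemma cont_at_norm : cont_at (fun y => `|f y|). Proof. exact: cvg_norm. Qed.
Lemma cont_at_sin : cont_at (fun y => sin (f y)).
Proof. exact: (cont_at_comp (@continuous_sin _) cf). Qed.
Lemma cont_at_cos : cont_at (fun y => cos (f y)).
Proof. exact: (cont_at_comp (@continuous_cos _) cf). Qed.
Lemma cont_at_atan : cont_at (fun y => atan (f y)).
Proof. exact: (cont_at_comp (@continuous_atan _) cf). Qed.
Lemma cont_at_sqrt : cont_at (fun y => Num.sqrt (f y)).
Proof. exact: (cont_at_comp (@sqrt_continuous _) cf). Qed.
Lemma cont_at_max : cont_at (fun y => Num.max (f y) (g y)).
Proof.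
rewrite /cont_at.
have maxE (a b : R) : Num.max a b = (a + b + `|a - b|) / 2 by case: ltrgtP; lra.
under eq_fun do rewrite maxE; rewrite maxE.
apply: cvgM; last exact: cvg_cst.
by apply: cvgD; [exact: cvgD|apply: cvg_norm; exact: cvgB].
Qed.
Lemma cont_at_min : cont_at (fun y => Num.min (f y) (g y)).
Proof.
rewrite /cont_at.
have minE (a b : R) : Num.min a b = (a + b - `|a - b|) / 2 by case: ltrgtP; lra.
under eq_fun do rewrite minE; rewrite minE.
apply: cvgM; last exact: cvg_cst.
by apply: cvgB; [exact: cvgD|apply: cvg_norm; exact: cvgB].
Qed.
End ContinuityAt.

Lemma continuousI (T U : topologicalType) (f : T -> U) :
  (forall x, cont_at x f) -> continuous f.
Proof. by []. Qed.

Ltac cts_at :=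
  cbn beta;
  match goal with
  | |- cont_at _ (fun _ => ?c) => exact: cont_at_cst
  | |- cont_at _ (fun y => y) => exact: cont_at_id
  | |- cont_at ?x (fun y => (@?f y, @?g y)) =>
    apply: (@cont_at_pair _ x _ _ f g); cts_at
  | |- cont_at ?x (fun y => @fst _ _ (@?f y)) => apply: (@cont_at_fst _ x _ _ f); cts_at
  | |- cont_at ?x (fun y => @snd _ _ (@?f y)) => apply: (@cont_at_snd _ x _ _ f); cts_at
  | |- cont_at ?x (fun y => @?f y + @?g y) => apply: (@cont_at_add _ _ x f g); cts_at
  | |- cont_at ?x (fun y => - @?f y) => apply: (@cont_at_opp _ _ x f); cts_at
  | |- cont_at ?x (fun y => @?f y * @?g y) => apply: (@cont_at_mul _ _ x f g); cts_at
  | |- cont_at ?x (fun y => @?f y ^+ ?n) => apply: (@cont_at_exp _ _ x f _ n); cts_at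
  | |- cont_at ?x (fun y => (@?f y)^-1) => apply: (@cont_at_inv _ _ x f); cts_at
  | |- cont_at ?x (fun y => `|@?f y|) => apply: (@cont_at_norm _ _ x f); cts_at
  | |- cont_at ?x (fun y => sin (@?f y)) => apply: (@cont_at_sin _ _ x f); cts_at
  | |- cont_at ?x (fun y => cos (@?f y)) => apply: (@cont_at_cos _ _ x f); cts_at
  | |- cont_at ?x (fun y => atan (@?f y)) => apply: (@cont_at_atan _ _ x f); cts_at
  | |- cont_at ?x (fun y => Num.sqrt (@?f y)) => apply: (@cont_at_sqrt _ _ x f); cts_at
  | |- cont_at ?x (fun y => Num.max (@?f y) (@?g y)) =>
    apply: (@cont_at_max _ _ x f g); cts_at
  | |- cont_at ?x (fun y => Num.min (@?f y) (@?g y)) =>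
    apply: (@cont_at_min _ _ x f g); cts_at
  | H : continuous ?h |- cont_at ?x (fun y => ?h (@?f y)) =>
    apply: (@cont_at_comp _ x _ _ h f H); cts_at
  | H : continuous ?h |- cont_at ?x ?h => exact: H
  | _ => first [assumption | idtac]
  end.
Ltac cts := apply: continuousI => ?; cts_at.

Section Angle.
Variable R : realType.
Implicit Types (v : R * R) (t : R).

Definition vlen v : R := Num.sqrt (v.1 ^+ 2 + v.2 ^+ 2).

(** Every real number is an angle of the zero vector. *)
Definition is_angle v t := v = (vlen v * cos t, vlen v * sin t).

Lemma vlen_ge0 v : 0 <= vlen v. Proof. exact: sqrtr_ge0. Qed.

Lemma vlen_sqr v : vlen v ^+ 2 = v.1 ^+ 2 + v.2 ^+ 2.
Proof. by rewrite sqr_sqrtr// addr_ge0// sqr_ge0. Qed.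

Lemma vlen_gt0 v : v != (0, 0) -> 0 < vlen v.
Proof.
case: v => x y /= vN0; rewrite sqrtr_gt0 /= lt0r addr_ge0 ?sqr_ge0 ?andbT //.
by rewrite paddr_eq0 ?sqr_ge0// !sqrf_eq0 -xpair_eqE.
Qed.

Lemma vlen_polar (r t : R) : 0 <= r -> vlen (r * cos t, r * sin t) = r.
Proof.
by move=> r0; rewrite /vlen /= !exprMn -mulrDr cos2Dsin2 mulr1 sqrtr_sqr ger0_norm.
Qed.

Lemma is_angle_polar (r t : R) : 0 <= r -> is_angle (r * cos t, r * sin t) t.
Proof. by move=> r0; rewrite /is_angle vlen_polar. Qed.

Lemma sin_eq0_cos1 (x : R) : cos x = 1 -> sin x = 0.
Proof. by move=> c1; apply: cos1sin0; rewrite c1 normr1. Qed.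

Lemma cos_lt1 (x : R) : x != 0 -> `|x| < 2 * pi -> cos x < 1.
Proof.
move=> x0 x2; rewrite -cos_norm.
have {x0} : 0 < `|x| by rewrite normr_gt0.
move: `|x| x2 => y y2 y0.
have -> : y = y / 2 *+ 2 by rewrite mulr2n; lra.
rewrite cos_mulr2n cos2sin2.
have : 0 < sin (y / 2) ^+ 2 by rewrite exprn_gt0// sin_gt0_pi//; lra.
by rewrite mulr2n; lra.
Qed.

Lemma cos_eq1_small (x : R) : cos x = 1 -> `|x| < 2 * pi -> x = 0.
Proof.
move=> c1 x2; apply/eqP/contraT => x0.
by have := cos_lt1 x0 x2; rewrite c1 ltxx.
Qed.

Lemma cos_sin_eq (s t : R) : cos (s - t) = 1 -> cos s = cos t /\ sin s = sin t.
Proof.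
move=> c1; have s0 := sin_eq0_cos1 c1.
have := sinD t (s - t); have := cosD t (s - t).
by rewrite c1 s0 addrCA subrr addr0 => -> ->; split; ring.
Qed.

Lemma angle_unique v s t : v != (0, 0) -> is_angle v s -> is_angle v t ->
  cos (s - t) = 1.
Proof.
move=> v0 vs vt; have l0 := vlen_gt0 v0.
have [] : (vlen v * cos s, vlen v * sin s) = (vlen v * cos t, vlen v * sin t).
  by rewrite -vs -vt.
move=> /(mulfI (lt0r_neq0 l0)) cE /(mulfI (lt0r_neq0 l0)) sE.
by rewrite cosB cE sE -!expr2 cos2Dsin2.
Qed.

Lemma is_angle_eq v s t : cos (s - t) = 1 -> is_angle v s -> is_angle v t.
Proof. by move=> /cos_sin_eq[c1 s1]; rewrite /is_angle c1 s1. Qed.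

Lemma atan_polar (C D : R) : 0 < D ->
  D = vlen (D, C) * cos (atan (C / D)) /\ C = vlen (D, C) * sin (atan (C / D)).
Proof.
move=> D0; have DN0 : D != 0 by rewrite gt_eqF.
have l0 : 0 < vlen (D, C) by rewrite vlen_gt0// xpair_eqE negb_and DN0.
have cE : cos (atan (C / D)) = D / vlen (D, C).
  rewrite cos_atan; have -> : 1 + (C / D) ^+ 2 = (vlen (D, C) / D) ^+ 2.
    by rewrite [RHS]exprMn vlen_sqr /=; field.
  by rewrite sqrtr_sqr ger0_norm ?invf_div// divr_ge0 ?ltW.
have cN0 : cos (atan (C / D)) != 0 by rewrite cE mulf_neq0// invr_eq0 gt_eqF.
have sE : sin (atan (C / D)) = C / vlen (D, C).
  have := atanK (C / D); rewrite /tan => /(congr1 ( *%R^~ (cos (atan (C / D))))).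
  rewrite mulfVK // => ->; rewrite cE; field.
  by rewrite DN0 gt_eqF.
by rewrite cE sE; split; field; rewrite gt_eqF.
Qed.

Lemma angle_pi v : exists t, - pi <= t <= pi /\ is_angle v t.
Proof.
have [->|vN0] := eqVneq v (0, 0).
  exists 0; split; first by have := @pi_gt0 R; lra.
  by rewrite /is_angle /vlen /= expr0n /= addr0 sqrtr0 !mul0r.
have l0 := vlen_gt0 vN0; have lE := vlen_sqr v.
have lN0 : vlen v != 0 by rewrite gt_eqF.
have x1 : -1 <= v.1 / vlen v <= 1.
  rewrite -ler_norml -(ler_pXn2r (n := 2)) ?nnegrE// expr1n real_normK ?num_real//.
  by rewrite exprMn exprVn lE ler_pdivrMr -?lE ?exprn_gt0// mul1r lE lerDl sqr_ge0.
have sE : Num.sqrt (1 - (v.1 / vlen v) ^+ 2) = `|v.2| / vlen v.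
  have -> : 1 - (v.1 / vlen v) ^+ 2 = (`|v.2| / vlen v) ^+ 2.
    rewrite !exprMn !exprVn real_normK ?num_real//.
    by apply: (mulIf (expf_neq0 2 lN0)); rewrite mulrBl mul1r !mulfVK ?expf_neq0// lE; ring.
  by rewrite sqrtr_sqr ger0_norm// divr_ge0// ltW.
case: v l0 lN0 x1 sE {lE vN0} => x y /= l0 lN0 x1 sE.
have [y0|y0] := leP 0 y.
  exists (acos (x / vlen (x, y))).
  have := acos_ge0 x1; have := acos_lepi x1; split; first by have := @pi_gt0 R; lra.
  rewrite /is_angle sin_acos// acosK ?in_itv//= sE.
  by rewrite ger0_norm//; congr pair; field.
exists (- acos (x / vlen (x, y))).
have := acos_ge0 x1; have := acos_lepi x1; split; first by have := @pi_gt0 R; lra.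
rewrite /is_angle sinN cosN sin_acos// acosK ?in_itv//= sE.
by rewrite ltr0_norm//; congr pair; field.
Qed.

Lemma angle_exists v : exists t, is_angle v t.
Proof. by have [t [_ ?]] := angle_pi v; exists t. Qed.

Definition dot (u v : R * R) : R := u.1 * v.1 + u.2 * v.2.
Definition cross (u v : R * R) : R := u.1 * v.2 - u.2 * v.1.

(** The oriented angle from [u] to [v], as long as it is acute, is the arctangent of the cross
    product over the dot product. This shows how angles vary with the vector, hence that they cover
    the punctured plane. *)
Lemma is_angle_rot u v s : u != (0, 0) -> 0 < dot u v -> is_angle u s ->
  is_angle v (s + atan (cross u v / dot u v)).
Proof.
move=> u0 uv us; have l0 := vlen_gt0 u0.
pose D := cos s * v.1 + sin s * v.2; pose C := cos s * v.2 - sin s * v.1.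
have dE : dot u v = vlen u * D by rewrite /dot us vlen_polar ?vlen_ge0 // /D /=; ring.
have cE : cross u v = vlen u * C by rewrite /cross us vlen_polar ?vlen_ge0 // /C /=; ring.
have D0 : 0 < D by move: uv; rewrite dE pmulr_rgt0.
have -> : cross u v / dot u v = C / D by rewrite dE cE; field; rewrite !gt_eqF.
have [DE CE] := atan_polar C D0.
have vE : vlen (D, C) = vlen v.
  rewrite /vlen /=; congr Num.sqrt; rewrite /D /C.
  have := cos2Dsin2 s; move: (cos s) (sin s) => c k ck.
  by transitivity ((c ^+ 2 + k ^+ 2) * (v.1 ^+ 2 + v.2 ^+ 2)); [ring|rewrite ck mul1r].
rewrite vE in DE CE; rewrite /is_angle cosD sinD.
have cs := cos2Dsin2 s; move: DE CE.
move: (cos (atan _)) (sin (atan _)) (vlen v) => a b L DE CE.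
have -> : L * (cos s * a - sin s * b) = cos s * D - sin s * C by rewrite DE CE; ring.
have -> : L * (sin s * a + cos s * b) = sin s * D + cos s * C by rewrite DE CE; ring.
rewrite (surjective_pairing v) /=; congr pair; rewrite /C /D.
  by rewrite -[LHS]mul1r -cs; ring.
by rewrite -[LHS]mul1r -cs; ring.
Qed.

Definition rdist (x y : R) := `|x - y|.

Lemma rdistxx y : rdist y y = 0. Proof. by rewrite /rdist subrr normr0. Qed.
Lemma rdistC y z : rdist y z = rdist z y. Proof. exact: distrC. Qed.
Lemma rdistD y z t : rdist y t <= rdist y z + rdist z t. Proof. exact: ler_distD. Qed.
Lemma rdist0 y z : rdist y z <= 0 -> y = z.
Proof. by rewrite /rdist normr_le0 subr_eq0 => /eqP. Qed.

Lemma angle_covering : covering rdist [set v | v != (0, 0)] is_angle.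
Proof.
move=> b /= b0; split; last first.
  exists 1 => //; near=> c => c0 y z cy cz yz.
  apply/eqP; rewrite -subr_eq0; apply/eqP/cos_eq1_small; first exact: angle_unique cy cz.
  by apply: (lt_le_trans yz); move: (@pi_ge2 R); lra.
move=> e e0.
have bb : 0 < dot b b by rewrite /dot -!expr2 -vlen_sqr exprn_gt0// vlen_gt0.
have cd : dot b c @[c --> b] --> dot b b by have : cont_at b (dot b) by rewrite /dot; cts_at.
have ca : atan (cross b c / dot b c) @[c --> b] --> atan (cross b b / dot b b).
  suff : cont_at b (fun c => atan (cross b c / dot b c)) by [].
  by rewrite /cross /dot; cts_at; rewrite gt_eqF.
have a0 : atan (cross b b / dot b b) = 0.
  by have -> : cross b b = 0; [rewrite /cross; ring|rewrite mul0r atan0].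
rewrite a0 in ca.
near=> c => c0.
have d0 : 0 < dot b c by near: c; exact: cvgr_gt cd _ bb.
have ae : `|atan (cross b c / dot b c)| < e.
  rewrite -[X in `|X|]subr0 distrC; near: c.
  by move: ca => /cvgr_dist_lt; apply.
split=> y by_.
  exists (y + atan (cross b c / dot b c)); first exact: is_angle_rot.
  by rewrite /rdist addrAC subrr add0r.
exists (y + atan (cross c b / dot c b)).
  by apply: is_angle_rot => //; rewrite /dot (mulrC c.1) (mulrC c.2).
have -> : cross c b / dot c b = - (cross b c / dot b c).
  have -> : cross c b = - cross b c by rewrite /cross; ring.
  by rewrite mulNr /dot (mulrC c.1) (mulrC c.2).
by rewrite atanN /rdist opprD opprK addrA subrr add0r.
Unshelve. all: by end_near. Qed.

Lemma angle_lift (V : normedModType R) (f : V -> R * R) :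
  continuous f -> (forall x, f x != (0, 0)) ->
  exists2 t : V -> R, continuous t & forall x, is_angle (f x) (t x).
Proof.
move=> cf f0; have [t0 t0P] := angle_exists (f 0).
have cov : covering rdist setT (is_angle \o f).
  by apply: covering_comp angle_covering => // x _; exact: f0.
have [t [ct At] _] := @star_lift R R rdist rdistxx rdistC rdistD rdist0 V setT 0
  (is_angle \o f) (fun _ _ _ _ => I) cov 0 t0 I t0P.
exists t; last by move=> x; exact: At.
move=> x; apply/cvgrPdist_lt => e e0; have := ct x I e e0.
by apply: filterS => y /(_ I); rewrite /rdist distrC.
Qed.
End Angle.

(** * Extension and separation in the plane *)

Section Extension.
Variable R : realType.

(** A continuous map from a compact set to a Hausdorff space is closed, hence a quotient map onto
    its image. *)
Lemma factor_within (S T Z : topologicalType) (C : set S) (g : S -> T) (f : S -> Z)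
    (F : T -> Z) :
  hausdorff_space T -> compact C -> closed C -> continuous g -> continuous f ->
  (forall s, C s -> F (g s) = f s) -> {within g @` C, continuous F}.
Proof.
move=> hT cC clC cg cf Ff; apply/subspace_continuousP => x [s Cs <-] B.
rewrite nbhsE => -[W [oW Wfs] WB].
pose E := C `&` f @^-1` (~` W).
have cE : compact E.
  apply: (subclosed_compact _ cC); last by move=> ? [].
  by apply: closedI => //; apply: preimage_closed => //; exact: open_closedC.
have clgE : closed (g @` E).
  apply: compact_closed => //; apply: continuous_compact => //.
  exact: continuous_subspaceT.
have : nbhs (g s) (~` (g @` E)).
  apply: open_nbhs_nbhs; split; first exact: closed_openC.
  by move=> [t [Ct /= Wft] gts]; apply: Wft; rewrite -(Ff t Ct) gts.
apply: filterS => y nEy [t Ct gt]; apply: WB; apply: contrapT => nW.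
by apply: nEy; exists t => //; split => //=; rewrite -Ff// gt.
Qed.

Lemma bigcup_within (T Z : topologicalType) (K : finType) (A : K -> set T) (F : T -> Z) :
  (forall k, closed (A k)) -> (forall k, {within A k, continuous F}) ->
  {within \bigcup_k A k, continuous F}.
Proof.
move=> clA cF; apply/subspace_continuousP => x _ B BFx.
have : \forall y \near x, forall k, A k y -> B (F y).
  apply: filter_forall => k; have [Akx|nAkx] := pselect (A k x).
    exact: (((subspace_continuousP _ _).1 (cF k)) x Akx B BFx).
  have : nbhs x (~` A k) by apply: open_nbhs_nbhs; split => //; exact: closed_openC.
  by apply: filterS => y nAy /nAy.
by apply: filterS => y H [k _ /H].
Qed.

Lemma bigcup_compact_fin (T : topologicalType) (K : finType) (A : K -> set T) :
  (forall k, compact (A k)) -> compact (\bigcup_k A k).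
Proof.
move=> cA.
have -> : \bigcup_k A k = \bigcup_(k in [set` enum K]) A k.
  by apply/seteqP; split=> x [k _ Akx]; exists k => //=; rewrite mem_enum.
by rewrite bigcup_seq; apply: bigsetU_compact => k _.
Qed.

(** The compatibility condition defines the function on the union of the curves, a compact set;
    Tietze's theorem extends it to the plane. *)
Lemma curve_extension (K : finType) (g : K -> R -> R * R) (f : K -> R -> R) :
  (forall k, continuous (g k)) -> (forall k, continuous (f k)) ->
  (forall k l s t, 0 <= s <= 1 -> 0 <= t <= 1 -> g k s = g l t -> f k s = f l t) ->
  exists2 F : R * R -> R, continuous F &
    forall k s, 0 <= s <= 1 -> F (g k s) = f k s.
Proof.
move=> cg cf fg.
pose C : set R := `[0, 1]%classic.
have inC s : C s = (0 <= s <= 1) :> Prop by rewrite /C /= in_itv.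
have cC : compact C by exact: segment_compact.
have clC : closed C by exact: itv_closed.
have hT : hausdorff_space (R * R)%type by exact: norm_hausdorff.
have /choice[F0 HF0] : forall x, exists y, forall k s, C s -> g k s = x -> y = f k s.
  move=> x; have [[k [s [Cs gx]]]|nx] := pselect (exists k s, C s /\ g k s = x).
    exists (f k s) => l t Ct gt; apply: fg; rewrite -?inC//.
    by rewrite gx gt.
  by exists 0 => k s Cs gx; exfalso; apply: nx; exists k, s.
pose A k := g k @` C.
have cA k : compact (A k) by apply: continuous_compact => //; exact: continuous_subspaceT.
have clA k : closed (A k) by exact: compact_closed.
have cF0 : {within \bigcup_k A k, continuous F0}.
  apply: bigcup_within => // k.
  by apply: factor_within => // s Cs; exact: HF0.
have cX : compact (\bigcup_k A k) by exact: bigcup_compact_fin.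
have clX : closed (\bigcup_k A k) by exact: compact_closed.
have [M [M0 HM]] : exists M, 0 < M /\ forall x, (\bigcup_k A k) x -> `|F0 x| <= M.
  have /compact_bounded[N [Nreal HN]] : compact (F0 @` (\bigcup_k A k)).
    exact: continuous_compact.
  exists (`|N| + 1); split; first by rewrite ltr_wpDl.
  move=> x Xx; apply: (HN (`|N| + 1)); last by exists x.
  by rewrite (le_lt_trans (ler_norm N))// ltrDl.
have [F [FE cF _]] := continuous_bounded_extension
  (@pseudometric_normal R (R * R)%type) clX M0 cF0 HM.
exists F => // k s s01; rewrite -FE; first by apply: HF0 => //; rewrite inC.
by apply/mem_set; exists k => //; exists s => //; rewrite inC.
Qed.

Lemma cont_at_glue (T Z : topologicalType) (f g1 g2 : T -> Z) x :
  cont_at x g1 -> cont_at x g2 -> g1 x = f x -> g2 x = f x ->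
  (forall y, f y = g1 y \/ f y = g2 y) -> cont_at x f.
Proof.
move=> c1 c2 e1 e2 H B Bf.
have H1 : nbhs x (g1 @^-1` B) by apply: c1; rewrite e1.
have H2 : nbhs x (g2 @^-1` B) by apply: c2; rewrite e2.
suff : nbhs x (f @^-1` B) by [].
by move: H1 H2; apply: filterS2 => y /= ? ?; case: (H y) => ->.
Qed.

Lemma cont_at_near (T Z : topologicalType) (f g : T -> Z) x :
  cont_at x g -> (\forall y \near x, f y = g y) -> cont_at x f.
Proof.
move=> cg fg B Bf.
have H : nbhs x (g @^-1` B) by apply: cg; rewrite -(nbhs_singleton fg).
suff : nbhs x (f @^-1` B) by [].
by move: H fg; apply: filterS2 => y /= ? ->.
Qed.
End Extension.

(** * Eilenberg's separation criterion *)

Section Eilenberg.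
Variable R : realType.
Implicit Types (p q z : R * R).

Definition subp (z p : R * R) : R * R := (z.1 - p.1, z.2 - p.2).
Definition unitv z : R * R := (z.1 / vlen z, z.2 / vlen z).
Definition plane_rot (t : R) z : R * R :=
  (cos t * z.1 - sin t * z.2, sin t * z.1 + cos t * z.2).

Lemma subp_neq0 z p : z <> p -> subp z p != (0, 0).
Proof.
case: z p => [a b] [c d] zp; apply/eqP => -[]/= /eqP; rewrite subr_eq0 => /eqP ac.
by move/eqP; rewrite subr_eq0 => /eqP bd; apply: zp; rewrite ac bd.
Qed.

Lemma unitv_angle z t : z != (0, 0) -> is_angle z t -> unitv z = (cos t, sin t).
Proof.
move=> z0 zt; have l0 := vlen_gt0 z0; rewrite /unitv {1 3}zt /=.
by rewrite mulrC mulKf ?gt_eqF// [in X in (_, X)]mulrC mulKf ?gt_eqF.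
Qed.

Lemma angle_unitv_eq (t s : R) : is_angle (cos s, sin s) t -> cos t = cos s /\ sin t = sin s.
Proof.
have -> : (cos s, sin s) = (1 * cos s, 1 * sin s) by rewrite !mul1r.
by rewrite /is_angle vlen_polar ?ler01// !mul1r => -[-> ->].
Qed.

Lemma cont_at_unitv p z : z <> p -> cont_at z (fun z => unitv (subp z p)).
Proof.
move=> /subp_neq0 /vlen_gt0 z0; rewrite /unitv /subp /vlen /=; cts_at.
all: by move: z0; rewrite /vlen /subp /= => /gt_eqF ->.
Qed.

Lemma vlen_ge_coord z : `|z.1| <= vlen z /\ `|z.2| <= vlen z.
Proof.
rewrite -!sqrtr_sqr; split; apply: ler_wsqrtr; first by rewrite lerDl sqr_ge0.
by rewrite lerDr sqr_ge0.
Qed.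

Lemma dot_le (u v : R * R) : dot u v <= vlen u * vlen v.
Proof.
have uv0 : 0 <= vlen u * vlen v by rewrite mulr_ge0 ?vlen_ge0.
have [d0|d0] := leP (dot u v) 0; first exact: le_trans uv0.
rewrite -ler_sqr ?nnegrE//; last exact: ltW.
rewrite exprMn !vlen_sqr /dot.
rewrite -subr_ge0.
have -> : (u.1 ^+ 2 + u.2 ^+ 2) * (v.1 ^+ 2 + v.2 ^+ 2) -
  (u.1 * v.1 + u.2 * v.2) ^+ 2 = (u.1 * v.2 - u.2 * v.1) ^+ 2 by ring.
exact: sqr_ge0.
Qed.

(** The direction from [q], turned by [psi], agrees outside [U] and [V] with the direction from [p].
    Using the former on [U] and the latter elsewhere gives a field without zeros on the plane, which
    has a continuous angle. But a large circle lies in [V], and there the direction from [p] winds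
    once. *)
Lemma eilenberg_aux (U V : set (R * R)) p q (psi : R * R -> R) rho :
  open U -> open V -> U `&` V = set0 -> U p -> V q -> continuous psi ->
  (forall z, ~ U z -> ~ V z -> exists a b,
     [/\ is_angle (subp z p) a, is_angle (subp z q) b & psi z = a - b]) ->
  vlen p < rho -> (forall z, ~ U z -> ~ V z -> vlen z < rho) -> V (rho, 0) -> False.
Proof.
move=> oU oV UV Up Vq cpsi Hpsi prho Xrho Vrho.
have rho0 : 0 < rho by rewrite (le_lt_trans (vlen_ge0 p)).
have UVF z : U z -> V z -> False by move=> Uz Vz; have : (U `&` V) z by []; rewrite UV.
pose g1 z := plane_rot (psi z) (unitv (subp z q)).
pose g2 z := unitv (subp z p).
have cg1 z : z <> q -> cont_at z g1.
  move=> zq; have c1 := cont_at_unitv zq; have c2 : cont_at z psi by exact: cpsi.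
  rewrite /g1 /plane_rot.
  by cts_at.
have cg2 z : z <> p -> cont_at z g2 by exact: cont_at_unitv.
have [f fU fV] : exists2 f : R * R -> R * R, forall z, U z -> f z = g1 z &
    forall z, ~ U z -> f z = g2 z.
  exists (fun z => if pselect (U z) then g1 z else g2 z) => z; by case: pselect.
have g12 z : ~ U z -> ~ V z -> g1 z = g2 z.
  move=> nU nV; have [a [b [za zb pE]]] := Hpsi z nU nV.
  have zp : subp z p != (0, 0) by apply: subp_neq0 => zp; apply: nU; rewrite zp.
  have zq : subp z q != (0, 0) by apply: subp_neq0 => zq; apply: nV; rewrite zq.
  rewrite /g1 /g2 (unitv_angle zp za) (unitv_angle zq zb) /plane_rot /= pE.
  have cs := cos2Dsin2 b; rewrite cosB sinB; move: cs.
  move: (cos a) (sin a) (cos b) (sin b) => x y c s cs.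
  by congr pair; [rewrite -[RHS]mul1r -cs|rewrite -[RHS]mul1r -cs]; ring.
have cf : continuous f.
  move=> z; have [Uz|nUz] := pselect (U z).
    apply: (@cont_at_near _ _ _ g1).
      by apply: cg1 => zq; apply: (UVF z) => //; rewrite zq.
    have := open_nbhs_nbhs (conj oU Uz); apply: filterS => y; exact: fU.
  have [Vz|nVz] := pselect (V z).
    apply: (@cont_at_near _ _ _ g2).
      by apply: cg2 => zp; apply: (UVF z) => //; rewrite zp.
    have := open_nbhs_nbhs (conj oV Vz); apply: filterS => y Vy.
    by apply: fV => Uy; exact: (UVF y).
  apply: (@cont_at_glue _ _ _ g1 g2).
  - by apply: cg1 => zq; apply: nVz; rewrite zq.
  - by apply: cg2 => zp; apply: nUz; rewrite zp.
  - by rewrite fV// g12.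
  - by rewrite fV.
  - by move=> y; have [Uy|nUy] := pselect (U y); [left; exact: fU|right; exact: fV].
have f0 z : f z != (0, 0).
  have unit0 (x : R * R) : x != (0, 0) -> exists t, unitv x = (cos t, sin t).
    by move=> x0; have [t xt] := angle_exists x; exists t; exact: unitv_angle.
  have cs0 (t : R) : (cos t, sin t) != (0, 0).
    apply/eqP => -[c0 s0]; have := cos2Dsin2 t; rewrite c0 s0 expr0n /= addr0.
    by move/eqP; rewrite eq_sym oner_eq0.
  have [Uz|nUz] := pselect (U z).
    have zq : subp z q != (0, 0) by apply: subp_neq0 => zq; apply: (UVF z) => //; rewrite zq.
    have [t tE] := unit0 _ zq; rewrite fU// /g1 tE /plane_rot /=.
    by rewrite -cosD -sinD cs0.
  have zp : subp z p != (0, 0) by apply: subp_neq0 => zp; apply: nUz; rewrite zp.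
  by have [t tE] := unit0 _ zp; rewrite fV// /g2 tE cs0.
have [th cth thP] := angle_lift cf f0.
pose c s := (rho * cos s, rho * sin s) : R * R.
have cc : continuous c by rewrite /c; cts.
have lc s : vlen (c s) = rho by rewrite vlen_polar// ltW.
have Vc s : 0 <= s <= 2 * pi -> V (c s).
  move=> s2.
  apply: (@connected_induction _ (`[0, 2 * pi]%classic : set R) (fun s => V (c s)) 0).
  - exact: segment_connected.
  - by rewrite /= in_itv /= lexx mulr_ge0 ?pi_ge0.
  - by rewrite /c cos0 sin0 mulr1 mulr0.
  - move=> x _ Vx; have := near_comp cc (open_nbhs_nbhs (conj oV Vx)).
    by apply: filterS.
  - move=> x _ nVx; have Ux : U (c x).
      by apply: contrapT => nUx; have := Xrho _ nUx nVx; rewrite lc ltxx.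
    have := near_comp cc (open_nbhs_nbhs (conj oU Ux)).
    by apply: filterS => y Uy _; exact: UVF.
  - by rewrite /= in_itv/=.
pose g s := th (c s) - s.
have cg : continuous g.
  by rewrite /g; cts.
(* As [p] lies inside the circle, the direction from [p] makes an acute angle with the radius. So
   [g] cannot pass from [g 0] to [g 0 - 2 * pi]. *)
have gpos s : 0 <= s <= 2 * pi -> 0 < cos (g s).
  move=> s2; have Vs := Vc s s2.
  have nU : ~ U (c s) by move=> Us; exact: (UVF (c s)).
  have zp : subp (c s) p != (0, 0) by apply: subp_neq0 => zp; apply: nU; rewrite zp.
  have [a aP] := angle_exists (subp (c s) p).
  have := thP (c s); rewrite fV// /g2 (unitv_angle zp aP) => /angle_unitv_eq[c1 s1].
  rewrite /g cosB c1 s1.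
  have l0 := vlen_gt0 zp; rewrite -(pmulr_rgt0 _ l0) mulrDr !mulrA.
  have [e1 e2] : subp (c s) p = (vlen (subp (c s) p) * cos a, vlen (subp (c s) p) * sin a).
    exact: aP.
  rewrite -e1 -e2 /c /=.
  have -> : (rho * cos s - p.1) * cos s + (rho * sin s - p.2) * sin s =
    rho * (cos s ^+ 2 + sin s ^+ 2) - dot p (1 * cos s, 1 * sin s).
    by rewrite /dot /=; ring.
  rewrite cos2Dsin2 mulr1 subr_gt0; apply: (le_lt_trans (dot_le _ _)).
  by rewrite vlen_polar ?ler01// mulr1.
have p0 := @pi_gt0 R.
have g2pi : g (2 * pi) = g 0 - 2 * pi.
  rewrite /g /c; have -> : 2 * pi = pi *+ 2 :> R by rewrite mulr2n; lra.
  by rewrite cos2pi sin2pi cos0 sin0 subr0.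
have := gpos 0; rewrite lexx mulr_ge0 ?pi_ge0// => /(_ isT) g0pos.
have [|||s] := @IVT R g 0 (2 * pi) (g 0 - pi).
- by rewrite mulr_ge0 ?pi_ge0.
- by apply: continuous_subspaceT.
- by rewrite g2pi ge_min le_max; apply/andP; split; apply/orP; [right|left]; lra.
rewrite in_itv /= => s2 gs; have := gpos s s2.
rewrite gs cosB cospi sinpi; lra.
Qed.

(** Whichever of the two sets contains a far point plays the role of [V]; exchanging them negates
    [psi]. *)
Lemma eilenberg (U V : set (R * R)) p q (psi : R * R -> R) M :
  open U -> open V -> U `&` V = set0 -> U p -> V q -> continuous psi ->
  (forall z, ~ U z -> ~ V z -> vlen z <= M) ->
  (forall z, ~ U z -> ~ V z -> exists a b,
     [/\ is_angle (subp z p) a, is_angle (subp z q) b & psi z = a - b]) ->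
  False.
Proof.
move=> oU oV UV Up Vq cpsi HM Hpsi.
pose rho := vlen p + vlen q + `|M| + 1.
have [p0 q0 M0] : [/\ 0 <= vlen p, 0 <= vlen q & M <= `|M|].
  by rewrite !vlen_ge0 ler_norm.
have M1 : 0 <= `|M| by [].
have rho0 : 0 <= rho by rewrite /rho; lra.
have rX z : ~ U z -> ~ V z -> vlen z < rho.
  by move=> nU nV; rewrite (le_lt_trans (HM z nU nV))// /rho; lra.
have [Vr|nVr] := pselect (V (rho, 0)).
  by apply: (@eilenberg_aux U V p q psi rho) => //; rewrite /rho; lra.
have [Ur|nUr] := pselect (U (rho, 0)); last first.
  have := rX _ nUr nVr.
  by rewrite /vlen /= expr0n /= addr0 sqrtr_sqr ger0_norm// ltxx.
apply: (@eilenberg_aux V U q p (fun z => - psi z) rho) => //.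
- by rewrite setIC.
- by cts.
- move=> z nV nU; have [a [b [za zb ->]]] := Hpsi z nU nV; exists b, a; split => //.
  by rewrite opprB.
- by rewrite /rho; lra.
- by move=> z nV nU; exact: rX.
Qed.
End Eilenberg.

(** * Arcs in a half-plane *)

Section HalfPlane.
Variable R : realType.

(** Retraction onto the unit interval: composed with it, an arc becomes a continuous map on the
    whole line. *)
Definition clamp (s : R) : R := Num.max 0 (Num.min 1 s).

Lemma clamp01 s : 0 <= clamp s <= 1.
Proof. by rewrite /clamp le_max lexx /= ge_max ler01 /= ge_min lexx. Qed.

Lemma clamp_id s : 0 <= s <= 1 -> clamp s = s.
Proof.
by move=> /andP[s0 s1]; rewrite /clamp (min_idPr s1); apply/max_idPr.
Qed.

Lemma continuous_clamp : continuous clamp.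
Proof. by rewrite /clamp; cts. Qed.

(** Starting straight down and staying in the closed left half-plane, the direction cannot leave the
    interval of length [pi] below [th 0]: by the intermediate value theorem it would take an angle
    with positive cosine just outside. *)
Lemma angle_quarter (th : R -> R) : continuous th ->
  (forall s, 0 <= s <= 1 -> cos (th s) <= 0) -> cos (th 0) = 0 -> sin (th 0) = -1 ->
  th 0 - pi <= th 1 <= th 0.
Proof.
move=> cth c0 ct0 st0; have p2 := @pi_gt0 R.
have key (e : R) : 0 < e < pi -> 0 < cos (th 0 + e) /\ 0 < cos (th 0 - pi - e).
  move=> e0; have se : 0 < sin e by apply: sin_gt0_pi.
  have cE : cos (th 0 - pi - e) = sin e.
    rewrite -addrA -opprD cosB ct0 st0 mul0r add0r addrC sinDpi; lra.
  by rewrite cosD ct0 st0 cE; split=> //; lra.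
have ivt v : Num.min (th 0) (th 1) <= v <= Num.max (th 0) (th 1) -> cos v <= 0.
  move=> hv; have [c] := IVT ler01 (continuous_subspaceT cth) hv.
  by rewrite in_itv/= => ? <-; exact: c0.
apply/andP; split; rewrite leNgt; apply/negP => lt1.
  pose e := Num.min (th 0 - pi - th 1) (pi / 2).
  have e0 : 0 < e by rewrite lt_min; lra.
  have e1 : e <= th 0 - pi - th 1 by rewrite ge_min lexx.
  have e2 : e <= pi / 2 by rewrite ge_min lexx orbT.
  have [|_] := key e; first by lra.
  rewrite ltNge ivt//.
  by rewrite ge_min le_max; apply/andP; split; apply/orP; [right|left]; lra.
pose e := Num.min (th 1 - th 0) (pi / 2).
have e0 : 0 < e by rewrite lt_min; lra.
have e1 : e <= th 1 - th 0 by rewrite ge_min lexx.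
have e2 : e <= pi / 2 by rewrite ge_min lexx orbT.
have [|+ _] := key e; first by lra.
rewrite ltNge ivt//.
by rewrite ge_min le_max; apply/andP; split; apply/orP; [left|right]; lra.
Qed.

Lemma angle_vertical (r t : R) : is_angle (0, r) t -> r != 0 ->
  cos t = 0 /\ sin t = Num.sg r.
Proof.
move=> [c s] r0; have l0 : vlen (0, r) = `|r|.
  by rewrite /vlen /= expr0n /= add0r sqrtr_sqr.
have nr0 : `|r| != 0 by rewrite normr_eq0.
split; first by move/eqP: c; rewrite eq_sym mulf_eq0 l0 (negPf nr0) /= => /eqP.
by apply: (mulfI nr0); rewrite -{1}l0 -s mulrC -numEsg.
Qed.

Lemma cos_eqN1_small (x : R) : cos x = -1 -> -pi <= x <= 0 -> x = - pi.
Proof.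
move=> cx x1; have p2 := @pi_gt0 R.
have c1 : cos (x + pi) = 1 by rewrite cosDpi cx opprK.
have : x + pi = 0; last lra.
by apply: cos_eq1_small => //; rewrite ger0_norm; lra.
Qed.

(* If the arcs did not meet, the angle of [A s - B t] would wind once along
   the boundary of the square. *)
Lemma arcs_cross (A B : R -> R * R) (a b c d : R) :
  continuous A -> continuous B ->
  (forall s, 0 <= s <= 1 -> 0 <= (A s).1) -> (forall s, 0 <= s <= 1 -> 0 <= (B s).1) ->
  A 0 = (0, a) -> A 1 = (0, b) -> B 0 = (0, c) -> B 1 = (0, d) ->
  a < c -> c < b -> b < d ->
  exists s t, [/\ 0 <= s <= 1, 0 <= t <= 1 & A s = B t].
Proof.
move=> cA cB A0 B0 Aa Ab Bc Bd ac cb bd; apply: contrapT => nAB.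
have cc := continuous_clamp.
pose F (x : R * R) := subp (A (clamp x.1)) (B (clamp x.2)).
have cF : continuous F by rewrite /F /subp; cts.
have F0 x : F x != (0, 0).
  apply: subp_neq0 => AB; apply: nAB; exists (clamp x.1), (clamp x.2).
  by rewrite !clamp01.
have [th cth thP] := angle_lift cF F0.
have FE s t : 0 <= s <= 1 -> 0 <= t <= 1 -> F (s, t) = subp (A s) (B t).
  by move=> s1 t1; rewrite /F /= !clamp_id.
have r0 : 0 <= (0:R) <= 1 by lra.
have r1 : 0 <= (1:R) <= 1 by lra.
have cosF s t : 0 <= s <= 1 -> 0 <= t <= 1 ->
    exists2 l, 0 < l & (A s).1 - (B t).1 = l * cos (th (s, t)).
  move=> s1 t1; exists (vlen (F (s, t))); first exact/vlen_gt0/F0.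
  by have := congr1 fst (thP (s, t)); rewrite {1}FE.
have vert (s t x y : R) : 0 <= s <= 1 -> 0 <= t <= 1 -> A s = (0, x) -> B t = (0, y) ->
    x - y != 0 -> cos (th (s, t)) = 0 /\ sin (th (s, t)) = Num.sg (x - y).
  move=> s1 t1 As Bt; apply: angle_vertical.
  by have := thP (s, t); rewrite FE// As Bt /subp /= subrr.
have [nac nad nbd nbc] : [/\ a - c != 0, a - d != 0, b - d != 0 & b - c != 0].
  by split; apply/eqP; lra.
have [c00 s00] := vert 0 0 _ _ r0 r0 Aa Bc nac.
have [c01 s01] := vert 0 1 _ _ r0 r1 Aa Bd nad.
have [c11 s11] := vert 1 1 _ _ r1 r1 Ab Bd nbd.
have [c10 s10] := vert 1 0 _ _ r1 r0 Ab Bc nbc.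
rewrite ltr0_sg in s00; last lra.
rewrite ltr0_sg in s01; last lra.
rewrite ltr0_sg in s11; last lra.
rewrite gtr0_sg in s10; last lra.
have p2 := @pi_gt0 R.
(* The four sides of the square contribute [0], [0], [- pi], [- pi], although the sum of these
   changes is zero. On each side one of the two points is fixed on the axis, so the difference stays
   in a closed half-plane; the reflection [pi - th] or the reversal [1 - t] brings it to the form of
   [angle_quarter]. *)
have h1 : th (0, 1) = th (0, 0).
  have H1 : continuous (fun t : R => th (0, t)) by cts.
  have H2 t : 0 <= t <= 1 -> cos (th (0, t)) <= 0.
    move=> t1; have [l l0] := cosF 0 t r0 t1; rewrite Aa /= => E.
    by rewrite -(pmulr_rle0 _ l0) -E; have := B0 t t1; clear; lra.
  have h := angle_quarter H1 H2 c00 s00.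
  apply/eqP; rewrite -subr_eq0; apply/eqP/cos_eq1_small.
    by rewrite cosB c01 c00 s01 s00; clear; lra.
  by move: h p2; clear=> h p2; rewrite ler0_norm; lra.
have h2 : th (1, 1) = th (0, 1).
  have H1 : continuous (fun s : R => pi - th (s, 1)) by cts.
  have H2 t : 0 <= t <= 1 -> cos (pi - th (t, 1)) <= 0.
    move=> t1; have [l l0] := cosF t 1 t1 r1; rewrite Bd /= => E.
    rewrite cosB cospi sinpi mul0r addr0 mulN1r oppr_le0 -(pmulr_rge0 _ l0) -E.
    by have := A0 t t1; clear; lra.
  have H3 : cos (pi - th (0, 1)) = 0 by rewrite cosB cospi sinpi c01; clear; lra.
  have H4 : sin (pi - th (0, 1)) = -1 by rewrite sinB cospi sinpi s01; clear; lra.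
  have h := angle_quarter H1 H2 H3 H4.
  apply/eqP; rewrite -subr_eq0; apply/eqP/cos_eq1_small.
    by rewrite cosB c11 c01 s11 s01; clear; lra.
  by move: h p2; clear=> h p2; rewrite ger0_norm; lra.
have h3 : th (1, 0) - th (1, 1) = - pi.
  have H1 : continuous (fun t : R => th (1, 1 - t)) by cts.
  have H2 t : 0 <= t <= 1 -> cos (th (1, 1 - t)) <= 0.
    move=> t1; have t1' : 0 <= 1 - t <= 1 by lra.
    have [l l0] := cosF 1 (1 - t) r1 t1'; rewrite Ab /= => E.
    by rewrite -(pmulr_rle0 _ l0) -E; have := B0 _ t1'; clear; lra.
  have H3 : cos (th (1, 1 - 0)) = 0 by rewrite subr0.
  have H4 : sin (th (1, 1 - 0)) = -1 by rewrite subr0.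
  have := angle_quarter H1 H2 H3 H4.
  rewrite subr0 subrr => h; apply: cos_eqN1_small; last by move: h p2; clear; lra.
  by rewrite cosB c11 c10 s11 s10; clear; lra.
have h4 : th (0, 0) - th (1, 0) = - pi.
  have H1 : continuous (fun s : R => pi - th (s, 0)) by cts.
  have H2 t : 0 <= t <= 1 -> cos (pi - th (t, 0)) <= 0.
    move=> t1; have [l l0] := cosF t 0 t1 r0; rewrite Bc /= => E.
    rewrite cosB cospi sinpi mul0r addr0 mulN1r oppr_le0 -(pmulr_rge0 _ l0) -E.
    by have := A0 t t1; clear; lra.
  have H3 : cos (pi - th (0, 0)) = 0 by rewrite cosB cospi sinpi c00; clear; lra.
  have H4 : sin (pi - th (0, 0)) = -1 by rewrite sinB cospi sinpi s00; clear; lra.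
  have h := angle_quarter H1 H2 H3 H4.
  apply: cos_eqN1_small; last by move: h p2; clear; lra.
  by rewrite cosB c00 c10 s00 s10; clear; lra.
have : pi <= 0 :> R by move: h1 h2 h3 h4; clear; lra.
by rewrite leNgt p2.
Qed.

End HalfPlane.

Section HalfAngle.
Variable R : realType.

(** The principal argument on the closed right half-plane, through the tangent of the half angle:
    unlike the arctangent of the slope, it is continuous also at the nonzero points of the vertical
    axis. *)
Definition half_angle (v : R * R) : R := 2 * atan (v.2 / (v.1 + vlen v)).

Lemma half_angle_den (v : R * R) : 0 <= v.1 -> v != (0, 0) -> 0 < v.1 + vlen v.
Proof. by move=> v1 /vlen_gt0 v0; rewrite ltr_wpDl. Qed.

Lemma half_angleP (v : R * R) : 0 <= v.1 -> v != (0, 0) -> is_angle v (half_angle v).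
Proof.
move=> v1 v0; have D0 := half_angle_den v1 v0.
have [DE CE] := atan_polar v.2 D0; have l2 := vlen_sqr (v.1 + vlen v, v.2).
have L2 := vlen_sqr v; have L0 := vlen_gt0 v0; rewrite /is_angle /half_angle.
have -> : 2 * atan (v.2 / (v.1 + vlen v)) = atan (v.2 / (v.1 + vlen v)) *+ 2.
  by rewrite mulr2n; lra.
rewrite sin_mulr2n mulr2n cosD; move: l2 DE CE; rewrite /=.
move: (vlen (_, _)) (cos _) (sin _) => l x y l2 DE CE.
have l2E : l ^+ 2 = 2 * vlen v * (v.1 + vlen v) by rewrite l2; ring: L2.
have lN0 : l != 0 by apply/eqP => l0; move: D0; rewrite DE l0 mul0r ltxx.
rewrite (surjective_pairing v) -/(vlen v) /=; congr pair.
  apply: (mulfI (expf_neq0 2 lN0)).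
  transitivity (vlen v * ((l * x) ^+ 2 - (l * y) ^+ 2)); last ring.
  by rewrite -DE -CE l2E; ring: L2.
apply: (mulfI (expf_neq0 2 lN0)).
transitivity (vlen v * (2 * (l * x) * (l * y))); last by rewrite mulr2n; ring.
by rewrite -DE -CE l2E; ring.
Qed.

Lemma cont_at_half_angle (v : R * R) : 0 <= v.1 -> v != (0, 0) -> cont_at v half_angle.
Proof.
move=> v1 v0; have D0 := half_angle_den v1 v0.
by move: D0; rewrite /half_angle /vlen => D0; cts_at; rewrite gt_eqF.
Qed.

Lemma half_angle_vertical (y : R) : y != 0 -> half_angle (0, y) = Num.sg y * (pi / 2).
Proof.
move=> y0; rewrite /half_angle /vlen /= expr0n /= !add0r sqrtr_sqr.
case: (ltrgtP y 0) y0 => // y0 _.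
  by rewrite ltr0_norm// ltr0_sg// invrN mulrN divff ?lt_eqF// atanN atan1; lra.
by rewrite gtr0_norm// gtr0_sg// divff ?gt_eqF// atan1; lra.
Qed.
End HalfAngle.

(** The difference of signs at [e] is nonzero exactly when [e] lies between [p] and [q]. The
    hypothesis says that an even number of the points [e], [f] do so, hence both or neither. *)
Lemma same_side_sg (R : realType) (p q e f : R) :
  e != p -> f != p -> e != q -> f != q ->
  ((p - e) * (p - f) < 0) = ((q - e) * (q - f) < 0) ->
  Num.sg (f - p) - Num.sg (f - q) = Num.sg (e - p) - Num.sg (e - q) /\
  [\/ Num.sg (e - p) - Num.sg (e - q) = 0, Num.sg (e - p) - Num.sg (e - q) = 2 |
      Num.sg (e - p) - Num.sg (e - q) = -2].
Proof.
rewrite -[e == p]subr_eq0 -[f == p]subr_eq0 -[e == q]subr_eq0 -[f == q]subr_eq0.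
have sgE (x : R) : x != 0 -> (0 < x /\ Num.sg x = 1) \/ (x < 0 /\ Num.sg x = -1).
  by case: (ltrgtP x 0) => // x0 _; [right; rewrite ltr0_sg|left; rewrite gtr0_sg].
move=> /sgE n0p /sgE n1p /sgE n0q /sgE n1q H {sgE}.
case: n0p => -[i0p ->]; case: n1p => -[i1p ->]; case: n0q => -[i0q ->];
  case: n1q => -[i1q ->].
all: try by split; [lra|first [apply: Or31; lra|apply: Or32; lra|apply: Or33; lra]].
all: exfalso; try lra.
all: try (have : (p - e) * (p - f) < 0 by nra); rewrite ?H.
all: try (have : (q - e) * (q - f) < 0 by nra); rewrite -?H.
all: nra.
Qed.

(** * Complements of disjoint arcs and points in a half-plane *)

Section Page.
Variables (R : realType) (K : finType) (A : K -> R -> R * R).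
Hypothesis cA : forall k, continuous (A k).
Hypothesis clampA : forall k s, A k s = A k (clamp s).
Hypothesis A_ge0 : forall k s, 0 <= (A k s).1.
Hypothesis A_ends : forall k, (A k 0).1 = 0 /\ (A k 1).1 = 0.
Hypothesis A_axis : forall k s, (A k s).1 = 0 -> A k s = A k 0 \/ A k s = A k 1.
Hypothesis A_inj : forall k s t, 0 <= s <= 1 -> 0 <= t <= 1 -> A k s = A k t ->
  s = t \/ forall u, A k u = A k s.
Hypothesis A_disj : forall k l s t, A k s = A l t -> k = l.

Let X : set (R * R) := [set z | exists k s, A k s = z].
Variable P : R * R -> Prop.
Hypothesis locP : forall z, 0 <= z.1 -> ~ X z ->
  (P z -> \forall y \near z, 0 <= y.1 -> ~ X y -> P y) /\
  (~ P z -> \forall y \near z, 0 <= y.1 -> ~ X y -> ~ P y).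

Let XE : X = \bigcup_k A k @` `[0, 1]%classic.
Proof.
apply/seteqP; split=> [z [k [s <-]]|z [k _ [s _ <-]]]; last by exists k, s.
by exists k => //; exists (clamp s); rewrite /= ?in_itv/= ?clamp01 -?clampA.
Qed.

Let compactX : compact X.
Proof.
rewrite XE; apply: bigcup_compact_fin => k; apply: continuous_compact.
  exact: continuous_subspaceT.
exact: segment_compact.
Qed.

Let closedX : closed X.
Proof. by apply: compact_closed => //; exact: norm_hausdorff. Qed.

Let boundX : exists M, forall z, X z -> vlen z <= M.
Proof.
have cv : continuous (@vlen R) by rewrite /vlen; cts.
have /compact_bounded[N [Nreal HN]] : compact (@vlen R @` X).
  by apply: continuous_compact => //; exact: continuous_subspaceT.
exists (`|N| + 1) => z Xz.
have := HN (`|N| + 1); rewrite (le_lt_trans (ler_norm N)) ?ltrDl// => /(_ isT).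
move=> /(_ (vlen z)); rewrite /= ger0_norm ?vlen_ge0//; apply; by exists z.
Qed.

Let xaxis (z : R * R) : z.1 = 0 -> z = (0, z.2).
Proof. by case: z => a b /= ->. Qed.

(** A region of the page that avoids the axis would be separated by the curves from a point of the
    other half-plane. But each curve is an arc or a point, so the argument about any point off the
    curves has a continuous branch on it; the curves being disjoint, Eilenberg's criterion forbids
    the separation. *)
Lemma page_clopen_axis z : 0 <= z.1 -> ~ X z -> P z ->
  exists r, ~ X (0, r) /\ P (0, r).
Proof.
move=> z0 nXz Pz; apply: contrapT => nax.
have axP r : ~ X (0, r) -> ~ P (0, r) by move=> nX Pr; apply: nax; exists r.
have z1 : 0 < z.1.
  rewrite lt0r z0 andbT; apply/eqP => z10; apply: (axP z.2); by rewrite -xaxis.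
have oC : open (~` X) by exact: closed_openC.
pose U := [set y : R * R | [/\ 0 < y.1, ~ X y & P y]].
pose V := ~` X `&` ~` U.
have near_pos (y : R * R) : 0 < y.1 -> \forall w \near y, 0 < w.1.
  move=> y1; have cf : cont_at y (fun w : R * R => w.1) by cts_at.
  exact: (cvgr_gt _ cf).
have near_neg (y : R * R) : y.1 < 0 -> \forall w \near y, w.1 < 0.
  move=> y1; have cf : cont_at y (fun w : R * R => w.1) by cts_at.
  exact: (cvgr_lt _ cf).
have oU : open U.
  rewrite openE => y [y1 nXy Py]; have [+ _] := locP (ltW y1) nXy => /(_ Py).
  move: (near_pos y y1) (open_nbhs_nbhs (conj oC nXy)); apply: filterS3 => w w1 nXw H.
  by split => //; apply: H => //; exact: ltW.
have oV : open V.
  rewrite openE => y [nXy nUy].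
  have nXn := open_nbhs_nbhs (conj oC nXy).
  have [y1|y1] := ltP y.1 0.
    move: (near_neg y y1) nXn; apply: filterS2 => w w1 nXw; split => //.
    by move=> [w1' _ _]; move: w1; rewrite ltNge ltW.
  have nPy : ~ P y.
    move=> Py; move: y1; rewrite le_eqVlt => /orP[/eqP y1|y1]; last exact: nUy.
    by apply: (axP y.2); rewrite -xaxis.
  have [_ /(_ nPy)] := locP y1 nXy.
  move: nXn; apply: filterS2 => w nXw H; split => // -[w1 _ Pw].
  by apply: H => //; exact: ltW.
have UX y : ~ U y -> ~ V y -> X y.
  by move=> nU nV; apply: contrapT => nX; apply: nV.
pose q : R * R := (-1, 0).
have nXq : ~ X q by move=> [k [s Aq]]; have := A_ge0 k s; rewrite Aq /=; lra.
have [M HM] := boundX.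
have sub0 (w : R * R) k s : ~ X w -> subp (A k s) w != (0, 0).
  by move=> nXw; apply: subp_neq0 => Aw; apply: nXw; exists k, s.
have lifts (w : R * R) : ~ X w -> exists2 th : K -> R -> R,
    forall k, continuous (th k) & (forall k s, is_angle (subp (A k s) w) (th k s)) /\
    forall k s t, 0 <= s <= 1 -> 0 <= t <= 1 -> A k s = A k t -> th k s = th k t.
  move=> nXw; have /choice[th Hth] : forall k, exists th : R -> R,
      [/\ continuous th, forall s, is_angle (subp (A k s) w) (th s) &
       forall s t, 0 <= s <= 1 -> 0 <= t <= 1 -> A k s = A k t -> th s = th t].
    move=> k; have ck := @cA k.
    have [[u0 cst]|ncst] := pselect (exists u0, forall u, A k u = A k u0).
      have [t tP] := angle_exists (subp (A k u0) w).
      exists (fun=> t); split => // [|s]; first by move=> ?; exact: cvg_cst.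
      by rewrite cst.
    have [||th cth thP] := @angle_lift R R (fun s => subp (A k s) w).
    - by rewrite /subp; cts.
    - by move=> s; exact: sub0.
    - exists th; split => // s t s1 t1 E; have [->//|cst] := A_inj s1 t1 E.
      by exfalso; apply: ncst; exists s.
  by exists th; [|split] => k; have [] := Hth k.
have [a ca [aP aE]] := lifts z nXz; have [b cb [bP bE]] := lifts q nXq.
have [|||psi cpsi psiP] := @curve_extension R K A (fun k s => a k s - b k s).
- exact: cA.
- by move=> k; have ? := @ca k; have ? := @cb k; cts.
- by move=> k l s t s1 t1 E; have kl := A_disj E; subst l; rewrite (aE _ _ _ s1 t1 E) (bE _ _ _ s1 t1 E).
apply: (@eilenberg R U V z q psi M) => //.
- by apply/seteqP; split => // y [Uy [_]].
- by split => // -[]; rewrite /q /=; lra.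
- by move=> y nU nV; apply: HM; exact: UX.
- move=> y nU nV; have := UX y nU nV; rewrite XE => -[k _ [s]].
  rewrite /= in_itv /= => s1 <-; exists (a k s), (b k s); split => //.
  exact: psiP.
Qed.

Definition inside (k : K) (r : R) : bool :=
  (r - (A k 0).2) * (r - (A k 1).2) < 0.

Let fold (z : R * R) : R * R := (`|z.1|, z.2).
Let mir (z : R * R) : R * R := (- z.1, z.2).

(** The page is doubled by reflection in its axis, and [P] with it. Each arc and its mirror image
    form a closed curve, on which the difference of the arguments about the two axis points is
    single-valued because it agrees at both ends of the arc: this is where the hypothesis on
    [inside] enters. *)
Lemma page_same_side p q : ~ X (0, p) -> ~ X (0, q) ->
  (forall k, inside k p = inside k q) -> P (0, p) -> P (0, q).
Proof.
move=> nXp nXq pq Pp; apply: contrapT => nPq.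
have cfold : continuous fold by rewrite /fold; cts.
have oC : open (~` X) by exact: closed_openC.
pose U := [set z | ~ X (fold z) /\ P (fold z)].
pose V := [set z | ~ X (fold z) /\ ~ P (fold z)].
have fold_ge0 z : 0 <= (fold z).1 by rewrite /fold /=.
have oU : open U.
  rewrite openE => y [nXy Py]; have [+ _] := locP (fold_ge0 y) nXy => /(_ Py) H.
  have := near_comp cfold H; have := near_comp cfold (open_nbhs_nbhs (conj oC nXy)).
  by apply: filterS2 => w nXw Pw; split => //; apply: Pw.
have oV : open V.
  rewrite openE => y [nXy Py]; have [_ +] := locP (fold_ge0 y) nXy => /(_ Py) H.
  have := near_comp cfold H; have := near_comp cfold (open_nbhs_nbhs (conj oC nXy)).
  by apply: filterS2 => w nXw Pw; split => //; apply: Pw.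
have UVX z : ~ U z -> ~ V z -> X (fold z).
  move=> nU nV; apply: contrapT => nX; have [Pz|nPz] := pselect (P (fold z)).
    exact: nU.
  exact: nV.
have [M HM] := boundX.
pose D (z : R * R) := half_angle (subp z (0, p)) - half_angle (subp z (0, q)).
have nz r z : ~ X (0, r) -> X z -> subp z (0, r) != (0, 0).
  by move=> nXr Xz; apply: subp_neq0 => zr; apply: nXr; rewrite -zr.
have XA k s : X (A k s) by exists k, s.
have pos r k s : 0 <= (subp (A k s) (0, r)).1 by rewrite /subp /= subr0.
have cha r k s : ~ X (0, r) -> cont_at s (fun s => half_angle (subp (A k s) (0, r))).
  move=> nXr; apply: (@cvg_comp _ _ _ (fun s => subp (A k s) (0, r)) (@half_angle R)); last first.
    by apply: cont_at_half_angle => //; exact: nz.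
  suff : cont_at s (fun s => subp (A k s) (0, r)) by [].
  by have ck := @cA k; rewrite /subp; cts_at.
have cD k : continuous (fun s => D (A k s)).
  apply: continuousI => s; have c1 := cha p k s nXp; have c2 := cha q k s nXq.
  by rewrite /D; cts_at.
have Dvert r : r != p -> r != q -> D (0, r) = (Num.sg (r - p) - Num.sg (r - q)) * (pi / 2).
  move=> rp rq; rewrite /D /subp /= !subrr !half_angle_vertical ?subr_eq0//.
  by ring.
have endE k : A k 0 = (0, (A k 0).2) /\ A k 1 = (0, (A k 1).2).
  by have [? ?] := A_ends k; split; apply: xaxis.
have endN k s r : ~ X (0, r) -> A k s = (0, (A k s).2) -> (A k s).2 != r.
  by move=> nXr E; apply/eqP => Er; apply: nXr; rewrite -Er -E.
have Dend k : D (A k 1) = D (A k 0) /\ cos (2 * D (A k 0)) = 1.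
  have [e0 e1] := endE k.
  have n0p := endN k 0 p nXp e0; have n1p := endN k 1 p nXp e1.
  have n0q := endN k 0 q nXq e0; have n1q := endN k 1 q nXq e1.
  rewrite e0 e1 !Dvert//; have := pq k; rewrite /inside.
  move=> /same_side_sg[]// -> H; split => //; case: H => ->.
  - by rewrite mul0r mulr0 cos0.
  - by have -> : 2 * (2 * (pi / 2)) = pi *+ 2 :> R; [field|rewrite cos2pi].
  - by have -> : 2 * (-2 * (pi / 2)) = - (pi *+ 2) :> R; [field|rewrite cosN cos2pi].
pose g (kb : K * bool) s := if kb.2 then mir (A kb.1 s) else A kb.1 s.
(* Reflection turns an angle [t] into [pi - t] and thus negates [D]; the constant [2 * D (A k 0)], a
   multiple of [2 * pi], makes the two branches agree at the ends. *)
pose f (kb : K * bool) s :=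
  if kb.2 then 2 * D (A kb.1 0) - D (A kb.1 s) else D (A kb.1 s).
have mir_eq k l s t : 0 <= s <= 1 -> 0 <= t <= 1 -> A k s = mir (A l t) ->
    D (A k s) = 2 * D (A l 0) - D (A l t).
  move=> s1 t1 E; have Ekt : (A l t).1 = 0.
    have := A_ge0 k s; have := A_ge0 l t; rewrite E /mir /=; lra.
  have Est : A k s = A l t.
    by rewrite E /mir Ekt oppr0; case: (A l t) Ekt => ? ? /= ->.
  rewrite Est; have [H1 H2] := Dend l.
  have [->|->] := A_axis Ekt; rewrite ?H1; lra.
have [|||psi cpsi psiP] := @curve_extension R _ g f.
- by move=> [k []]; have ck := @cA k; rewrite /g /mir /=; cts.
- by move=> [k []]; have ck := @cD k; rewrite /f /=; cts.
- move=> [k b] [l c] s t s1 t1; rewrite /g /f /=; case: b; case: c => E.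
  + have Est : A k s = A l t.
      move: E; rewrite /mir; case: (A k s) (A l t) => a b [c d] /= [/oppr_inj -> ->].
      by [].
    have kl := A_disj Est; subst l.
    by rewrite Est.
  + by symmetry; apply: mir_eq.
  + exact: mir_eq.
  + by rewrite E.
have foldE z : X (fold z) -> exists k s b, 0 <= s <= 1 /\ z = g (k, b) s.
  rewrite XE => -[k _ [s]]; rewrite /= in_itv/= => s1; case: z => a b.
  rewrite /fold /= => E; exists k, s, (a < 0); split => //.
  rewrite /g /mir /= E /=; case: (ltP a 0) => a0 /=; last by rewrite ger0_norm.
  by rewrite ltr0_norm// opprK.
have vlen_fold z : vlen (fold z) = vlen z.
  by rewrite /vlen /fold /= real_normK ?num_real.
have mirP v t : is_angle v t -> is_angle (mir v) (pi - t).
  rewrite /is_angle => vE; have -> : vlen (mir v) = vlen v by rewrite /vlen /mir /= sqrrN.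
  rewrite cosB sinB cospi sinpi !mul0r addr0 sub0r mulN1r mulN1r opprK /mir {1 2}vE /=.
  by rewrite mulrN.
apply: (@eilenberg R U V (0, p) (0, q) psi M) => //.
- by apply/seteqP; split => // y [[_ ?] [_]].
- by rewrite /U /= /fold /= normr0.
- by rewrite /V /= /fold /= normr0.
- by move=> z nU nV; rewrite -vlen_fold; apply: HM; exact: UVX.
- move=> z nU nV; have [k [s [b [s1 ->]]]] := foldE z (UVX z nU nV).
  rewrite psiP// /g /f /=; case: b => /=; last first.
    exists (half_angle (subp (A k s) (0, p))), (half_angle (subp (A k s) (0, q))).
    by split => //; apply: half_angleP => //; exact: nz.
  exists (pi - half_angle (subp (A k s) (0, p)) + 2 * D (A k 0)),
    (pi - half_angle (subp (A k s) (0, q))); split.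
  - apply: (@is_angle_eq _ _ (pi - half_angle (subp (A k s) (0, p)))).
      by rewrite opprD addrA subrr add0r cosN; exact: (Dend k).2.
    have -> : subp (mir (A k s)) (0, p) = mir (subp (A k s) (0, p)).
      by rewrite /subp /mir /= !subr0.
    by apply: mirP; apply: half_angleP => //; exact: nz.
  - have -> : subp (mir (A k s)) (0, q) = mir (subp (A k s) (0, q)).
      by rewrite /subp /mir /= !subr0.
    by apply: mirP; apply: half_angleP => //; exact: nz.
  - by rewrite {2}/D; ring.
Qed.
End Page.

(** * The cubic covering of the trefoil complement *)

Section ComplexDistance.
Variable R : realType.
Implicit Types x y z : R[i].
Local Notation normc := (@ComplexField.Normc.normc R).

Definition cdist x y : R := normc (x - y).

Lemma normc_ge0 x : 0 <= normc x.
Proof. by case: x => a b; exact: sqrtr_ge0. Qed.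

Lemma normc_triangle x y : normc (x + y) <= normc x + normc y.
Proof. exact: le_normcD. Qed.

Lemma normcB x y : normc (x - y) = normc (y - x).
Proof. by rewrite -opprB normcN. Qed.

Lemma normc_lip x y : normc x - normc y <= normc (x - y).
Proof. by rewrite lerBlDr -{1}(subrK y x) normc_triangle. Qed.

Lemma normc_eq0 x : (normc x == 0) = (x == 0).
Proof.
by apply/eqP/eqP => [/ComplexField.Normc.eq0_normc //|->]; rewrite ComplexField.Normc.normc0.
Qed.

Lemma normc_gt0 x : (0 < normc x) = (x != 0).
Proof. by rewrite lt0r normc_ge0 andbT normc_eq0. Qed.

Lemma normcX x n : normc (x ^+ n) = normc x ^+ n.
Proof.
elim: n => [|n IHn]; first by rewrite !expr0 ComplexField.Normc.normc1.
by rewrite !exprS ComplexField.Normc.normcM IHn.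
Qed.

Lemma normc_nat n : normc (n%:R : R[i]) = n%:R.
Proof. by rewrite normcMn ComplexField.Normc.normc1. Qed.

Lemma cdistxx x : cdist x x = 0.
Proof. by rewrite /cdist subrr ComplexField.Normc.normc0. Qed.
Lemma cdistC x y : cdist x y = cdist y x. Proof. exact: normcB. Qed.
Lemma cdistD x y z : cdist x z <= cdist x y + cdist y z.
Proof. by rewrite /cdist -{1}(subrK y x) -addrA normc_triangle. Qed.
Lemma cdist0 x y : cdist x y <= 0 -> x = y.
Proof.
move=> xy; apply/eqP; rewrite -subr_eq0 -normc_eq0 eq_le normc_ge0 andbT.
exact: xy.
Qed.

Lemma sqrt_le_norms (u v : R) : Num.sqrt (u ^+ 2 + v ^+ 2) <= `|u| + `|v|.
Proof.
rewrite -ler_sqr ?nnegrE ?sqrtr_ge0 ?addr_ge0//.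
rewrite sqr_sqrtr ?addr_ge0 ?sqr_ge0// -(real_normK (num_real u)) -(real_normK (num_real v)).
by rewrite sqrrD addrAC lerDl mulrn_wge0// mulr_ge0.
Qed.

Lemma continuous_to_complex (T : topologicalType) (D : set T) (f g : T -> R) :
  continuous f -> continuous g ->
  continuous_to cdist D (fun p => (f p +i* g p)%C).
Proof.
move=> cf cg p Dp e e0; have e20 : 0 < e / 2 by lra.
have H1 : \forall q \near p, `|f p - f q| < e / 2 by move/cvgrPdist_lt: (cf p); apply.
have H2 : \forall q \near p, `|g p - g q| < e / 2 by move/cvgrPdist_lt: (cg p); apply.
move: H1 H2; apply: filterS2 => q fq gq Dq; rewrite distrC in fq; rewrite distrC in gq.
rewrite /cdist /=; set u := f q - f p; set v := g q - g p.
by apply: (le_lt_trans (sqrt_le_norms u v)); lra.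
Qed.

Lemma continuous_toB (T : topologicalType) (D : set T) (f g : T -> R[i]) :
  continuous_to cdist D f -> continuous_to cdist D g ->
  continuous_to cdist D (fun p => f p - g p).
Proof.
move=> cf cg p Dp e e0; have e20 : 0 < e / 2 by lra.
move: (cf p Dp _ e20) (cg p Dp _ e20); apply: filterS2 => q fq gq Dq.
move: (fq Dq) (gq Dq); rewrite /cdist => {}fq {}gq.
have -> : f q - g q - (f p - g p) = (f q - f p) - (g q - g p) by ring.
by apply: (le_lt_trans (normc_triangle _ _)); rewrite normcN; lra.
Qed.

Lemma continuous_toM (T : topologicalType) (D : set T) (f g : T -> R[i]) :
  continuous_to cdist D f -> continuous_to cdist D g ->
  continuous_to cdist D (fun p => f p * g p).
Proof.
move=> cf cg p Dp e e0.
pose M := normc (f p) + normc (g p) + 1.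
have M0 : 0 < M by rewrite /M; have := normc_ge0 (f p); have := normc_ge0 (g p); lra.
pose h := Num.min 1 (e / (2 * M)).
have h0 : 0 < h by rewrite lt_min ltr01 /= divr_gt0// mulr_gt0.
have h1 : h <= 1 by rewrite ge_min lexx.
have h2 : h * M <= e / 2.
  apply: (@le_trans _ _ (e / (2 * M) * M)).
    by apply: ler_wpM2r; [exact: ltW|rewrite ge_min lexx orbT].
  by have -> : e / (2 * M) * M = e / 2 by field; lra.
move: (cf p Dp _ h0) (cg p Dp _ h0); apply: filterS2 => q fq gq Dq.
move: (fq Dq) (gq Dq); rewrite /cdist => {}fq {}gq.
have -> : f q * g q - f p * g p = (f q - f p) * (g q - g p) +
  ((f q - f p) * g p + f p * (g q - g p)) by ring.
apply: (le_lt_trans (normc_triangle _ _)).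
have := normc_triangle ((f q - f p) * g p) (f p * (g q - g p)).
rewrite !ComplexField.Normc.normcM.
move: fq gq (normc_ge0 (f q - f p)) (normc_ge0 (g q - g p)) (normc_ge0 (f p)) (normc_ge0 (g p)).
move: h2; rewrite /M.
move: (normc (f q - f p)) (normc (g q - g p)) (normc (f p)) (normc (g p)).
move=> u v F G h2 uh vh u0 v0 F0 G0 H.
have k1 : u * v <= h * 1 by apply: ler_pM => //; lra.
have k2 : u * G <= h * G by apply: ler_wpM2r => //; lra.
have k3 : F * v <= F * h by apply: ler_wpM2l => //; lra.
by nra.
Qed.

Definition cis (t : R) : R[i] := (cos t +i* sin t)%C.

Lemma cisD s t : cis (s + t) = cis s * cis t.
Proof. by rewrite /cis cosD sinD; congr Complex; ring. Qed.

Lemma cis0 : cis 0 = 1. Proof. by rewrite /cis cos0 sin0. Qed.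

Lemma normc_cis t : normc (cis t) = 1.
Proof. by rewrite /cis /= cos2Dsin2 sqrtr1. Qed.

Lemma cis_neq0 t : cis t != 0.
Proof. by rewrite -normc_gt0 normc_cis ltr01. Qed.

Lemma cis_eq s t : cis s = cis t -> cos (s - t) = 1.
Proof. by move=> [cE sE]; rewrite cosB cE sE -!expr2 cos2Dsin2. Qed.

Lemma continuous_cis (D : set R) (k : R) : continuous_to cdist D (fun s => cis (k * s)).
Proof. by apply: continuous_to_complex; cts. Qed.
End ComplexDistance.

Section Cubic.
Variable R : realType.
Local Notation normc := (@ComplexField.Normc.normc R).

Definition cubic_root (a w T : R[i]) : Prop := T ^+ 3 - 3 * a * T + 2 * w = 0.

Lemma cubic_roots (a w : R[i]) : a ^+ 3 != w ^+ 2 ->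
  exists t : 'I_3 -> R[i], injective t /\
    forall T, T ^+ 3 - 3 * a * T + 2 * w = \prod_i (T - t i).
Proof.
move=> aw.
have [t0 t0P] : exists t0 : R[i], t0 ^+ 3 - 3 * a * t0 + 2 * w = 0.
  have [x xE] := @solve_monicpoly R[i] 3 (nth 0 [:: - (2 * w); 3 * a]) isT.
  exists x; rewrite xE !big_ord_recr big_ord0 /=; ring.
(* The discriminant of the quotient by [T - t0], which is [T^2 + t0 T + t0^2 - 3 a]. *)
pose d := sqrtc (12 * a - 3 * t0 ^+ 2); have d2 : d ^+ 2 = 12 * a - 3 * t0 ^+ 2.
  exact: sqr_sqrtc.
have two0 : 2 != 0 :> R[i] by rewrite pnatr_eq0.
pose t (i : 'I_3) := nth 0 [:: t0; (- t0 + d) / 2; (- t0 - d) / 2] i.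
have wE : w = (3 * a * t0 - t0 ^+ 3) / 2.
  move/eqP: t0P; rewrite addr_eq0 => /eqP E.
  have -> : 3 * a * t0 - t0 ^+ 3 = 2 * w by rewrite -[RHS]opprK -E; ring.
  by field.
have d0 : d != 0.
  apply/eqP => d0; move/eqP: aw; apply.
  have aE : a = t0 ^+ 2 / 4.
    have /eqP : 12 * a - 3 * t0 ^+ 2 = 0 by rewrite -d2 d0 expr0n.
    by rewrite subr_eq0 => /eqP E; apply: (mulfI (x := 12)); [rewrite pnatr_eq0|rewrite E; field].
  by rewrite wE aE; field.
(* Equality would mean that [t0] is also a root of the quadratic quotient. *)
have t3 : 9 * t0 ^+ 2 != d ^+ 2.
  apply/eqP; rewrite d2 => E; move/eqP: aw; apply.
  have aE : a = t0 ^+ 2.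
    apply: (mulfI (x := 12)); first by rewrite pnatr_eq0.
    by rewrite -[LHS](subrK (3 * t0 ^+ 2)) -E; ring.
  by rewrite wE aE; field.
have t01 : t0 != (- t0 + d) / 2.
  apply/eqP => E; move/eqP: t3; apply.
  have -> : d = 3 * t0 by rewrite -[d](addrK (- t0)) [d - t0]addrC -[- t0 + d](mulfVK two0) -E; ring.
  ring.
have t02 : t0 != (- t0 - d) / 2.
  apply/eqP => E; move/eqP: t3; apply.
  have -> : d = - (3 * t0) by rewrite -[LHS]opprK -[- d](addKr (- t0)) -[- t0 - d](mulfVK two0) -E; ring.
  ring.
have t12 : (- t0 + d) / 2 != (- t0 - d) / 2.
  apply/eqP => /(mulIf (invr_neq0 two0)) /addrI /eqP.
  by rewrite -subr_eq0 opprK -mulr2n mulrn_eq0 (negPf d0).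
exists t; split.
  move=> [[|[|[|i]]] // i3] [[|[|[|j]]] // j3]; rewrite /t /= => E; apply/val_inj => //=;
    exfalso; move/eqP: E; apply/negP => //; by rewrite eq_sym.
move=> T; rewrite !big_ord_recr big_ord0 /= /t /= mul1r wE.
have aE : a = (d ^+ 2 + 3 * t0 ^+ 2) / 12 by rewrite d2; field.
by rewrite aE; field.
Qed.

Lemma cubic_root_prod (a w : R[i]) (t : 'I_3 -> R[i]) :
  (forall T, T ^+ 3 - 3 * a * T + 2 * w = \prod_i (T - t i)) ->
  forall T, cubic_root a w T <-> exists i, T = t i.
Proof.
move=> tP T; rewrite /cubic_root tP; split=> [/eqP/prodf_eq0[i _]|[i ->]].
  by rewrite subr_eq0 => /eqP ->; exists i.
by apply/eqP/prodf_eq0; exists i; rewrite ?subrr.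
Qed.

(** The third root is [- (y + z)], so the left side is the squared product of the differences of the
    roots, the discriminant. *)
Lemma cubic_disc (a w y z : R[i]) : cubic_root a w y -> cubic_root a w z -> y != z ->
  (y - z) ^+ 2 * ((2 * y + z) * (y + 2 * z)) ^+ 2 = 108 * (a ^+ 3 - w ^+ 2).
Proof.
rewrite /cubic_root => ya za yz.
have yz0 : y - z != 0 by rewrite subr_eq0.
have aE : a = (y ^+ 2 + y * z + z ^+ 2) / 3.
  apply: (mulfI yz0); apply: (mulfI (x := 3)); first by rewrite pnatr_eq0.
  have : y ^+ 3 - 3 * a * y + 2 * w - (z ^+ 3 - 3 * a * z + 2 * w) = 0 by rewrite ya za subr0.
  move/eqP; rewrite (_ : _ - _ = (y - z) * (y ^+ 2 + y * z + z ^+ 2) - 3 * ((y - z) * a)); last ring.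
  by rewrite subr_eq0 => /eqP <-; field.
have wE : w = y * z * (y + z) / 2.
  apply: (mulfI (x := 2)); first by rewrite pnatr_eq0.
  by apply/eqP; rewrite -subr_eq0; apply/eqP; rewrite -[RHS]ya aE; field.
by rewrite aE wE; field.
Qed.

Lemma cubic_root_bound (a w T : R[i]) : cubic_root a w T ->
  normc T <= 1 + 3 * normc a + 2 * normc w.
Proof.
move=> TE; have [T1|T1] := leP (normc T) 1.
  by have := normc_ge0 a; have := normc_ge0 w; lra.
have : T ^+ 3 = 3 * a * T - 2 * w.
  by apply/eqP; rewrite -subr_eq0; apply/eqP; rewrite -[RHS]TE; ring.
move=> /(congr1 normc); rewrite normcX => E.
have := normc_triangle (3 * a * T) (- (2 * w)); rewrite -E normcN.
rewrite !ComplexField.Normc.normcM !normc_nat.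
move: (normc_ge0 a) (normc_ge0 w) T1; move: (normc a) (normc w) (normc T) => x y r x0 y0 r1 H.
rewrite leNgt; apply/negP => H2.
have : r * (1 + 3 * x + 2 * y) < r * r by rewrite ltr_pM2l //; lra.
have : r * r <= r * r * r by rewrite ler_peMr ?mulr_ge0//; lra.
rewrite exprS expr2 mulrA in H.
have : y <= r * y by rewrite ler_peMl//; lra.
by nra.
Qed.

Lemma prod3_ge (e : R) (x : 'I_3 -> R) : 0 < e -> (forall i, 0 <= x i) ->
  \prod_i x i < e ^+ 3 -> exists i, x i < e.
Proof.
move=> e0 x0 H; apply: contrapT => nx.
have ex i : e <= x i by rewrite leNgt; apply/negP => xi; apply: nx; exists i.
move: H; rewrite ltNge => /negP; apply.
have -> : e ^+ 3 = \prod_(i < 3) e by rewrite prodr_const card_ord.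
by apply: ler_prod => i _; rewrite ltW //= ex.
Qed.

Lemma normc_prod (x : 'I_3 -> R[i]) : normc (\prod_i x i) = \prod_i normc (x i).
Proof.
by rewrite !big_ord_recr !big_ord0 /= !ComplexField.Normc.normcM ComplexField.Normc.normc1.
Qed.

Variables (T : topologicalType) (a w : T -> R[i]).
Hypothesis ca : continuous_to (@cdist R) setT a.
Hypothesis cw : continuous_to (@cdist R) setT w.

(** At the old root [y] the new polynomial has modulus below [e ^ 3]. This modulus is the product of
    the distances from [y] to the three new roots, so one of them is below [e]. *)
Lemma cubic_near_root (u v u' v' y : R[i]) (e h : R) :
  u' ^+ 3 != v' ^+ 2 -> cubic_root u v y -> 0 < e ->
  normc (u' - u) <= h -> normc (v' - v) <= h -> h * (3 * normc y + 2) < e ^+ 3 ->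
  exists2 y', cubic_root u' v' y' & cdist y' y < e.
Proof.
move=> uv' yE e0 hu hv he; have [t [_ tP]] := cubic_roots uv'.
have E : \prod_i (y - t i) = - (3 * (u' - u) * y) + 2 * (v' - v).
  by rewrite -tP -[LHS]subr0 -yE; ring.
have : \prod_i normc (y - t i) < e ^+ 3.
  rewrite -normc_prod E; apply: le_lt_trans he; apply: (le_trans (normc_triangle _ _)).
  rewrite normcN !ComplexField.Normc.normcM !normc_nat.
  have := normc_ge0 y; move: hu hv.
  move: (normc (u' - u)) (normc (v' - v)) (normc y) => p q r *.
  by nra.
move=> /prod3_ge[//|i|i ti]; first exact: normc_ge0.
exists (t i); last by rewrite cdistC.
by apply/(cubic_root_prod tP); exists i.
Qed.

(** The roots move little, in both directions, by [cubic_near_root]. They stay apart because they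
    are bounded while the discriminant stays away from zero. *)
Lemma cubic_covering : covering (@cdist R) [set p | a p ^+ 3 != w p ^+ 2]
  (fun p => cubic_root (a p) (w p)).
Proof.
move=> b /= Db.
pose M := 1 + 3 * (normc (a b) + 1) + 2 * (normc (w b) + 1).
have [na nw] := (normc_ge0 (a b), normc_ge0 (w b)).
have M1 : 1 <= M by rewrite /M; lra.
have nearh (h : R) : 0 < h -> \forall p \near b,
    normc (a p - a b) < h /\ normc (w p - w b) < h.
  move=> h0; move: (@ca b I h h0) (@cw b I h h0); apply: filterS2 => p ap wp.
  by split; [exact: ap|exact: wp].
have bd p : normc (a p - a b) < 1 -> normc (w p - w b) < 1 ->
    normc (a p) <= normc (a b) + 1 /\ normc (w p) <= normc (w b) + 1.
  by move=> a1 w1; have := normc_lip (a p) (a b); have := normc_lip (w p) (w b); lra.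
have rootM p y : normc (a p - a b) < 1 -> normc (w p - w b) < 1 ->
    cubic_root (a p) (w p) y -> normc y <= M.
  by move=> a1 w1 /cubic_root_bound; have := bd p a1 w1; rewrite /M; lra.
have rootMb y : cubic_root (a b) (w b) y -> normc y <= M.
  by apply: rootM; rewrite subrr ComplexField.Normc.normc0.
split.
  move=> e e0.
  (* [M] bounds all roots near [b]; changing the coefficients by less than [h] alters the value at a
     root by at most [h * (3 * M + 2)], which is to be below [e ^ 3]. *)
  pose h := Num.min (1 / 2) (e ^+ 3 / (2 * (3 * M + 2))).
  have M2 : 0 < 2 * (3 * M + 2) by lra.
  have e3 : 0 < e ^+ 3 by rewrite exprn_gt0.
  have h0 : 0 < h by rewrite lt_min divr_gt0 //= divr_gt0.
  have h1 : h <= 1 / 2 by rewrite ge_min lexx.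
  have h2 (r : R) : 0 <= r -> r <= M -> h * (3 * r + 2) < e ^+ 3.
    move=> r0 rM; apply: (@le_lt_trans _ _ (h * (3 * M + 2))).
      by apply: ler_wpM2l; [exact: ltW|lra].
    have : h * (2 * (3 * M + 2)) <= e ^+ 3.
      by rewrite -ler_pdivlMr// ge_min lexx orbT.
    by lra.
  move: (nearh h h0); apply: filterS => p [ap wp] Dp.
  have [ap1 wp1] : normc (a p - a b) < 1 /\ normc (w p - w b) < 1 by split; lra.
  split=> y yE.
    apply: (cubic_near_root Dp yE e0 (ltW ap) (ltW wp)); apply: h2 => //.
      exact: normc_ge0.
    exact: rootMb.
  have hp : normc (a b - a p) <= h by rewrite normcB ltW.
  have hw : normc (w b - w p) <= h by rewrite normcB ltW.
  have yM : normc y <= M by exact: rootM yE.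
  have [y' y'E yy'] := cubic_near_root Db yE e0 hp hw (h2 _ (normc_ge0 y) yM).
  by exists y' => //; rewrite cdistC.
pose k := normc (a b ^+ 3 - w b ^+ 2).
have k0 : 0 < k by rewrite normc_gt0 subr_eq0.
(* The variations of [a ^ 3] and [w ^ 2] are at most [3 * M ^ 2] and [2 * M ^ 2] times [h], so their
   difference keeps modulus at least [k / 2]. *)
pose h := Num.min 1 (k / (2 * (5 * M ^+ 2))).
have M20 : 0 < M ^+ 2 by rewrite exprn_gt0//; lra.
have h0 : 0 < h by rewrite lt_min ltr01 divr_gt0//; lra.
have h1 : h <= 1 by rewrite ge_min lexx.
have h2 : h * (5 * M ^+ 2) <= k / 2.
  have : h * (2 * (5 * M ^+ 2)) <= k by rewrite -ler_pdivlMr ?ge_min ?lexx ?orbT//; lra.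
  by lra.
have M40 : 0 < 81 * M ^+ 4 by rewrite mulr_gt0// exprn_gt0//; lra.
(* Two distinct roots closer than this would make the discriminant smaller than [k], whereas it is
   at least 54 times [k]. *)
exists (Num.min 1 (k / (81 * M ^+ 4))).
  by rewrite lt_min ltr01 /= divr_gt0.
move: (nearh h h0); apply: filterS => p [ap wp] Dp y z yE zE yz.
have [ap1 wp1] : normc (a p - a b) < 1 /\ normc (w p - w b) < 1 by split; lra.
apply/eqP; apply: contraT => yNz; exfalso.
have := congr1 normc (cubic_disc yE zE yNz).
rewrite !(ComplexField.Normc.normcM, normcX) normc_nat => E.
have kp : k / 2 <= normc (a p ^+ 3 - w p ^+ 2).
  have [ba bw] := bd p ap1 wp1.
  have := normc_lip (a b ^+ 3 - w b ^+ 2) (a p ^+ 3 - w p ^+ 2); rewrite -/k.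
  have -> : a b ^+ 3 - w b ^+ 2 - (a p ^+ 3 - w p ^+ 2) =
    (a b - a p) * (a b ^+ 2 + a b * a p + a p ^+ 2) - (w b - w p) * (w b + w p) by ring.
  have := normc_triangle ((a b - a p) * (a b ^+ 2 + a b * a p + a p ^+ 2))
    (- ((w b - w p) * (w b + w p))).
  rewrite normcN !ComplexField.Normc.normcM.
  have t1 := normc_triangle (w b) (w p).
  have t2 := normc_triangle (a b ^+ 2 + a b * a p) (a p ^+ 2).
  have t3 := normc_triangle (a b ^+ 2) (a b * a p).
  rewrite !(ComplexField.Normc.normcM, normcX) in t2 t3.
  rewrite (normcB (a b)) (normcB (w b)).
  have s2 : normc (a b ^+ 2 + a b * a p + a p ^+ 2) <= 3 * M ^+ 2.
    have := normc_ge0 (a p); move: t2 t3 ba na nw; rewrite /M.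
    move: (normc (a b ^+ 2 + a b * a p + _)) (normc (a b ^+ 2 + _)).
    move: (normc (a b)) (normc (a p)) (normc (w b)) => s t v q r *.
    by nra.
  have s1 : normc (w b + w p) <= 2 * M ^+ 2.
    have MM : M <= M ^+ 2 by rewrite expr2 ler_peMl//; lra.
    have w2 : normc (w b + w p) <= 2 * M by move: t1 bw na nw; rewrite /M; clear; lra.
    by move: w2 MM; clear; lra.
  have := normc_ge0 (a b ^+ 2 + a b * a p + a p ^+ 2).
  have := normc_ge0 (w b + w p).
  move: s1 s2 ap wp h2 (normc_ge0 (a p - a b)) (normc_ge0 (w p - w b)).
  move: (normc (w b + w p)) (normc (a b ^+ 2 + _ + _)) (normc (a p - a b)) (normc (w p - w b)).
  move=> q r s t s1 s2 sh th h2 s0 t0 q0 r0 H1 H2.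
  have j1 : s * r <= h * (3 * M ^+ 2) by apply: ler_pM => //; exact: ltW.
  have j2 : t * q <= h * (2 * M ^+ 2) by apply: ler_pM => //; exact: ltW.
  by move: j1 j2 h2 H1 H2; clear; lra.
have [yM zM] := (rootM p y ap1 wp1 yE, rootM p z ap1 wp1 zE).
have n1 : normc (2 * y + z) <= 3 * M.
  apply: (le_trans (normc_triangle _ _)); rewrite ComplexField.Normc.normcM normc_nat.
  by move: yM zM; clear; lra.
have n2 : normc (y + 2 * z) <= 3 * M.
  apply: (le_trans (normc_triangle _ _)); rewrite ComplexField.Normc.normcM normc_nat.
  by move: yM zM; clear; lra.
have n12 : (normc (2 * y + z) * normc (y + 2 * z)) ^+ 2 <= 81 * M ^+ 4.
  have -> : 81 * M ^+ 4 = ((3 * M) * (3 * M)) ^+ 2 by ring.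
  have M0 : 0 <= M by move: M1; clear; lra.
  rewrite ler_sqr ?nnegrE ?mulr_ge0 ?normc_ge0//.
  by apply: ler_pM => //; exact: normc_ge0.
have yz1 : normc (y - z) < 1 by rewrite (lt_le_trans yz)// ge_min lexx.
have yz2 : normc (y - z) * (81 * M ^+ 4) < k.
  by rewrite -ltr_pdivlMr// (lt_le_trans yz)// ge_min lexx orbT.
have yz0 := normc_ge0 (y - z).
have : normc (y - z) ^+ 2 * (normc (2 * y + z) * normc (y + 2 * z)) ^+ 2 <=
  normc (y - z) * (81 * M ^+ 4).
  apply: ler_pM => //; rewrite ?sqr_ge0//.
  by rewrite expr2 ler_piMl// ltW.
rewrite E; lra.
Qed.
End Cubic.

Section TrefoilCovering.
Variable R : realType.
Implicit Types p : E3 R.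
Local Notation normc := (@ComplexField.Normc.normc R).
Local Notation K := (trefoil_knot R).

(* On the trefoil [knot_w] is [exp (3 i t)] and [knot_a] is [exp (2 i t)], and the
   cutoff makes the knot the locus [a ^ 3 = w ^ 2] where the cubic
   [T ^ 3 - 3 a T + 2 w] has a double root. *)
Definition meridian p : R * R := (vlen p.1 - 2, p.2).
Definition knot_w p : R[i] := ((meridian p).1 +i* (meridian p).2)%C.
(** At distance 1 from the core the numerator is 1, so [knot_a] is the unit complex number of the
    longitude. The cube of the numerator decreases and the square of the distance increases, so they
    agree only at distance 1. From distance 3/2 on the numerator vanishes, in particular near the
    axis, where the denominator is kept away from zero. *)
Definition cutoff p : R := Num.max 0 (3 - 2 * vlen (meridian p)) / Num.max (vlen p.1) (1 / 2).
Definition knot_a p : R[i] := ((cutoff p * p.1.1) +i* (cutoff p * p.1.2))%C.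

Lemma continuous_knot_w : continuous_to (@cdist R) setT knot_w.
Proof. by apply: continuous_to_complex; rewrite /meridian /vlen; cts. Qed.

Lemma half_max_gt0 (x : R) : 0 < Num.max x (1 / 2).
Proof. by rewrite lt_max orbC divr_gt0. Qed.

Lemma continuous_knot_a : continuous_to (@cdist R) setT knot_a.
Proof.
have cm : continuous cutoff.
  by rewrite /cutoff /meridian /vlen; cts; rewrite gt_eqF// half_max_gt0.
by apply: continuous_to_complex; cts.
Qed.

Lemma polar_cube (l : R) : 0 <= l -> Num.max 0 (3 - 2 * l) ^+ 3 = l ^+ 2 -> l = 1.
Proof.
move=> l0; have [l3|l3] := leP (3 - 2 * l) 0.
  rewrite expr0n /= => /esym/eqP; rewrite sqrf_eq0 => /eqP l0'; lra.
move=> E; have [l1|l1|//] := ltgtP l 1; exfalso.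
  have h1 : 1 < 3 - 2 * l by lra.
  have : 1 < (3 - 2 * l) ^+ 3 by rewrite exprn_egt1.
  by rewrite E; have : l * l <= 1 * 1 by [apply: ler_pM => //; lra]; rewrite expr2; lra.
have h1 : 3 - 2 * l < 1 by lra.
have : (3 - 2 * l) ^+ 3 < 1 by rewrite exprn_ilt1// ltW.
rewrite E; have : 1 * 1 <= l * l by apply: ler_pM => //; lra.
by rewrite expr2; lra.
Qed.

Lemma knot_disc p : knot_a p ^+ 3 = knot_w p ^+ 2 -> K p.
Proof.
move=> aw; pose l := vlen (meridian p); pose m := Num.max 0 (3 - 2 * l).
have l0 : 0 <= l by exact: vlen_ge0.
have m0 : 0 <= m by rewrite le_max lexx.
have r0 : 0 <= vlen p.1 by exact: vlen_ge0.
have cE : cutoff p = m / Num.max (vlen p.1) (1 / 2) by [].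
have nw : normc (knot_w p) = l by [].
have na : normc (knot_a p) = cutoff p * vlen p.1.
  have : 0 <= cutoff p by rewrite cE divr_ge0// ltW// half_max_gt0.
  rewrite /knot_a /= /vlen; move: (cutoff p) => c c0.
  by rewrite !exprMn -mulrDr sqrtrM ?sqr_ge0// sqrtr_sqr ger0_norm.
have na3 := congr1 normc aw; rewrite !normcX nw na in na3.
have rl : 2 - vlen p.1 <= l.
  have [h _] := vlen_ge_coord (meridian p); apply: le_trans h.
  by rewrite /meridian /= distrC ler_norm.
have [rsmall|rbig] := leP (vlen p.1) (1 / 2).
  have mE : m = 0 by apply/max_idPl; lra.
  rewrite cE mE !mul0r expr0n /= in na3.
  by move/eqP: na3; rewrite eq_sym sqrf_eq0 => /eqP; lra.
have cut : cutoff p * vlen p.1 = m.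
  by rewrite cE (max_idPl (ltW rbig)) mulfVK// gt_eqF// (lt_trans _ rbig)// divr_gt0.
rewrite cut in na3; have l1 : l = 1 by exact: polar_cube.
have m1 : m = 1.
  rewrite /m l1; have -> : 3 - 2 * 1 = 1 :> R by ring.
  exact/max_idPr/ler01.
have [phi phiP] := angle_exists p.1; have [al alP] := angle_exists (meridian p).
have aE : knot_a p = cis phi.
  have x1 : p.1.1 = vlen p.1 * cos phi by rewrite {1}phiP.
  have y1 : p.1.2 = vlen p.1 * sin phi by rewrite {1}phiP.
  by rewrite /knot_a x1 y1 !mulrA cut m1 !mul1r.
have wE : knot_w p = cis al.
  have x1 : (meridian p).1 = l * cos al by rewrite {1}alP.
  have y1 : (meridian p).2 = l * sin al by rewrite {1}alP.
  by rewrite /knot_w x1 y1 l1 !mul1r.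
have e1 : cos (3 * phi - 2 * al) = 1.
  apply: cis_eq; transitivity (knot_a p ^+ 3).
    have -> : 3 * phi = phi + (phi + phi) by ring.
    by rewrite aE !exprS expr0 mulr1 !cisD.
  by rewrite aw wE expr2 -cisD; congr cis; ring.
have e2 := sin_eq0_cos1 e1.
(* Since [3 * phi] and [2 * al] agree modulo [2 * pi], the parameter [al - phi] has double [phi] and
   triple [al]. *)
exists (al - phi) => //.
have c3 : cos (3 * (al - phi)) = cos al /\ sin (3 * (al - phi)) = sin al.
  apply: cos_sin_eq; rewrite -cosN.
  by have -> : - (3 * (al - phi) - al) = 3 * phi - 2 * al by ring.
have c2 : cos (2 * (al - phi)) = cos phi /\ sin (2 * (al - phi)) = sin phi.
  apply: cos_sin_eq; rewrite -cosN.
  by have -> : - (2 * (al - phi) - phi) = 3 * phi - 2 * al by ring.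
have [mE1 mE2] : meridian p = (cos al, sin al).
  by rewrite {1}alP -/l l1 !mul1r.
rewrite c3.1 c3.2 c2.1 c2.2 -mE1 -mE2 addrC subrK -phiP.
by case: p {aw l m l0 m0 r0 cE nw na na3 rl rbig cut l1 m1 phiP alP aE wE mE1 mE2} => [[? ?] ?].
Qed.

Lemma trefoil_meridian p : K p -> vlen (meridian p) = 1.
Proof.
move=> [t _ <-]; rewrite /meridian /= vlen_polar; last first.
  by have := cos_geN1 (3 * t); lra.
rewrite addrC addKr /vlen /= cos2Dsin2 sqrtr1 //.
Qed.

Lemma knot_covering : covering (@cdist R) (~` K)
  (fun p => cubic_root (knot_a p) (knot_w p)).
Proof.
apply: covering_sub (cubic_covering continuous_knot_a continuous_knot_w).
by move=> p nK /=; apply/eqP => /knot_disc.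
Qed.

(** The circle of radius 2 about a point of the core: the cutoff vanishes on it and the cubic
    becomes [T^3 + 2 w]. In turn [loop_a] is the core itself, where [w] vanishes and the
    discriminant is [108 a^3]. *)
Definition loop_w (s : R) : E3 R := (2 + 2 * cos s, 0, 2 * sin s).
Definition loop_a (s : R) : E3 R := (2 * cos s, 2 * sin s, 0).

Lemma loop_wE s : [/\ ~ K (loop_w s), knot_a (loop_w s) = 0 & knot_w (loop_w s) = 2 * cis s].
Proof.
have c1 := cos_geN1 s.
have mE : meridian (loop_w s) = (2 * cos s, 2 * sin s).
  rewrite /meridian /loop_w /=; congr pair.
  by rewrite /vlen /= expr0n /= addr0 sqrtr_sqr ger0_norm; lra.
have lE : vlen (meridian (loop_w s)) = 2 by rewrite mE vlen_polar.
split.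
- by move=> /trefoil_meridian; rewrite lE; lra.
- rewrite /knot_a /cutoff lE; have -> : Num.max 0 (3 - 2 * 2) = 0 :> R by apply/max_idPl; lra.
  by rewrite !mul0r.
- rewrite /knot_w mE /=; have -> : 2 = (2 +i* 0)%C :> R[i] by rewrite -[LHS](rmorph_nat (real_complex R)).
  by rewrite /cis /=; congr Complex; ring.
Qed.

Lemma loop_aE s : [/\ ~ K (loop_a s), knot_a (loop_a s) = 3 * cis s & knot_w (loop_a s) = 0].
Proof.
have rE : vlen (loop_a s).1 = 2 by rewrite vlen_polar.
have mE : meridian (loop_a s) = (0, 0) by rewrite /meridian rE /loop_a /= subrr.
have lE : vlen (meridian (loop_a s)) = 0.
  by rewrite mE /vlen /= expr0n /= addr0 sqrtr0.
split.
- by move=> /trefoil_meridian; rewrite lE; lra.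
- rewrite /knot_a /cutoff lE rE.
  have -> : Num.max 0 (3 - 2 * 0) = 3 :> R by [rewrite mulr0 subr0; apply/max_idPr].
  have -> : Num.max 2 (1 / 2) = 2 :> R by [apply/max_idPl; lra].
  have -> : 3 = (3 +i* 0)%C :> R[i] by rewrite -[LHS](rmorph_nat (real_complex R)).
  by rewrite /cis /=; congr Complex; field.
- by rewrite /knot_w mE.
Qed.

Lemma loops_periodic : loop_w (2 * pi) = loop_w 0 /\ loop_a (2 * pi) = loop_a 0.
Proof.
have -> : 2 * pi = pi *+ 2 :> R by rewrite mulr_natl.
by rewrite /loop_w /loop_a cos2pi sin2pi cos0 sin0.
Qed.

(** Along [loop_w] a root satisfies [T^3 = - 4 exp (i s)]; by uniqueness of lifts it is [T 0] times
    [exp (i s / 3)], which does not close up. *)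
Lemma no_global_root r :
  lift_on (@cdist R) (~` K) (fun p => cubic_root (knot_a p) (knot_w p)) r -> False.
Proof.
move=> lr; have cl : continuous loop_w by rewrite /loop_w; cts.
have lK s : setT s -> (~` K) (loop_w s) by have [] := loop_wE s.
have lT := lift_comp cl lK lr; have cT := covering_comp cl lK knot_covering.
set T := r \o loop_w in lT.
have QT s : T s ^+ 3 = - 4 * cis s.
  have := lT.2 s I; have [_ aE wE] := loop_wE s; rewrite /= aE wE /cubic_root.
  by rewrite mulr0 mul0r subr0 => /eqP; rewrite addr_eq0 => /eqP ->; ring.
pose F s := T 0 * cis (1 / 3 * s).
have lF : lift_on (@cdist R) setT ((fun p => cubic_root (knot_a p) (knot_w p)) \o loop_w) F.
  split.
    apply: continuous_toM; last exact: continuous_cis.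
    by move=> s _ e e0; apply: (@filterE _ (nbhs s)) => u _; rewrite cdistxx.
  move=> s _; have [_ aE wE] := loop_wE s; rewrite /= aE wE /cubic_root.
  have -> : cis s = cis (1 / 3 * s) ^+ 3.
    by rewrite !exprS expr0 mulr1 -!cisD; congr cis; field.
  rewrite mulr0 mul0r subr0 /F exprMn QT cis0; ring.
have cR : connected [set: R] by apply/connected_intervalP.
have TF0 : T 0 = F 0 by rewrite /F mulr0 cis0 mulr1.
have := lift_unique (@cdistC R) (@cdistD R) (@cdist0 R) cT cR lT lF I TF0
  (I : setT (2 * pi : R)).
rewrite /F {1}/T /= loops_periodic.1 -/(T 0) -[LHS]mulr1 => /mulfI H.
have T0 : T 0 != 0.
  apply/eqP => T0; have := QT 0; rewrite T0 expr0n /= cis0 mulr1 => /esym/eqP.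
  by rewrite oppr_eq0 pnatr_eq0.
have := H T0; rewrite -(cis0 R) => /cis_eq; rewrite sub0r cosN => c1.
have p0 := @pi_gt0 R.
suff : cos (1 / 3 * (2 * pi)) < 1 :> R by rewrite c1 ltxx.
have q0 : 0 < 1 / 3 * (2 * pi) :> R by lra.
by apply: cos_lt1; [rewrite gt_eqF|rewrite gtr0_norm//; lra].
Qed.

Lemma normc_opposite (x y : R[i]) :
  normc (y - x) < normc x -> normc (- y - x) < normc x -> False.
Proof.
move=> h1 h2; have := normc_triangle (x - y) (- (- y - x)).
have -> : x - y - (- y - x) = 2 * x by ring.
by rewrite normcN (normcB x) ComplexField.Normc.normcM normc_nat; lra.
Qed.

(** Along [loop_a] the discriminant is [2916 exp (3 i s)], with 2916 = 108 * 27. A continuous square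
    root is a multiple of [exp (3 i s / 2)] and changes sign after one turn. *)
Lemma no_global_sqrt d : continuous_to (@cdist R) (~` K) d ->
  (forall p, ~ K p -> d p ^+ 2 = 108 * (knot_a p ^+ 3 - knot_w p ^+ 2)) -> False.
Proof.
move=> cd d2; have cl : continuous loop_a by rewrite /loop_a; cts.
have lK s : setT s -> (~` K) (loop_a s) by have [] := loop_aE s.
have cT := continuous_to_comp cl lK cd; set T := d \o loop_a in cT.
have QT s : T s ^+ 2 = 2916 * cis (3 * s).
  have [nK aE wE] := loop_aE s; rewrite /T /= d2// aE wE.
  have -> : cis (3 * s) = cis s ^+ 3.
    by rewrite !exprS expr0 mulr1 -!cisD; congr cis; ring.
  by ring.
pose F s := T 0 * cis (3 / 2 * s).
have cF : continuous_to (@cdist R) setT F.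
  apply: continuous_toM; last exact: continuous_cis.
  by move=> s _ e e0; apply: (@filterE _ (nbhs s)) => u _; rewrite cdistxx.
have T0 : T 0 != 0.
  apply/eqP => T0; have := QT 0; rewrite T0 expr0n /= mulr0 cis0 mulr1 => /esym/eqP.
  by rewrite pnatr_eq0.
have F0 s : F s != 0 by rewrite mulf_neq0// cis_neq0.
have TF s : T s = F s \/ T s = - F s.
  have /eqP : T s ^+ 2 = F s ^+ 2.
    rewrite QT /F exprMn QT mulr0 cis0 mulr1; congr (_ * _).
    by rewrite expr2 -cisD; congr cis; field.
  by rewrite eqf_sqr => /orP[] /eqP; [left|right].
have cR : connected [set: R] by apply/connected_intervalP.
have H : forall s, setT s -> T s = F s.
  apply: (@connected_induction _ _ (fun s => T s = F s) 0) => //.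
  - by rewrite /F mulr0 cis0 mulr1.
  - move=> s _ TFs; have e0 : 0 < normc (F s) by rewrite normc_gt0.
    move: (cT s I _ e0) (cF s I _ e0); apply: filterS2 => u /(_ I) Tu /(_ I) Fu _.
    have [//|TFu] := TF u; exfalso.
    rewrite /cdist TFu TFs in Tu; rewrite /cdist in Fu.
    exact: (normc_opposite Fu Tu).
  - move=> s _ nTF; have TFs : T s = - F s by have [|] := TF s.
    have e0 : 0 < normc (F s) by rewrite normc_gt0.
    move: (cT s I _ e0) (cF s I _ e0); apply: filterS2 => u /(_ I) Tu /(_ I) Fu _ TFu.
    rewrite /cdist TFu TFs opprK in Tu; rewrite /cdist in Fu.
    apply: (normc_opposite Fu); rewrite -normcN opprD !opprK; exact: Tu.
have := H (2 * pi) I; rewrite {1}/T /= loops_periodic.2 -/(T 0) /F -[LHS]mulr1 => /mulfI.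
move=> /(_ T0); have -> : 3 / 2 * (2 * pi) = pi + pi *+ 2 :> R by field.
move=> /esym; rewrite -(cis0 R) => /cis_eq; rewrite subr0 cosD2pi cospi => /eqP.
by rewrite eqNr oner_eq0.
Qed.
End TrefoilCovering.

(** * Wedges and monodromy around the axis *)

Section Wedges.
Variables (R : realType) (m : nat) (eta : nat -> R).
Hypothesis eta_step : forall k, (k < m)%N -> eta k < eta k.+1 < eta k + pi.
Hypothesis eta_last : eta m = eta 0 + 2 * pi.
Implicit Types p : E3 R.

Definition dir (t : R) : R * R := (cos t, sin t).

(** A closed sector narrower than a half-turn is the intersection of two half-spaces bounded by
    planes through the axis. *)
Definition wedge k p := 0 <= cross (dir (eta k)) p.1 /\ 0 <= cross p.1 (dir (eta k.+1)).

Lemma cross_dirl (s t r : R) : cross (dir s) (r * cos t, r * sin t) = r * sin (t - s).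
Proof. by rewrite /cross /dir /= sinB; ring. Qed.

Lemma cross_dirr (s t r : R) : cross (r * cos t, r * sin t) (dir s) = r * sin (s - t).
Proof. by rewrite /cross /dir /= sinB; ring. Qed.

Lemma sin_lt0_Npi (x : R) : - pi < x < 0 -> sin x < 0.
Proof. by move=> x1; rewrite -oppr_gt0 -sinN sin_gt0_pi//; lra. Qed.

Lemma sin_lt0_2pi (x : R) : pi < x < 2 * pi -> sin x < 0.
Proof.
move=> x1; have -> : x = (x - pi) + pi by ring.
by rewrite sinDpi oppr_lt0 sin_gt0_pi//; lra.
Qed.

Lemma eta_lt i j : (i < j)%N -> (j <= m)%N -> eta i < eta j.
Proof.
elim: j => // j IHj; rewrite ltnS leq_eqVlt => /orP[/eqP ->|ij] jm.
  by have /andP[] := eta_step jm.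
by apply: lt_trans (IHj ij (ltnW jm)) _; have /andP[] := eta_step jm.
Qed.

Lemma eta_le i j : (i <= j)%N -> (j <= m)%N -> eta i <= eta j.
Proof.
rewrite leq_eqVlt => /orP[/eqP -> //|ij] jm; exact/ltW/eta_lt.
Qed.

Lemma m_gt0 : (0 < m)%N.
Proof.
rewrite lt0n; apply/eqP => m0; have := eta_last; rewrite m0.
by have := @pi_gt0 R; lra.
Qed.

Lemma angle_window v : exists t, eta 0 <= t <= eta m /\ is_angle v t.
Proof.
have p0 := @pi_gt0 R.
pose a := eta 0 + pi.
(* [v] turned by [- a]: an angle of [u] in [[- pi, pi]], increased by [a], is an angle of [v] in the
   window. *)
pose u : R * R := (cos a * v.1 + sin a * v.2, cos a * v.2 - sin a * v.1).
have [s [s1 us]] := angle_pi u.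
exists (s + a); split; first by rewrite eta_last /a; lra.
have ca := cos2Dsin2 a.
have luv : vlen u = vlen v.
  rewrite /vlen /u /=; congr Num.sqrt.
  transitivity ((cos a ^+ 2 + sin a ^+ 2) * (v.1 ^+ 2 + v.2 ^+ 2)); [ring|].
  by rewrite ca mul1r.
have e1 : u.1 = vlen v * cos s by rewrite -luv {1}us.
have e2 : u.2 = vlen v * sin s by rewrite -luv {1}us.
rewrite /u /= in e1 e2.
rewrite /is_angle cosD sinD !mulrBr !mulrDr !mulrA -e1 -e2.
rewrite (surjective_pairing v) /=; congr pair; rewrite -[LHS]mul1r -ca; ring.
Qed.

Lemma wedge_cover p : exists k, (k < m)%N /\ wedge k p.
Proof.
have [t [tm pt]] := angle_window p.1.
have [k km kt] : exists2 k, (k < m)%N & eta k <= t <= eta k.+1.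
  have : forall j, (j <= m)%N -> t <= eta j -> (0 < j)%N ->
      exists2 k, (k < m)%N & eta k <= t <= eta k.+1.
    elim=> // j IHj jm tj _; have [jt|jt] := leP (eta j) t.
      by exists j => //; rewrite jt.
    case: j {jm} IHj tj jt (ltnW jm) => [|j] IHj tj jt jm; first by move: tm; lra.
    by apply: IHj => //; exact: ltW.
  by apply; [exact: leqnn|lra|exact: m_gt0].
exists k; split=> //; have /andP[s1 s2] := eta_step km.
rewrite /wedge pt cross_dirl cross_dirr.
by split; apply: mulr_ge0; rewrite ?vlen_ge0 ?sin_ge0_pi//; lra.
Qed.

(** The two ends of the window [[eta 0, eta m]] represent the same half-plane, whence the two
    exceptional cases. *)
Lemma wedge_angle k p r t : (k < m)%N -> wedge k p -> p.1 = (r * cos t, r * sin t) ->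
  0 < r -> eta 0 <= t <= eta m ->
  [\/ eta k <= t <= eta k.+1, t = eta 0 /\ k.+1 = m | t = eta m /\ k = 0%N].
Proof.
move=> km [] + + pE r0 t1; rewrite pE cross_dirl cross_dirr !pmulr_rge0// => s1 s2.
have /andP[k1 k2] := eta_step km; have p0 := @pi_gt0 R; have el := eta_last.
have e1 := eta_le (leq0n k) (ltnW km); have e2 := eta_le km (leqnn m).
have sN (x : R) : 0 <= sin x -> - pi < x < 0 -> False.
  by move=> + /sin_lt0_Npi; rewrite leNgt => /negP.
have s2pi (x : R) : 0 <= sin x -> pi < x < 2 * pi -> False.
  by move=> + /sin_lt0_2pi; rewrite leNgt => /negP.
have [kt|tk] := leP (eta k) t; last first.
  apply: Or32; have h1 : t - eta k <= - pi.
    by rewrite leNgt; apply/negP => h; apply: (sN _ s1); lra.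
  have h2 : eta k.+1 - t >= 2 * pi.
    by rewrite leNgt; apply/negP => h; apply: (s2pi _ s2); lra.
  split; first by lra.
  apply/eqP; rewrite eqn_leq km leqNgt; apply/negP => km'.
  by have := eta_lt km' (leqnn m); lra.
have [tk|tk] := leP t (eta k.+1); first by apply: Or31.
apply: Or33; have h1 : eta k.+1 - t <= - pi.
  by rewrite leNgt; apply/negP => h; apply: (sN _ s2); lra.
have h2 : t - eta k >= 2 * pi.
  by rewrite leNgt; apply/negP => h; apply: (s2pi _ s1); lra.
split; first by lra.
apply/eqP; rewrite -leqn0 leqNgt; apply/negP => k0.
by have := eta_lt k0 (ltnW km); lra.
Qed.

Lemma axis_wedge k p : binding_axis p -> wedge k p.
Proof. by move=> [p1 p2]; rewrite /wedge /cross p1 p2 !mulr0 !mul0r subrr. Qed.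

Lemma page_wedge k p : (k < m)%N -> page (eta k) p \/ page (eta k.+1) p -> wedge k p.
Proof.
move=> km; have /andP[k1 k2] := eta_step km; have p0 := @pi_gt0 R.
by case=> -[r r0 pE]; rewrite /wedge pE !cross_dirl !cross_dirr;
  split; apply: mulr_ge0 => //; rewrite sin_ge0_pi//; lra.
Qed.

Lemma page0m : page (eta m) = page (eta 0).
Proof.
have e : eta m = eta 0 + pi *+ 2 by rewrite eta_last mulr_natl.
by rewrite /page e cosD2pi sinD2pi.
Qed.

Lemma wedge_inter k l p : (k < l)%N -> (l < m)%N -> wedge k p -> wedge l p ->
  [\/ binding_axis p, l = k.+1 /\ page (eta l) p | [/\ k = 0%N, l.+1 = m & page (eta m) p]].
Proof.
move=> kl lm wk wl; have km := ltn_trans kl lm.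
have [p0|pN0] := eqVneq p.1 (0, 0); first by apply: Or31; rewrite /binding_axis /= p0.
have [t [t1 pt]] := angle_window p.1; have r0 := vlen_gt0 pN0.
have pg t' : t = t' -> page t' p by move=> <-; exists (vlen p.1) => //; exact: ltW.
have el := eta_le kl (ltnW lm); have el' := eta_lt kl (ltnW lm).
have [h|[h1 h2]|[h1 h2]] := wedge_angle km wk pt r0 t1.
- have [h'|[h1 h2]|[h1 h2]] := wedge_angle lm wl pt r0 t1.
  + apply: Or32; have tl : t = eta l by lra.
    split; last exact: pg.
    apply/eqP; rewrite eqn_leq kl andbT leqNgt; apply/negP => kl'.
    by have := eta_lt kl' (ltnW lm); lra.
  + apply: Or33; split => //.
      apply/eqP; rewrite -leqn0 leqNgt; apply/negP => k0.
      by have := eta_lt k0 (ltnW km); lra.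
    by rewrite page0m; exact: pg.
  + by rewrite h2 in kl.
- by move: (leq_ltn_trans kl lm); rewrite h2 ltnn.
- have [h'|[h1' h2']|[h1' h2']] := wedge_angle lm wl pt r0 t1.
  + apply: Or33; split; [by []| |exact: pg].
    apply/eqP; rewrite eqn_leq lm leqNgt; apply/negP => lm'.
    by have := eta_lt lm' (leqnn m); lra.
  + by have := eta_lt m_gt0 (leqnn m); rewrite -h1 h1' ltxx.
  + by rewrite h2' in kl.
Qed.

Lemma wedge_closed k : closed [set p | wedge k p].
Proof.
have c1 : continuous (fun p : E3 R => cross (dir (eta k)) p.1) by rewrite /cross /dir /=; cts.
have c2 : continuous (fun p : E3 R => cross p.1 (dir (eta k.+1))) by rewrite /cross /dir /=; cts.
have -> : [set p | wedge k p] = (fun p : E3 R => cross (dir (eta k)) p.1) @^-1` [set x | 0 <= x]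
  `&` (fun p : E3 R => cross p.1 (dir (eta k.+1))) @^-1` [set x | 0 <= x] by [].
by apply: closedI; apply: preimage_closed => //; exact: closed_ge.
Qed.

Definition wedge_center k : E3 R :=
  (cos (eta k) + cos (eta k.+1), sin (eta k) + sin (eta k.+1), 0).

Variable K : set (E3 R).
Hypothesis K_pages : forall p, K p -> exists2 l, (l < m)%N & page (eta l) p.

Lemma wedge_interior k p : (k < m)%N ->
  0 < cross (dir (eta k)) p.1 -> 0 < cross p.1 (dir (eta k.+1)) -> ~ K p.
Proof.
move=> km c1 c2 /K_pages[l lm [r r0 pE]].
have rp : 0 < r.
  rewrite lt0r r0 andbT; apply/eqP => rz; move: c1.
  by rewrite pE cross_dirl rz mul0r ltxx.
have wp : wedge k p by split; exact: ltW.
have l1 : eta 0 <= eta l <= eta m by rewrite !eta_le// ltnW.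
have [h|[h1 h2]|[h1 h2]] := wedge_angle km wp pE rp l1.
- have [lk|kl|lk] := ltngtP l k.
  + by have := eta_lt lk (ltnW km); lra.
  + have [lk1|lk1] := eqVneq l k.+1.
      by move: c2; rewrite pE lk1 cross_dirr subrr sin0 mulr0 ltxx.
    have kl1 : (k.+1 < l)%N by rewrite ltn_neqAle eq_sym lk1.
    by have := eta_lt kl1 (ltnW lm); lra.
  + by move: c1; rewrite pE lk cross_dirl subrr sin0 mulr0 ltxx.
- move: c2; rewrite pE cross_dirr h2 eta_last h1.
  have -> : eta 0 + 2 * pi - eta 0 = pi *+ 2 by rewrite mulr_natl addrAC subrr add0r.
  by rewrite sin2pi mulr0 ltxx.
- by have := eta_lt lm (leqnn m); rewrite h1 ltxx.
Qed.

(** The centre, on the bisector, lies strictly inside the sector since consecutive pages differ by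
    less than [pi]. So does every point of the segment except possibly its end [p], and [K],
    contained in the pages, is absent there. *)
Lemma wedge_star k p (s : R) : (k < m)%N -> wedge k p -> ~ K p -> 0 <= s <= 1 ->
  wedge k (wedge_center k + s *: (p - wedge_center k)) /\
  ~ K (wedge_center k + s *: (p - wedge_center k)).
Proof.
move=> km wp nK s1; have /andP[k1 k2] := eta_step km.
have [s11|s11] := eqVneq s 1.
  by rewrite s11 scale1r addrC subrK.
have sl : s < 1 by rewrite lt_neqAle s11; lra.
have sp : 0 < sin (eta k.+1 - eta k) by apply: sin_gt0_pi; lra.
set q := _ + _.
have q1 : q.1 = ((1 - s) * (cos (eta k) + cos (eta k.+1)) + s * p.1.1,
    (1 - s) * (sin (eta k) + sin (eta k.+1)) + s * p.1.2).
  case: p @q {wp nK} => -[x y] z; rewrite /wedge_center /=.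
  move: (cos (eta k) + _) (sin (eta k) + _) => a b.
  by transitivity (a + s * (x - a), b + s * (y - b)); [reflexivity|congr pair; ring].
have c1 : cross (dir (eta k)) q.1 =
    (1 - s) * sin (eta k.+1 - eta k) + s * cross (dir (eta k)) p.1.
  by rewrite q1 /cross /dir /= sinB; ring.
have c2 : cross q.1 (dir (eta k.+1)) =
    (1 - s) * sin (eta k.+1 - eta k) + s * cross p.1 (dir (eta k.+1)).
  by rewrite q1 /cross /dir /= sinB; ring.
have p1 : 0 < cross (dir (eta k)) q.1.
  rewrite c1 ltr_pwDl ?mulr_gt0 ?subr_gt0//; apply: mulr_ge0; [lra|exact: wp.1].
have p2 : 0 < cross q.1 (dir (eta k.+1)).
  rewrite c2 ltr_pwDl ?mulr_gt0 ?subr_gt0//; apply: mulr_ge0; [lra|exact: wp.2].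
by split; [split; exact: ltW|exact: wedge_interior p1 p2].
Qed.
End Wedges.

Lemma star_connected (R : realType) (V : normedModType R) (D : set V) (c : V) :
  (forall p (s : R), D p -> 0 <= s <= 1 -> D (c + s *: (p - c))) -> connected D.
Proof.
move=> starD.
have -> : D = \bigcup_(p in D) ((fun s : R => c + s *: (p - c)) @` `[0, 1]%classic).
  apply/seteqP; split=> [p Dp|p [q Dq [s]]].
    exists p => //; exists 1; first by rewrite /= in_itv /= ler01 lexx.
    by rewrite scale1r addrC subrK.
  by rewrite /= in_itv /= => s1 <-; exact: starD.
apply: bigcup_connected.
  exists c => p Dp; exists 0; first by rewrite /= in_itv /= ler01 lexx.
  by rewrite scale0r addr0.
move=> p Dp; apply: connected_continuous_connected; first exact: segment_connected.
apply: continuous_subspaceT => s; apply: cvgD; first exact: cvg_cst.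
by apply: cvgZ; [exact: cvg_id|exact: cvg_cst].
Qed.

Lemma perm3_tperm (s : 'S_3) (i j k : 'I_3) : i != j -> i != k -> j != k ->
  s i = j -> s j = i -> s k = k -> odd_perm s.
Proof.
move=> ij ik jk si sj sk; suff -> : s = tperm i j by rewrite odd_tperm ij.
apply/permP => l; case: tpermP => [->|->|] //; move: (ltn_ord l) (ltn_ord k) (ltn_ord i) (ltn_ord j).
move=> l3 k3 i3 j3 /eqP li /eqP lj; suff -> : l = k by [].
apply/val_inj; move: ij ik jk li lj; rewrite -!val_eqE /=; lia.
Qed.

Lemma even_perm3 (s : 'S_3) : ~~ odd_perm s ->
  [\/ [/\ s ord0 = ord0, s (inord 1) = inord 1 & s (inord 2) = inord 2],
      [/\ s ord0 = inord 1, s (inord 1) = inord 2 & s (inord 2) = ord0] |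
      [/\ s ord0 = inord 2, s (inord 1) = ord0 & s (inord 2) = inord 1]].
Proof.
move=> sE.
have n01 : ord0 != inord 1 :> 'I_3 by rewrite -val_eqE /= inordK.
have n02 : ord0 != inord 2 :> 'I_3 by rewrite -val_eqE /= inordK.
have n12 : inord 1 != inord 2 :> 'I_3 by rewrite -val_eqE /= !inordK.
have all3 (i : 'I_3) : [\/ i = ord0, i = inord 1 | i = inord 2].
  case: i => [[|[|[|]]]] // i3.
  - by apply: Or31; apply/val_inj.
  - by apply: Or32; apply/val_inj; rewrite /= inordK.
  - by apply: Or33; apply/val_inj; rewrite /= inordK.
have inj (i j : 'I_3) : i != j -> s i != s j by rewrite (inj_eq perm_inj).
have odd (i j k : 'I_3) : i != j -> i != k -> j != k ->
  s i = j -> s j = i -> s k = k -> False.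
  by move=> ij ik jk si sj sk; move: sE; rewrite (perm3_tperm ij ik jk si sj sk).
move: (inj _ _ n01) (inj _ _ n02) (inj _ _ n12).
case: (all3 (s ord0)) => s0; case: (all3 (s (inord 1))) => s1; case: (all3 (s (inord 2))) => s2;
  rewrite s0 s1 s2 ?eqxx // => _ _ _.
- by apply: Or31.
- by exfalso; apply: (odd (inord 1) (inord 2) ord0); rewrite // eq_sym.
- by exfalso; apply: (odd ord0 (inord 1) (inord 2)); rewrite // eq_sym.
- by apply: Or32.
- by apply: Or33.
- by exfalso; apply: (odd ord0 (inord 2) (inord 1)); rewrite // eq_sym.
Qed.

(** * Sheets over the wedges and their transitions *)

Section Sheets.
Variables (R : realType) (m : nat) (eta : nat -> R).
Hypothesis eta_step : forall k, (k < m)%N -> eta k < eta k.+1 < eta k + pi.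
Hypothesis eta_last : eta m = eta 0 + 2 * pi.
Variable K : set (E3 R).
Hypothesis K_pages : forall p, K p -> exists2 l, (l < m)%N & page (eta l) p.
Variable Q : E3 R -> R[i] -> Prop.
Local Notation cdist := (@cdist R).
Hypothesis covQ : covering cdist (~` K) Q.
Hypothesis rootsQ : forall b, ~ K b -> exists t : 'I_3 -> R[i],
  injective t /\ forall T, Q b T <-> exists i, T = t i.
Variable q0 : E3 R.
Hypotheses (q0_axis : binding_axis q0) (q0K : ~ K q0).

Local Notation wedge := (wedge eta).
Let S k := [set p | wedge k p /\ ~ K p].

Let S_star k : (k < m)%N -> forall p (s : R), S k p -> 0 <= s <= 1 ->
  S k (wedge_center eta k + s *: (p - wedge_center eta k)).
Proof.
by move=> km p s [wp nK] s1; exact: (wedge_star eta_step eta_last K_pages km wp nK s1).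
Qed.

Let S_connected k : (k < m)%N -> connected (S k).
Proof. by move=> km; apply: star_connected; exact: S_star. Qed.

Let S_covering k : covering cdist (S k) Q.
Proof.
have h : S k `<=` ~` K by move=> p [].
exact: covering_sub h covQ.
Qed.

Let Sq0 k : S k q0. Proof. by split => //; exact: axis_wedge. Qed.

Lemma base_roots : {t : 'I_3 -> R[i] | injective t /\ forall T, Q q0 T <-> exists i, T = t i}.
Proof. exact: cid (rootsQ q0K). Qed.

(** All wedges contain the axis, so the sheets over each of them can be numbered by the roots over
    the one base point [q0]. This makes all transitions at [q0] trivial. *)
Lemma sheets_exist : {sh : nat -> 'I_3 -> E3 R -> R[i] |
  forall k i, (k < m)%N -> lift_on cdist (S k) Q (sh k i) /\ sh k i q0 = sval base_roots i}.
Proof.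
suff : exists sh : nat -> 'I_3 -> E3 R -> R[i], forall k i, (k < m)%N ->
    lift_on cdist (S k) Q (sh k i) /\ sh k i q0 = sval base_roots i by move/cid.
have /choice[f Hf] : forall ki : nat * 'I_3, exists s : E3 R -> R[i], (ki.1 < m)%N ->
    lift_on cdist (S ki.1) Q s /\ s q0 = sval base_roots ki.2.
  move=> [k i] /=; have [km|_] := ltnP k m; last by exists (fun _ => 0).
  have Qi : Q q0 (sval base_roots i) by apply/(svalP base_roots).2; exists i.
  have [s ls sE] := star_lift (@cdistxx R) (@cdistC R) (@cdistD R) (@cdist0 R)
    (S_star km) (@S_covering k) (Sq0 k) Qi.
  by exists s.
by exists (fun k i => f (k, i)) => k i km; exact: (Hf (k, i)).
Qed.

Definition sheet := sval sheets_exist.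

Lemma sheet_lift k i : (k < m)%N -> lift_on cdist (S k) Q (sheet k i).
Proof. by move=> km; have [] := svalP sheets_exist k i km. Qed.

Lemma sheet_base k i : (k < m)%N -> sheet k i q0 = sval base_roots i.
Proof. by move=> km; have [] := svalP sheets_exist k i km. Qed.

Lemma sheet_inj k b : (k < m)%N -> S k b -> injective (fun i => sheet k i b).
Proof.
move=> km Sb i j E; apply: (svalP base_roots).1.
rewrite -!(@sheet_base k)//.
exact: (lift_unique (@cdistC R) (@cdistD R) (@cdist0 R) (@S_covering k) (S_connected km)
  (sheet_lift i km) (sheet_lift j km) Sb E (Sq0 k)).
Qed.

Lemma sheet_surj k b T : (k < m)%N -> S k b -> Q b T -> exists i, T = sheet k i b.
Proof.
move=> km Sb QT; have [t [tinj tP]] := rootsQ Sb.2.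
have /choice[f Hf] : forall i, exists j, sheet k i b = t j.
  by move=> i; apply/tP; exact: ((sheet_lift i km).2 b Sb).
have finj : injective f.
  by move=> i j E; apply: (sheet_inj km Sb); rewrite /= !Hf E.
have [j ->] := (tP T).1 QT; exists (invF finj j).
by rewrite Hf f_invF.
Qed.

Definition transition k l b (s : 'S_3) := forall i, sheet k i b = sheet l (s i) b.

Lemma transition_exists k l b : (k < m)%N -> (l < m)%N -> S k b -> S l b ->
  exists s, transition k l b s.
Proof.
move=> km lm Sk Sl.
have /choice[f Hf] : forall i, exists j, sheet k i b = sheet l j b.
  by move=> i; apply: sheet_surj => //; exact: ((sheet_lift i km).2 b Sk).
have finj : injective f.
  by move=> i j E; apply: (sheet_inj km Sk); rewrite /= !Hf E.
by exists (perm finj) => i; rewrite permE.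
Qed.

Lemma transition_unique k l b s s' : (l < m)%N -> S l b ->
  transition k l b s -> transition k l b s' -> s = s'.
Proof.
move=> lm Sl ts ts'; apply/permP => i; apply: (sheet_inj lm Sl).
by rewrite /= -ts -ts'.
Qed.

Lemma transition_comp k l j b s s' :
  transition k l b s -> transition l j b s' -> transition k j b (s * s')%g.
Proof. by move=> ts ts' i; rewrite ts ts' permM. Qed.

Lemma transition_inv k l b s : transition k l b s -> transition l k b s^-1%g.
Proof. by move=> ts i; rewrite ts permKV. Qed.

Lemma transition_base k l : (k < m)%N -> (l < m)%N -> transition k l q0 1%g.
Proof. by move=> km lm i; rewrite perm1 !sheet_base. Qed.

Lemma transition_near k l b s : (k < m)%N -> (l < m)%N -> S k b -> S l b ->
  transition k l b s -> \forall b' \near b, S k b' -> S l b' -> transition k l b' s.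
Proof.
move=> km lm Sk Sl ts; have [_ [e e0 He]] := covQ Sk.2.
have : \forall b' \near b, forall i, S k b' -> S l b' -> sheet k i b' = sheet l (s i) b'.
  apply: (@filter_forall _ 'I_3 (fun i c => S k c -> S l c ->
    sheet k i c = sheet l (s i) c) (nbhs b)) => i.
  have e20 : 0 < e / 2 by lra.
  move: ((sheet_lift i km).1 b Sk _ e20) ((sheet_lift (s i) lm).1 b Sl _ e20) He.
  apply: filterS3 => c h1 h2 h3 Skc Slc; apply: (h3 Skc.2).
  - exact: ((sheet_lift i km).2 c Skc).
  - exact: ((sheet_lift (s i) lm).2 c Slc).
  apply: (le_lt_trans (cdistD _ (sheet k i b) _)).
  rewrite {2}(ts i) (cdistC (sheet l (s i) b)).
  by move: (h1 Skc) (h2 Slc); lra.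
by apply: filterS => c H Skc Slc i; exact: H.
Qed.

Lemma transition_near_not k l b s : (k < m)%N -> (l < m)%N -> S k b -> S l b ->
  ~ transition k l b s -> \forall b' \near b, S k b' -> S l b' -> ~ transition k l b' s.
Proof.
move=> km lm Sk Sl nts; have [s' ts'] := transition_exists km lm Sk Sl.
have := transition_near km lm Sk Sl ts'; apply: filterS => c H Skc Slc ts.
by apply: nts; rewrite (transition_unique lm Slc ts (H Skc Slc)).
Qed.

Definition next k := if k.+1 == m then 0%N else k.+1.

Lemma next_lt k : (k < m)%N -> (next k < m)%N.
Proof.
move=> km; rewrite /next; case: eqP => [_|/eqP km']; first exact: (m_gt0 eta_last).
by rewrite ltn_neqAle km'.
Qed.

Lemma axis_S k b : binding_axis b -> ~ K b -> S k b.
Proof. by move=> ab nK; split => //; exact: axis_wedge. Qed.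

Lemma transition_path b (s : nat -> 'S_3) j : binding_axis b -> ~ K b ->
  (forall k, (k < m)%N -> transition k (next k) b (s k)) -> (j < m)%N ->
  transition 0 j b (\prod_(k < j) s k)%g.
Proof.
move=> ab nK Hs; elim: j => [|j IHj] jm.
  by rewrite big_ord0 => i; rewrite perm1.
rewrite big_ord_recr /=; apply: transition_comp (IHj (ltnW jm)) _.
have := Hs j (ltnW jm); rewrite /next; case: eqP => // jE.
by rewrite jE ltnn in jm.
Qed.

Lemma transition_prod b (s : nat -> 'S_3) : binding_axis b -> ~ K b ->
  (forall k, (k < m)%N -> transition k (next k) b (s k)) ->
  (\prod_(k < m) s k)%g = 1%g.
Proof.
move=> ab nK Hs; have m0 := m_gt0 eta_last.
have jm : (m.-1 < m)%N by rewrite prednK.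
have := transition_path ab nK Hs jm; have := Hs _ jm.
rewrite /next prednK// eqxx => t1 t2.
have t := transition_comp t2 t1.
have -> : (\prod_(k < m) s k = \prod_(k < m.-1) s k * s m.-1)%g.
  rewrite -!(big_mkord xpredT s) -big_nat_recr//=.
  by rewrite prednK.
apply: (transition_unique m0 (axis_S 0 ab nK) t).
by move=> i; rewrite perm1.
Qed.

Section Monodromy.
Variable good : 'S_3 -> Prop.
Hypothesis good1 : good 1%g.
Hypothesis goodM : forall s t, good s -> good t -> good (s * t)%g.
Hypothesis goodV : forall s, good s -> good s^-1%g.
Hypothesis adjacent_good : forall k b s, (k < m)%N -> page (eta k.+1) b -> ~ K b ->
  transition k (next k) b s -> good s.

Lemma axis_page (t : R) b : binding_axis b -> page t b.
Proof. by case: b => -[x y] z [/= -> ->]; exists 0 => //; rewrite !mul0r. Qed.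

Lemma next_wedge k b : (k < m)%N -> page (eta k.+1) b -> wedge k b /\ wedge (next k) b.
Proof.
move=> km pb; split; first by apply: (page_wedge eta_step km); right.
rewrite /next; case: eqP => [kE|kE].
  apply: (page_wedge eta_step (m_gt0 eta_last)); left.
  by rewrite -(page0m eta_last) -kE.
by apply: (page_wedge eta_step) => //; [rewrite ltn_neqAle km andbT; apply/eqP|left].
Qed.

(** Adjacent wedges meet in a page. Other wedges meet only in the axis, and the transition at an
    axis point is composed of adjacent ones and their inverses. *)
Lemma transition_good k l b s : (k < m)%N -> (l < m)%N -> S k b -> S l b ->
  transition k l b s -> good s.
Proof.
have axis_case k' b' : binding_axis b' -> ~ K b' -> (k' < m)%N ->
    exists2 u, good u & transition 0 k' b' u.
  move=> ab nK; elim: k' => [|k' IH] km.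
    by exists 1%g => // i; rewrite perm1.
  have [u ug ts] := IH (ltnW km).
  have [s' ts'] := transition_exists (ltnW km) (next_lt (ltnW km))
    (axis_S k' ab nK) (axis_S _ ab nK).
  exists (u * s')%g.
    by apply: goodM => //; apply: adjacent_good ts' => //; [exact: ltnW|exact: axis_page].
  apply: transition_comp ts _; move: ts'; rewrite /next; case: eqP => // kE.
  by rewrite kE ltnn in km.
have lt_case k' l' b' s' : (k' < l')%N -> (l' < m)%N -> S k' b' -> S l' b' ->
    transition k' l' b' s' -> good s'.
  move=> kl lm Sk Sl ts; have km := ltn_trans kl lm; have nK := Sk.2.
  have [ab|[lE pl]|[kE lE pm]] := wedge_inter eta_step eta_last kl lm Sk.1 Sl.1.
  - have [u ug tu] := axis_case k' b' ab nK km; have [v vg tv] := axis_case l' b' ab nK lm.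
    have tt := transition_comp (transition_inv tu) tv.
    by rewrite (transition_unique lm Sl ts tt); apply: goodM => //; exact: goodV.
  - apply: (adjacent_good km (b := b')) => //; first by rewrite -lE.
    rewrite /next -lE; case: eqP => // lm'; by rewrite lm' ltnn in lm.
  - rewrite -[s']invgK; apply: goodV; apply: (adjacent_good lm (b := b')) => //; first by rewrite lE.
    by rewrite /next lE eqxx; have := transition_inv ts; rewrite kE.
move=> km lm Sk Sl ts; have [kl|lk|kl] := ltngtP k l.
- exact: lt_case ts.
- by rewrite -[s]invgK; apply: goodV; apply: lt_case (transition_inv ts).
- subst l; have -> : s = 1%g.
    by apply: (transition_unique lm Sl ts) => i; rewrite perm1.
  exact: good1.
Qed.

(** [good] stands for a subgroup containing all transitions: the stabilizer of a root, or the even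
    permutations. A function of the roots that is invariant under it takes the same value on the
    sheets of all wedges through a point. The values glue continuously because the wedges are
    finitely many closed sets. *)
Lemma glue_sheets (F : ('I_3 -> R[i]) -> R[i]) :
  (forall (t : 'I_3 -> R[i]) (s : 'S_3), good s -> F (fun i => t (s i)) = F t) ->
  (forall k, (k < m)%N -> continuous_to cdist (S k) (fun b => F (fun i => sheet k i b))) ->
  exists2 r, continuous_to cdist (~` K) r &
    forall b, ~ K b -> exists k, [/\ (k < m)%N, S k b & r b = F (fun i => sheet k i b)].
Proof.
move=> Finv Fcont.
have /choice[r0 Hr0] : forall b, exists y, forall k, (k < m)%N -> S k b ->
    y = F (fun i => sheet k i b).
  move=> b; have [nK|Kb] := pselect (~ K b); last first.
    by exists 0 => k _ [_ nK].
  have [k [km wk]] := wedge_cover eta_step eta_last b.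
  exists (F (fun i => sheet k i b)) => l lm Sl.
  have Sk : S k b by [].
  have [s ts] := transition_exists km lm Sk Sl.
  rewrite -(Finv (fun i => sheet l i b) s (transition_good km lm Sk Sl ts)); congr F.
  by apply/funext => i; exact: ts.
exists r0; last first.
  move=> b nK; have [k [km wk]] := wedge_cover eta_step eta_last b.
  by exists k; split => //; apply: Hr0.
move=> b /= nK e e0.
have : \forall c \near b, forall k : 'I_m, S k c -> cdist (r0 c) (r0 b) < e.
  apply: (@filter_forall _ 'I_m (fun k c => S k c -> cdist (r0 c) (r0 b) < e) (nbhs b)) => k.
  have [wk|nwk] := pselect (wedge k b).
    have Sk : S k b by [].
    have := Fcont k (ltn_ord k) b Sk e e0; apply: filterS => c H Sc.
    by rewrite (Hr0 b k)// (Hr0 c k)//; exact: H.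
  have : nbhs b (~` [set p | wedge k p]).
    apply: open_nbhs_nbhs; split => //; apply: closed_openC; exact: wedge_closed.
  by apply: filterS => c nwc [wc _].
apply: filterS => c H nKc; have [k [km wk]] := wedge_cover eta_step eta_last c.
exact: (H (Ordinal km)).
Qed.
End Monodromy.

Lemma global_root (i0 : 'I_3) :
  (forall k b s, (k < m)%N -> page (eta k.+1) b -> ~ K b ->
    transition k (next k) b s -> s i0 = i0) ->
  exists r, lift_on cdist (~` K) Q r.
Proof.
move=> H.
have [||||t s|k km|r cr rE] := @glue_sheets (fun s : 'S_3 => s i0 = i0) _ _ _ _ (fun t => t i0).
- by rewrite perm1.
- by move=> s t si ti; rewrite permM si ti.
- by move=> s si; rewrite -{1}si permK.
- by move=> k b s km pb nK ts; exact: (H k b s).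
- by move=> ->.
- exact: (sheet_lift i0 km).1.
exists r; split => // b nK; have [k [km Sk ->]] := rE b nK.
exact: ((sheet_lift i0 km).2 b Sk).
Qed.

(** A square root of the discriminant; only odd permutations change its sign. *)
Definition vandermonde3 (t : 'I_3 -> R[i]) : R[i] :=
  (t ord0 - t (inord 1)) * (t (inord 1) - t (inord 2)) * (t (inord 2) - t ord0).

Lemma global_disc :
  (forall k b s, (k < m)%N -> page (eta k.+1) b -> ~ K b ->
    transition k (next k) b s -> ~~ odd_perm s) ->
  exists2 r, continuous_to cdist (~` K) r &
    forall b, ~ K b -> exists t : 'I_3 -> R[i],
      [/\ injective t, forall i, Q b (t i) & r b = vandermonde3 t].
Proof.
move=> H.
have [||||t s|k km|r cr rE] := @glue_sheets (fun s : 'S_3 => ~~ odd_perm s) _ _ _ _ vandermonde3.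
- by rewrite odd_perm1.
- by move=> s t; rewrite odd_permM => /negbTE -> /negbTE ->.
- by move=> s; rewrite odd_permV.
- by move=> k b s km pb nK ts; exact: (H k b s).
- by move=> /even_perm3 sE; rewrite /vandermonde3; case: sE => -[-> -> ->]; ring.
- have ci i := (sheet_lift i km).1.
  by rewrite /vandermonde3; apply: continuous_toM; [apply: continuous_toM|]; apply: continuous_toB.
exists r => // b nK; have [k [km Sk ->]] := rE b nK.
exists (fun i => sheet k i b); split => //; first exact: sheet_inj.
by move=> i; exact: ((sheet_lift i km).2 b Sk).
Qed.

(** The interface to the sheets, which are not mentioned afterwards: [T k b s] says that crossing
    the page [eta k.+1] at [b] permutes the sheets by [s]. *)
Lemma monodromy_exists : exists T : nat -> E3 R -> 'S_3 -> Prop,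
  [/\ forall k b, (k < m)%N -> page (eta k.+1) b -> ~ K b -> exists2 s, T k b s &
        forall s', T k b s' -> s' = s,
      forall k b s, (k < m)%N -> page (eta k.+1) b -> ~ K b ->
        (T k b s -> \forall c \near b, page (eta k.+1) c -> ~ K c -> T k c s) /\
        (~ T k b s -> \forall c \near b, page (eta k.+1) c -> ~ K c -> ~ T k c s),
      (forall k, (k < m)%N -> T k q0 1%g) /\
      (forall b (s : nat -> 'S_3), binding_axis b -> ~ K b ->
        (forall k, (k < m)%N -> T k b (s k)) -> (\prod_(k < m) s k)%g = 1%g),
      forall i0 : 'I_3, (forall k b s, (k < m)%N -> page (eta k.+1) b -> ~ K b ->
        T k b s -> s i0 = i0) -> exists r, lift_on cdist (~` K) Q r &
      (forall k b s, (k < m)%N -> page (eta k.+1) b -> ~ K b -> T k b s -> ~~ odd_perm s) ->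
      exists2 r, continuous_to cdist (~` K) r &
        forall b, ~ K b -> exists t : 'I_3 -> R[i],
          [/\ injective t, forall i, Q b (t i) & r b = vandermonde3 t]].
Proof.
have SS k b : (k < m)%N -> page (eta k.+1) b -> ~ K b -> S k b /\ S (next k) b.
  by move=> km pb nK; have [] := next_wedge km pb.
exists (fun k => transition k (next k)); split.
- move=> k b km pb nK; have [Sk Sn] := SS _ _ km pb nK.
  have [s ts] := transition_exists km (next_lt km) Sk Sn; exists s => // s' ts'.
  exact: (transition_unique (next_lt km) Sn ts' ts).
- move=> k b s km pb nK; have [Sk Sn] := SS _ _ km pb nK; split.
    move=> /(transition_near km (next_lt km) Sk Sn); apply: filterS => c H pc nKc.
    by have [] := SS _ _ km pc nKc; exact: H.
  move=> /(transition_near_not km (next_lt km) Sk Sn); apply: filterS => c H pc nKc.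
  by have [] := SS _ _ km pc nKc; exact: H.
- split; first by move=> k km; apply: transition_base => //; exact: next_lt.
  by move=> b s ab nK Hs; exact: (transition_prod ab nK Hs).
- exact: global_root.
- exact: global_disc.
Qed.
End Sheets.

(** * Relations in the symmetric group *)

(** The digits of a constructor are the images of 0, 1 and 2. This copy of the symmetric group
    computes by case analysis, as the enumeration demands. *)
Inductive s3 := P012 | P021 | P102 | P120 | P201 | P210.

Definition act3 (c : s3) (i : nat) : nat :=
  match c, i with
  | P012, _ => i
  | P021, 0 => 0 | P021, 1 => 2 | P021, _ => 1
  | P102, 0 => 1 | P102, 1 => 0 | P102, _ => 2
  | P120, 0 => 1 | P120, 1 => 2 | P120, _ => 0
  | P201, 0 => 2 | P201, 1 => 0 | P201, _ => 1
  | P210, 0 => 2 | P210, 1 => 1 | P210, _ => 0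
  end%N.

Definition mul3 (c d : s3) : s3 :=
  match act3 d (act3 c 0), act3 d (act3 c 1) with
  | 0, 1 => P012 | 0, _ => P021
  | 1, 0 => P102 | 1, _ => P120
  | _, 0 => P201 | _, _ => P210
  end%N.

Definition is_id3 c := if c is P012 then true else false.
Definition even3 c := match c with P012 | P120 | P201 => true | _ => false end.
Definition all_s3 := [:: P012; P021; P102; P120; P201; P210].

(* Below, an arc is a triple (lowest vertex, highest vertex, page), the vertices
   being numbered by increasing height. *)
Section Check.
Local Open Scope nat_scope.

(** [v] lists the ranks of the vertices in their order along the knot, [P] the pages of the arcs;
    arc [e] joins vertex [e] to the next one cyclically. *)
Definition arc_of (v P : seq nat) (e : nat) : nat * nat * nat :=
  let a := nth 0 v e in let b := nth 0 v (e.+1 %% size v) in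
  (minn a b, maxn a b, nth 0 P e).
Definition arcs_of v P := [seq arc_of v P e | e <- iota 0 (size v)].

Definition spans (a : nat * nat * nat) k := (a.1.1 <= k) && (k < a.1.2).
Definition unlinked (a b : nat * nat * nat) :=
  [|| a.1.2 < b.1.1, b.1.2 < a.1.1, (a.1.1 < b.1.1) && (b.1.2 < a.1.2)
    | (b.1.1 < a.1.1) && (a.1.2 < b.1.2)].
Definition valid_config v P :=
  all (fun j => j \in P) (iota 0 4) &&
  all (fun e => all (fun f => (e == f) || (nth 0 P e != nth 0 P f) ||
    unlinked (arc_of v P e) (arc_of v P f)) (iota 0 (size v))) (iota 0 (size v)).

Definition innermost (arcs : seq (nat * nat * nat)) k j :=
  find (fun a => [&& a.2 == j, spans a k &
    all (fun b => (b.2 == j) && spans b k ==> (b.1.1 <= a.1.1)) arcs]) arcs.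

(** Ensures that one unknown per arc suffices: gap [k] and the gap [l] just above the lower end of
    the innermost arc are spanned by the same arcs of the page, so their transitions coincide. The
    bound on [l] says that it does number a gap. *)
Definition pattern_ok arcs k j :=
  let e := innermost arcs k j in
  if e < size arcs then
    let l := (nth (0, 0, 0) arcs e).1.1 in
    (l.+1 < size arcs) &&
    all (fun b => (b.2 == j) ==> (spans b k == spans b l)) arcs
  else all (fun b => (b.2 == j) ==> ~~ spans b k) arcs.

Definition arc_row arcs k := [seq innermost arcs k j | j <- iota 0 4].
(** An index beyond the unknowns, standing for a page without spanning arc, yields the default
    [P012], the identity. *)
Definition row_word (x : seq s3) (r : seq nat) :=
  foldl (fun acc i => mul3 acc (nth P012 x i)) P012 r.
Definition relation x r := is_id3 (row_word x r).

(* The relations of a configuration only matter up to rotation, which leaves few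
   distinct systems to enumerate. *)
Definition rotate_row n (r : seq nat) :=
  let r := [seq i <- r | i < n] in rot (find (pred1 (foldr minn n r)) r) r.

Fixpoint words (T : Type) (alphabet : seq T) n : seq (seq T) :=
  if n is n'.+1 then [seq a :: w | a <- alphabet, w <- words alphabet n'] else [:: [::]].

Definition conclusion (x : seq s3) :=
  has (fun i => all (fun c => act3 c i == i) x) (iota 0 3) || all even3 x.

Definition determined m l (r : seq nat) := all (fun i => (i < m) || (l <= i)) r.
(** The first and the last unknown are chosen before those in between. [P012] only fills the places
    still open, and a relation is tested as soon as it avoids them. *)
Definition partial_ok rows (pre : seq s3) d b :=
  let x := pre ++ rcons (nseq d P012) b in
  all (fun r => if determined (size pre) (size pre + d) r then relation x r else true) rows.

Fixpoint search rows (pre : seq s3) d b :=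
  if d is d'.+1 then
    all (fun c => let pre' := rcons pre c in
      if partial_ok rows pre' d' b then search rows pre' d' b else true) all_s3
  else conclusion (rcons pre b).

Definition check_relations n (rows : seq (seq nat)) :=
  all (fun b => all (fun a =>
    if partial_ok rows [:: a] (n - 2) b then search rows [:: a] (n - 2) b else true) all_s3)
    all_s3.

Definition check_patterns v P :=
  let arcs := arcs_of v P in
  all (fun k => all (fun j => pattern_ok arcs k j) (iota 0 4)) (iota 0 (size v).-1).

Definition config_rows v P :=
  let arcs := arcs_of v P in
  [seq rotate_row (size arcs) (arc_row arcs k) | k <- iota 0 (size arcs).-1].

Definition valid_words n w := [seq P <- words (iota 0 4) n | valid_config (0 :: w) P].

(** The vertices are listed from the lowest one on, so only the order of the others is enumerated.
    The systems of relations are collected without repetition before they are solved. *)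
Definition check_all n :=
  let ws := permutations (iota 1 n.-1) in
  all (fun w => all (check_patterns (0 :: w)) (valid_words n w)) ws &&
  all (check_relations n) (undup (flatten
    [seq undup [seq config_rows (0 :: w) P | P <- valid_words n w] | w <- ws])).

Lemma check_all4 : check_all 4.
Proof. by vm_cast_no_check (erefl true). Qed.

Lemma check_all5 : check_all 5.
Proof. by vm_cast_no_check (erefl true). Qed.
End Check.

Section Codes.
Local Open Scope nat_scope.

Definition coded (s : 'S_3) (c : s3) := forall i : 'I_3, s i = act3 c i :> nat.

Lemma mul3E c d i : i < 3 -> act3 (mul3 c d) i = act3 d (act3 c i).
Proof. by case: c; case: d; case: i => [|[|[|]]]. Qed.

Lemma coded_exists s : exists c, coded s c.
Proof.
pose i0 : 'I_3 := inord 0; pose i1 : 'I_3 := inord 1; pose i2 : 'I_3 := inord 2.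
have all3 (i : 'I_3) : [\/ i = i0, i = i1 | i = i2].
  case: i => [[|[|[|]]]] // i3.
  - by apply: Or31; apply/val_inj; rewrite /= inordK.
  - by apply: Or32; apply/val_inj; rewrite /= inordK.
  - by apply: Or33; apply/val_inj; rewrite /= inordK.
have e01 : s i0 != s i1 by rewrite (inj_eq perm_inj) -val_eqE /= !inordK.
have e02 : s i0 != s i2 by rewrite (inj_eq perm_inj) -val_eqE /= !inordK.
have e12 : s i1 != s i2 by rewrite (inj_eq perm_inj) -val_eqE /= !inordK.
have cE c : nat_of_ord (s i0) = act3 c 0 -> nat_of_ord (s i1) = act3 c 1 ->
    nat_of_ord (s i2) = act3 c 2 -> coded s c.
  move=> h0 h1 h2 i; case: (all3 i) => ->; rewrite ?h0 ?h1 ?h2 /= inordK //.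
move: cE; rewrite -!val_eqE /= in e01 e02 e12 *.
move: (ltn_ord (s i0)) (ltn_ord (s i1)) (ltn_ord (s i2)) e01 e02 e12.
case: (nat_of_ord (s i0)) => [|[|[|]]] //; case: (nat_of_ord (s i1)) => [|[|[|]]] //;
  case: (nat_of_ord (s i2)) => [|[|[|]]] // _ _ _ _ _ _ H.
- by exists P012; apply: H.
- by exists P021; apply: H.
- by exists P102; apply: H.
- by exists P120; apply: H.
- by exists P201; apply: H.
- by exists P210; apply: H.
Qed.

Lemma coded_mul s t c d : coded s c -> coded t d -> coded (s * t)%g (mul3 c d).
Proof. by move=> sc td i; rewrite permM td sc mul3E. Qed.

Lemma coded1 c : coded 1%g c <-> c = P012.
Proof.
split=> [H|-> i]; last by rewrite perm1.
have := H (inord 0); have := H (inord 1); rewrite !perm1 !inordK //.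
by case: c {H}.
Qed.

(** An even code has trivial cube, so [s] cubed is 1 and [s] is even. *)
Lemma coded_even s c : coded s c -> even3 c -> ~~ odd_perm s.
Proof.
move=> sc ec.
have : odd_perm (s * (s * s))%g = false.
  have -> : (s * (s * s))%g = 1%g; last by rewrite odd_perm1.
  have := coded_mul sc (coded_mul sc sc).
  have -> : mul3 c (mul3 c c) = P012 by case: c {sc} ec.
  by move=> H; apply/permP => i; apply/val_inj; rewrite /= H perm1.
by rewrite !odd_permM; case: (odd_perm s).
Qed.
End Codes.

Section Combinatorics.
Local Open Scope nat_scope.

Lemma words_mem (T : eqType) (A w : seq T) : all (fun a => a \in A) w ->
  w \in words A (size w).
Proof.
elim: w => [|a w IHw] //= /andP[aA wA].
by apply/allpairsP; exists (a, w); split => //=; exact: IHw.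
Qed.

Lemma all_all_s3 (p : pred s3) c : all p all_s3 -> p c.
Proof. by case: c => /= /andP[? /andP[? /andP[? /andP[? /andP[? /andP[? _]]]]]]. Qed.

Lemma relation_determined (pre w : seq s3) d b r : size w = d ->
  determined (size pre) (size pre + d) r ->
  relation (pre ++ rcons (nseq d P012) b) r = relation (pre ++ rcons w b) r.
Proof.
move=> wd; rewrite /relation /row_word.
set x := pre ++ _; set y := pre ++ _.
have xy i : (i < size pre) || (size pre + d <= i) -> nth P012 x i = nth P012 y i.
  rewrite /x /y !nth_cat; case: ltnP => //= ip di.
  rewrite !nth_rcons size_nseq wd; have -> : (i - size pre < d) = false by lia.
  by [].
have foldE acc : determined (size pre) (size pre + d) r ->
    foldl (fun acc i => mul3 acc (nth P012 x i)) acc r =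
    foldl (fun acc i => mul3 acc (nth P012 y i)) acc r.
  by elim: r acc => //= i r IHr acc /andP[/xy -> /IHr].
by move=> /foldE ->.
Qed.

Lemma searchP rows b d (pre w : seq s3) : size w = d -> search rows pre d b ->
  all (relation (pre ++ rcons w b)) rows -> conclusion (pre ++ rcons w b).
Proof.
elim: d pre w => [|d IHd] pre [|c w] //; first by rewrite /= cats1.
move=> [wd] H rel; rewrite /= -cat_rcons.
have {}H := @all_all_s3 (fun c => let pre' := rcons pre c in
  if partial_ok rows pre' d b then search rows pre' d b else true) c H.
apply: IHd => //; last by rewrite cat_rcons.
move: H => /=; case: ifP => // /negP[]; apply/allP => r rr.
case: ifP => // det; rewrite (relation_determined b wd det) cat_rcons.
exact: (allP rel).
Qed.

Lemma check_relationsP n rows x : check_relations n rows -> size x = n -> 2 <= n ->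
  all (relation x) rows -> conclusion x.
Proof.
move=> + sx n2 Hx; rewrite /check_relations => H.
case: x sx Hx => [|a x]; first by move=> /= sx; rewrite -sx in n2.
case/lastP: x => [|w b] /=; first by move=> sx; rewrite -sx in n2.
rewrite size_rcons => sx Hx.
have {}H := @all_all_s3 (fun b => all (fun a => if partial_ok rows [:: a] (n - 2) b
  then search rows [:: a] (n - 2) b else true) all_s3) b H.
have := @all_all_s3 (fun a => if partial_ok rows [:: a] (n - 2) b
  then search rows [:: a] (n - 2) b else true) a H.
move=> {H}.
have wn : size w = n - 2 by lia.
case: ifP => [_ H|/negP[]]; first exact: (searchP wn H Hx).
apply/allP => r rr; case: ifP => // det.
by rewrite (relation_determined b wn det); exact: (allP Hx).
Qed.

Lemma mul3A : associative mul3. Proof. by do 3!case. Qed.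

Lemma row_word_cat x r r' : row_word x (r ++ r') = mul3 (row_word x r) (row_word x r').
Proof.
rewrite /row_word foldl_cat; move: (foldl _ P012 r) => c.
elim/last_ind: r' => [|r' i IHr]; first by case: c.
by rewrite -!cats1 !foldl_cat /= IHr mul3A.
Qed.

Lemma relation_rotate_row x r : relation x (rotate_row (size x) r) = relation x r.
Proof.
have relC c d : is_id3 (mul3 c d) = is_id3 (mul3 d c) by case: c; case: d.
rewrite /relation /rotate_row /rot row_word_cat relC -row_word_cat cat_take_drop; congr is_id3.
suff H c : foldl (fun acc i => mul3 acc (nth P012 x i)) c [seq i <- r | i < size x] =
    foldl (fun acc i => mul3 acc (nth P012 x i)) c r by exact: H.
elim: r c => //= i r IHr c; case: ltnP => [ix|xi] /=; first exact: IHr.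
by rewrite IHr nth_default//; case: c.
Qed.

(** The two conclusions together characterize the abelian subgroups of the symmetric group of degree
    3. [g k j] is the transition across page [j] at gap [k]: one relation per gap, dependence on the
    spanning arcs only, and triviality in their absence reduce the claim to the finite check. *)
Theorem monodromy_abelian n v P (g : nat -> nat -> 'S_3) : (n == 4) || (n == 5) ->
  size v = n -> perm_eq v (iota 0 n) -> nth 0 v 0 = 0 -> size P = n ->
  all (fun j => j < 4) P -> valid_config v P ->
  (forall k, k < n.-1 -> (g k 0%N * g k 1%N * g k 2%N * g k 3%N)%g = 1%g) ->
  (forall k l j, k < n.-1 -> l < n.-1 -> j < 4 ->
    (forall e, e < n -> nth 0 P e = j ->
       spans (arc_of v P e) k = spans (arc_of v P e) l) -> g k j = g l j) ->
  (forall k j, k < n.-1 -> j < 4 ->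
    (forall e, e < n -> nth 0 P e = j -> ~~ spans (arc_of v P e) k) -> g k j = 1%g) ->
  (exists i : 'I_3, forall k j, k < n.-1 -> j < 4 -> g k j i = i) \/
  (forall k j, k < n.-1 -> j < 4 -> ~~ odd_perm (g k j)).
Proof.
move=> n45 sv pv v0 sP P4 val R1 R2 R3.
have [patt sys] : check_patterns v P /\ check_relations n (config_rows v P).
  have : check_all n by case/orP: n45 => /eqP ->; [exact: check_all4|exact: check_all5].
  clear R1 R2 R3; case: v sv pv v0 val => [|x w] sv pv /=; first by move: n45; rewrite -sv.
  move=> x0; subst x => val /andP[/allP patt /allP rel].
  have wP : w \in permutations (iota 1 n.-1).
    by rewrite mem_permutations; move: pv; rewrite -sv /= perm_cons.
  have PP : P \in valid_words n w.
    rewrite mem_filter val -sP; apply: words_mem; apply/allP => j jP; rewrite mem_iota /=.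
    by move/allP: P4 => /(_ j jP).
  split; first by have /allP := patt w wP; apply.
  apply: rel; rewrite mem_undup; apply/flattenP.
  exists (undup [seq config_rows (0 :: w) P | P <- valid_words n w]).
    by apply/mapP; exists w.
  by rewrite mem_undup; apply/mapP; exists P.
move: patt sys; rewrite /check_patterns /config_rows sv => /allP patt sys.
set arcs := arcs_of v P in patt sys.
have sa : size arcs = n by rewrite /arcs /arcs_of size_map size_iota sv.
have nthA e : e < n -> nth (0, 0, 0) arcs e = arc_of v P e.
  by move=> en; rewrite /arcs /arcs_of (nth_map 0) ?size_iota ?sv// nth_iota ?sv.
have allA (p : pred (nat * nat * nat)) : all p arcs -> forall e, e < n -> p (arc_of v P e).
  by move=> /allP H e en; rewrite -nthA//; apply: H; rewrite mem_nth ?sa.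
have /choice[c Hc] : forall kj : nat * nat, exists c, coded (g kj.1 kj.2) c.
  by move=> [k j]; exact: coded_exists.
(* The unknown of an arc is the transition across its page in the gap just above its lower end. *)
pose x := [seq c (a.1.1, a.2) | a <- arcs].
have sx : size x = n by rewrite size_map.
have cE k j : k < n.-1 -> j < 4 -> c (k, j) = nth P012 x (innermost arcs k j).
  move=> kn j4.
  have kin : k \in iota 0 n.-1 by rewrite mem_iota.
  have := patt k kin => /allP /(_ j).
  rewrite mem_iota /= => /(_ j4); rewrite /pattern_ok sa.
  have uniq_code (s : 'S_3) a b : coded s a -> coded s b -> a = b.
    move=> sa' sb'; have h0 := sa' (inord 0); have h1 := sa' (inord 1).
    move: h0 h1; rewrite sb' (sb' (inord 1)) !inordK //.
    by case: a {sa'}; case: b {sb'}.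
  case: ltnP => en; last first.
    move=> /allA H; rewrite nth_default ?sx//.
    apply/coded1; have <- : g k j = 1%g; last exact: (Hc (k, j)).
    by apply: R3 => // e en' Pe; have := H e en'; rewrite /= Pe eqxx.
  set l := (nth _ _ _).1.1 => /andP[ln /allA H].
  have jE : (nth (0, 0, 0) arcs (innermost arcs k j)).2 = j.
    have : has (fun a => [&& a.2 == j, spans a k &
      all (fun b => (b.2 == j) && spans b k ==> (b.1.1 <= a.1.1)) arcs]) arcs.
      by rewrite has_find sa.
    by move=> /(nth_find (0, 0, 0)) /and3P[/eqP].
  rewrite (nth_map (0, 0, 0)) ?sa// jE -/l.
  apply: (uniq_code (g k j)); first exact: (Hc (k, j)).
  have -> : g k j = g l j; last exact: (Hc (l, j)).
  apply: R2 => //; first by lia.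
  by move=> e en' Pe; have := H e en'; rewrite /= Pe eqxx => /eqP.
have relx k : k < n.-1 -> relation x (arc_row arcs k).
  move=> kn; rewrite /relation /row_word /arc_row /=.
  rewrite -!cE//.
  have cc := coded_mul (coded_mul (coded_mul (Hc (k, 0)) (Hc (k, 1))) (Hc (k, 2))) (Hc (k, 3)).
  rewrite /= R1// in cc; move/coded1: cc.
  have -> : mul3 P012 (c (k, 0)) = c (k, 0) by case: (c _).
  by move=> ->.
have n2 : 2 <= n by case/orP: n45 => /eqP ->.
have allx : all (relation x) [seq rotate_row (size arcs) (arc_row arcs k) | k <- iota 0 (size arcs).-1].
  apply/allP => r /mapP[k kin ->]; rewrite sa -sx relation_rotate_row; apply: relx.
  by move: kin; rewrite mem_iota sa.
have := check_relationsP sys sx n2 allx.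
have inx k j : k < n.-1 -> j < 4 -> c (k, j) = P012 \/ exists2 e, e < n & c (k, j) = nth P012 x e.
  move=> kn j4; rewrite cE//; case: (ltnP (innermost arcs k j) n) => en.
    by right; exists (innermost arcs k j).
  by left; rewrite nth_default ?sx.
case/orP => [/hasP [u]|ev].
  rewrite mem_iota /= => u3 fx; left; exists (Ordinal u3) => k j kn j4.
  apply/val_inj; have /= -> := Hc (k, j) (Ordinal u3).
  case: (inx k j kn j4) => [->//|[e en ->]].
  apply/eqP; apply: (all_nthP P012 fx); by rewrite sx.
right=> k j kn j4; apply: (coded_even (Hc (k, j))).
case: (inx k j kn j4) => [->//|[e en ->]].
by apply: (all_nthP P012 ev); rewrite sx.
Qed.
End Combinatorics.

(** * Lower bound for the trefoil *)

Lemma angle_window_lt (R : realType) (a t : R) :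
  exists t', a <= t' < a + 2 * pi /\ cos (t' - t) = 1.
Proof.
have p0 := @pi_gt0 R.
pose b := t - a - pi; pose v : R * R := (1 * cos b, 1 * sin b).
have vb : is_angle v b by apply: is_angle_polar; exact: ler01.
have vN0 : v != (0, 0).
  apply/eqP => -[]; rewrite !mul1r => cb sb.
  by have := cos2Dsin2 b; rewrite cb sb expr0n /= addr0 => /eqP; rewrite eq_sym oner_eq0.
have [u [upi vu]] := angle_pi v.
have cub := angle_unique vN0 vu vb.
have [up|up] := ltP u pi.
  exists (a + pi + u); split; first by lra.
  by rewrite -cub; congr cos; rewrite /b; ring.
exists a; split; first by lra.
have uE : u = pi by lra.
have -> : a - t = (u - b) - pi *+ 2 by rewrite uE /b mulr2n; ring.
by rewrite -cub -[in RHS](subrK (pi *+ 2) (u - b)) cosD2pi.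
Qed.

(** * Cyclic order of the arcs along the knot *)

Section Cycle.
Variables (R : realType) (phi : R -> E3 R) (n : nat) (gamma : 'I_n -> R -> E3 R).
Hypothesis cphi : continuous phi.
Hypothesis phi_eq : forall s t, phi s = phi t <-> cos (s - t) = 1.
Hypothesis cgamma : forall i, continuous (gamma i).
Hypothesis gamma_inj : forall i s t, 0 <= s <= 1 -> 0 <= t <= 1 ->
  gamma i s = gamma i t -> s = t.
Hypothesis gamma_axis : forall i s, 0 <= s <= 1 -> binding_axis (gamma i s) -> s = 0 \/ s = 1.
Hypothesis gamma_ends : forall i, binding_axis (gamma i 0) /\ binding_axis (gamma i 1).
Hypothesis gamma_disj : forall i j s t, 0 <= s <= 1 -> 0 <= t <= 1 ->
  gamma i s = gamma j t -> i = j \/ binding_axis (gamma i s).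
Hypothesis phi_gamma : forall t, exists i, exists2 s, 0 <= s <= 1 & phi t = gamma i s.
Hypothesis gamma_phi : forall i s, 0 <= s <= 1 -> exists t, gamma i s = phi t.
Hypothesis n_gt0 : (0 < n)%N.

Let in0 : 0 <= (0 : R) <= 1. Proof. by rewrite lexx ler01. Qed.
Let in1 : 0 <= (1 : R) <= 1. Proof. by rewrite lexx ler01. Qed.
Let inb (b : bool) : 0 <= (b%:R : R) <= 1. Proof. by case: b. Qed.
Let endb (p : 'I_n * bool) := gamma p.1 p.2%:R.

Let arc i (a b : R) : set (E3 R) := gamma i @` `[a, b].
Let arc_closed i a b : closed (arc i a b).
Proof.
apply: compact_closed; first exact: (@norm_hausdorff R (E3 R)).
apply: continuous_compact; first by apply: continuous_subspaceT; exact: cgamma.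
exact: segment_compact.
Qed.

Let near_out i a b x : ~ arc i a b (phi x) -> \forall y \near x, ~ arc i a b (phi y).
Proof.
move=> nx; apply: (@near_comp _ _ phi (fun p => ~ arc i a b p)) => //; apply: open_nbhs_nbhs; split => //.
by apply: closed_openC; exact: arc_closed.
Qed.

Let phi_neq s t : `|s - t| < 2 * pi -> phi s = phi t -> s = t.
Proof.
move=> st /phi_eq c1; apply/eqP; rewrite -subr_eq0; apply/eqP.
exact: cos_eq1_small.
Qed.

Let lowest : exists t0, binding_axis (phi t0) /\
  forall i b, (phi t0).2 <= (endb (i, b)).2.
Proof.
pose p0 : 'I_n * bool := (Ordinal n_gt0, false).
case: (@arg_minP _ _ _ p0 xpredT (fun p => (endb p).2)) => // p _ pmin.
have [t tE] := gamma_phi p.1 (inb p.2).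
exists t; rewrite -tE; split=> [|i b]; last exact: pmin.
by case: p.2; [exact: (gamma_ends _).2|exact: (gamma_ends _).1].
Qed.

Lemma cycle_structure : exists (e : nat -> 'I_n) (x : nat -> E3 R),
  [/\ forall k l, (k < n)%N -> (l < n)%N -> e k = e l -> k = l,
      forall k l, (k < n)%N -> (l < n)%N -> x k = x l -> k = l,
      forall k, (k < n)%N -> (x k = gamma (e k) 0 /\ x (k.+1 %% n)%N = gamma (e k) 1) \/
        (x k = gamma (e k) 1 /\ x (k.+1 %% n)%N = gamma (e k) 0) &
      forall k, (k < n)%N -> (x 0%N).2 <= (x k).2].
Proof.
have p0 := @pi_gt0 R.
have [t0 [t0_axis t0_low]] := lowest.
have window t : exists t', t0 <= t' < t0 + 2 * pi /\ phi t' = phi t.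
  by have [t' [h c]] := angle_window_lt t0 t; exists t'; split=> //; apply/phi_eq.
have window_eq s t : t0 <= s < t0 + 2 * pi -> t0 <= t < t0 + 2 * pi -> phi s = phi t -> s = t.
  move=> hs ht; apply: phi_neq; rewrite ltr_norml; lra.
have ends_axis p : binding_axis (endb p).
  by rewrite /endb; case: p => i [] /=; [exact: (gamma_ends i).2|exact: (gamma_ends i).1].
have /choice[tau Htau] : forall p, exists t, t0 <= t < t0 + 2 * pi /\ phi t = endb p.
  move=> p; have [t tE] := gamma_phi p.1 (inb p.2).
  by have [t' [h E]] := window t; exists t'; split=> //; rewrite E -tE.
have axis_end t : binding_axis (phi t) -> exists p, phi t = endb p.
  have [i [s s01 ->]] := phi_gamma t; move=> /(gamma_axis s01) [] ->.
    by exists (i, false).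
  by exists (i, true).
have axis_tau t : t0 <= t < t0 + 2 * pi -> binding_axis (phi t) -> exists p, t = tau p.
  move=> tw /axis_end[p pE]; exists p; have [h E] := Htau p.
  by apply: window_eq => //; rewrite E.
pose ts := sort <=%R (undup [seq tau p | p <- enum {: 'I_n * bool}]).
have ts_mem t : t \in ts -> t0 <= t < t0 + 2 * pi /\ binding_axis (phi t).
  rewrite mem_sort mem_undup => /mapP[p _ ->]; have [h E] := Htau p.
  by split=> //; rewrite E.
have mem_ts t : t0 <= t < t0 + 2 * pi -> binding_axis (phi t) -> t \in ts.
  move=> tw /(axis_tau _ tw)[p ->]; rewrite mem_sort mem_undup; apply: map_f.
  by rewrite mem_enum.
have ts_sorted : sorted <%R ts by rewrite lt_sorted_uniq_le sort_uniq undup_uniq sort_le_sorted.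
pose m := size ts.
have t0_ts : t0 \in ts by apply: mem_ts => //; lra.
have m_gt0 : (0 < m)%N by rewrite /m; case: (ts) t0_ts.
(* The value at [m] repeats the first parameter after a full turn and closes the cycle. *)
pose T k := if (k < m)%N then nth 0 ts k else t0 + 2 * pi.
have T_mem k : (k < m)%N -> T k \in ts by move=> km; rewrite /T km mem_nth.
have T_lt k l : (k < l)%N -> (l <= m)%N -> T k < T l.
  move=> kl lm; have km := leq_trans kl lm; rewrite {2}/T; case: ltnP => lm'.
    by rewrite /T km; apply: (sorted_ltn_nth lt_trans) => //; rewrite ?inE.
  by have [/andP[]] := ts_mem _ (T_mem k km).
have T_le k l : (k <= l)%N -> (l <= m)%N -> T k <= T l.
  by rewrite leq_eqVlt => /orP[/eqP ->//|kl] lm; apply/ltW/T_lt.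
have T0 : T 0%N = t0.
  have [/andP[h _] _] := ts_mem _ (T_mem 0%N m_gt0).
  apply/eqP; rewrite eq_le h andbT.
  have /(nthP 0)[k km <-] := t0_ts.
  by have := T_le 0%N k (leq0n _) (ltnW km); rewrite {2}/T km.
have Tm : T m = t0 + 2 * pi by rewrite /T ltnn.
have T_win k : (k <= m)%N -> t0 <= T k <= t0 + 2 * pi.
  by move=> km; rewrite -{1}T0 -Tm !T_le.
have T_axis k : (k <= m)%N -> binding_axis (phi (T k)).
  move=> km; rewrite /T; case: ltnP => km'; first exact: (ts_mem _ (mem_nth _ km')).2.
  have -> : phi (t0 + 2 * pi) = phi t0; last by [].
  apply/phi_eq; rewrite addrAC subrr add0r mulr_natl; exact: cos2pi.
have T_find t k : T 0%N <= t -> t < T k -> (k <= m)%N ->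
    exists2 j, (j < m)%N & T j <= t < T j.+1.
  move=> t0t; elim: k => [|k IHk] tk km; first by move: t0t; rewrite leNgt tk.
  have [tk'|tk'] := ltP t (T k); first exact: IHk tk' (ltnW km).
  by exists k => //; rewrite tk'.
have no_axis k t : (k < m)%N -> T k < t < T k.+1 -> ~ binding_axis (phi t).
  move=> km /andP[kt tk] ax.
  have tw : t0 <= t < t0 + 2 * pi.
    have := T_win _ (ltnW km); have := T_win _ km; lra.
  have /(nthP 0)[j jm jt] := mem_ts _ tw ax.
  have {}jt : T j = t by rewrite /T jm.
  have [jk|kj] := leqP j k.
    by have := T_le _ _ jk (ltnW km); rewrite jt leNgt kt.
  by have := T_le _ _ kj (ltnW jm); rewrite jt leNgt tk.
(* With a single axis point the two ends of an arc would coincide, against its injectivity. *)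
have m_ge2 : (1 < m)%N.
  rewrite ltnNge; apply/negP => m1.
  have mE : m = 1%N by apply/eqP; rewrite eqn_leq m1 m_gt0.
  have [h0 E0] := Htau (Ordinal n_gt0, false).
  have [h1 E1] := Htau (Ordinal n_gt0, true).
  have tauE p : tau p = t0.
    have : tau p \in ts by rewrite mem_sort mem_undup map_f ?mem_enum.
    by move=> /(nthP 0)[[|j]]; rewrite -/m mE // => _ <-; rewrite -T0 /T m_gt0.
  have := gamma_inj in0 in1 (etrans (esym E0) (etrans (congr1 phi (etrans (tauE _) (esym (tauE _)))) E1)).
  by move/eqP; rewrite eq_sym oner_eq0.
have T_neq k : (k < m)%N -> phi (T k) <> phi (T k.+1).
  move=> km E; have kk := T_lt _ _ (ltnSn k) km.
  have : T k = T k.+1; last by move=> E'; rewrite E' ltxx in kk.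
  apply: phi_neq => //; rewrite distrC gtr0_norm ?subr_gt0//.
  have := T_win _ (ltnW km); have := T_win _ km.
  case: k km {E} kk => [|k] km kk.
    by have := T_lt 1%N m m_ge2 (leqnn m); rewrite Tm; lra.
  by have := T_lt 0%N k.+1 isT (ltnW km); rewrite T0; lra.
have in_arc k : (k < m)%N -> exists i, forall t, T k < t < T k.+1 -> arc i 0 1 (phi t).
  move=> km; have kk := T_lt _ _ (ltnSn k) km.
  pose c := (T k + T k.+1) / 2.
  have ck : T k < c < T k.+1 by rewrite /c; lra.
  have [i [s s01 cE]] := phi_gamma c.
  exists i => t tk.
  apply: (@connected_induction _ `]T k, T k.+1[%classic (fun t => arc i 0 1 (phi t)) c) => //=.
  - by apply/connected_intervalP; exact: interval_is_interval.
  - by exists s.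
  - move=> x; rewrite in_itv /= => xk [u]; rewrite /= in_itv /= => u01 ux.
    have : \forall y \near x, forall j : 'I_n, j != i -> ~ arc j 0 1 (phi y).
      apply: (@filter_forall _ 'I_n (fun j y => j != i -> ~ arc j 0 1 (phi y)) (nbhs x)) => j.
      have [->|ji] := eqVneq j i; first by apply: nearW => y.
      have : ~ arc j 0 1 (phi x).
        move=> [v]; rewrite /= in_itv /= => v01 E; case: (gamma_disj v01 u01 (etrans E (esym ux))).
          by move=> jE; rewrite jE eqxx in ji.
        by rewrite E; apply: (no_axis _ _ km xk).
      by move/near_out; apply: filterS => y H _.
    apply: filterS => y H _; have [j [v v01 vE]] := phi_gamma y.
    have [ji|ji] := eqVneq j i; first by exists v; rewrite /= ?in_itv ?vE ?ji.
    by exfalso; apply: (H j ji); exists v; rewrite /= ?in_itv ?vE.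
  - by move=> x _ /near_out; apply: filterS => y H _.
have /choice[e He] : forall k, exists i, (k < m)%N ->
    forall t, T k < t < T k.+1 -> arc i 0 1 (phi t).
  move=> k; have [km|_] := ltnP k m; last by exists (Ordinal n_gt0).
  by have [i Hi] := in_arc k km; exists i.
(* Arcs are closed, so the ends of the interval belong to the same arc: a small step from an end
   towards the midpoint enters the open interval. *)
have in_arc' k t : (k < m)%N -> T k <= t <= T k.+1 -> arc (e k) 0 1 (phi t).
  move=> km tk; have kk := T_lt _ _ (ltnSn k) km.
  have [//|/near_out /nbhs_ballP[d /= d0 Hd]] := pselect (arc (e k) 0 1 (phi t)).
  pose c := (T k + T k.+1) / 2.
  pose q := Num.min 1 (d / (2 * (T k.+1 - T k))).
  have dd : 0 < d / (2 * (T k.+1 - T k)) by rewrite divr_gt0// mulr_gt0 ?subr_gt0.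
  have q0 : 0 < q by rewrite lt_min ltr01 dd.
  have q1 : q <= 1 by rewrite ge_min lexx.
  have qd : q * (T k.+1 - T k) <= d / 2.
    have : q <= d / (2 * (T k.+1 - T k)) by rewrite ge_min lexx orbT.
    rewrite ler_pdivlMr ?mulr_gt0 ?subr_gt0//; lra.
  have ck : `|c - t| <= (T k.+1 - T k) / 2 by rewrite ler_norml /c; lra.
  exfalso; apply: (Hd (t + q * (c - t))); last first.
    apply: He => //.
    have c1 : q * (c - t) = q * c - q * t by ring.
    have [h1 h2] : T k < t + q * (c - t) /\ t + q * (c - t) < T k.+1; last by rewrite h1.
    rewrite /c in ck *; split; nra.
  rewrite /ball /= opprD addrA subrr add0r normrN normrM (gtr0_norm q0).
  nra.
(* A missed inner point would split the arc into two closed parts. The image of the interval, being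
   connected, would lie in one of them, whereas its two ends are the distinct ends of the arc. *)
have surj k s : (k < m)%N -> 0 < s < 1 -> exists2 t, T k < t < T k.+1 & phi t = gamma (e k) s.
  move=> km s01; have kk := T_lt _ _ (ltnSn k) km.
  have s01' : 0 <= s <= 1 by lra.
  have [//|none] := pselect (exists2 t, T k < t < T k.+1 & phi t = gamma (e k) s).
  have split_arc p : arc (e k) 0 1 p -> arc (e k) 0 s p \/ arc (e k) s 1 p.
    move=> [u]; rewrite /= in_itv /= => u01 <-; have [us|su] := leP u s.
      by left; exists u => //; rewrite /= in_itv /=; lra.
    by right; exists u => //; rewrite /= in_itv /=; lra.
  have s_axis : ~ binding_axis (gamma (e k) s).
    by move=> /(gamma_axis s01')[] h; move: s01; rewrite h ltxx ?andbF.
  have miss t : T k <= t <= T k.+1 -> ~ (arc (e k) 0 s (phi t) /\ arc (e k) s 1 (phi t)).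
    move=> tk [[u]] + uE [v]; rewrite /= !in_itv /= => u0 v0 vE.
    have uv : u = v by apply: (@gamma_inj (e k)); [lra|lra|rewrite uE].
    have us : u = s by lra.
    rewrite us in uE.
    apply: none; exists t => //.
    have tk1 : t != T k by apply/eqP => tE; apply: s_axis; rewrite uE tE; exact: T_axis (ltnW km).
    have tk2 : t != T k.+1 by apply/eqP => tE; apply: s_axis; rewrite uE tE; exact: T_axis.
    by rewrite !lt_neqAle eq_sym tk1 tk2.
  have ind a b : T k <= a <= T k.+1 -> T k <= b <= T k.+1 ->
      arc (e k) 0 s (phi a) -> arc (e k) 0 s (phi b).
    move=> ak bk Pa.
    apply: (@connected_induction _ `[T k, T k.+1]%classic (fun t => arc (e k) 0 s (phi t)) a) => //=.
    - exact: segment_connected.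
    - move=> x; rewrite in_itv /= => xk Px.
      have : ~ arc (e k) s 1 (phi x) by move=> Px'; apply: (miss x).
      move/near_out; apply: filterS => y H; rewrite in_itv /= => yk.
      by case: (split_arc _ (in_arc' _ _ km yk)).
    - by move=> x _ /near_out; apply: filterS => y H _.
  have end0 : arc (e k) 0 s (gamma (e k) 0) by exists 0 => //; rewrite /= in_itv /=; lra.
  have end1 : ~ arc (e k) 0 s (gamma (e k) 1).
    move=> [u]; rewrite /= in_itv /= => us E.
    have : u = 1 by apply: gamma_inj E => //; lra.
    lra.
  have kk1 : T k <= T k <= T k.+1 by rewrite lexx ltW.
  have kk2 : T k <= T k.+1 <= T k.+1 by rewrite lexx ltW.
  have [u] := in_arc' _ _ km kk1; have [v] := in_arc' _ _ km kk2.
  rewrite /= !in_itv /= => v01 vE u01 uE.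
  have ne := T_neq k km.
  have hu : u = 0 \/ u = 1 by apply: (@gamma_axis (e k)) => //; rewrite uE; exact: T_axis (ltnW km).
  have hv : v = 0 \/ v = 1 by apply: (@gamma_axis (e k)) => //; rewrite vE; exact: T_axis.
  case: hu => h; case: hv => h'; rewrite h in uE; rewrite h' in vE.
  - by exfalso; apply: ne; rewrite -uE -vE.
  - by exfalso; apply: end1; rewrite vE; apply: (ind (T k)) => //; rewrite -uE.
  - by exfalso; apply: end1; rewrite uE; apply: (ind (T k.+1)) => //; rewrite -vE.
  - by exfalso; apply: ne; rewrite -uE -vE.
have half01 : 0 < (1 / 2 : R) < 1 by lra.
have half01' : 0 <= (1 / 2 : R) <= 1 by lra.
have e_lt k l : (k < l)%N -> (l < m)%N -> e k <> e l.
  move=> kl lm E; have km := ltn_trans kl lm.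
  have [t tk tE] := surj k _ km half01; have [t' tl tE'] := surj l _ lm half01.
  have tt : t = t'.
    have := T_win _ (ltnW km); have := T_win _ km; have := T_win _ (ltnW lm); have := T_win _ lm.
    move=> a1 a2 a3 a4; apply: window_eq; [| |by rewrite tE tE' E].
      by lra.
    by lra.
  have := T_le _ _ kl (ltnW lm); lra.
have e_inj k l : (k < m)%N -> (l < m)%N -> e k = e l -> k = l.
  move=> km lm E; have [kl|lk|//] := ltngtP k l; first by case: (e_lt _ _ kl lm).
  by case: (e_lt _ _ lk km).
have e_surj i : exists2 k, (k < m)%N & e k = i.
  have [t0' tE'] := gamma_phi i half01'; have [t [tw tE]] := window t0'.
  have [k km /andP[kt tk]] : exists2 k, (k < m)%N & T k <= t < T k.+1.
    by apply: (T_find t m); rewrite ?T0 ?Tm; case/andP: tw.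
  exists k => //.
  have kt' : T k <= t <= T k.+1 by rewrite kt ltW.
  have [u] := in_arc' _ _ km kt'; rewrite /= in_itv /= => u01 uE.
  have E : gamma i (1 / 2) = gamma (e k) u by rewrite uE tE.
  by case: (gamma_disj half01' u01 E) => [->//|/(gamma_axis half01')[] h]; move: half01; rewrite h ltxx ?andbF.
have mn : m = n.
  pose f (k : 'I_m) := e k.
  have f_inj : injective f by move=> k l E; apply/val_inj; exact: e_inj E.
  have f_surj i : exists k, f k = i by have [k km E] := e_surj i; exists (Ordinal km).
  rewrite -[LHS]card_ord -[RHS]card_ord; apply/eqP; rewrite eqn_leq.
  rewrite (leq_card f f_inj) /=.
  have /choice[h Hh] := f_surj.
  apply: (leq_card h) => i j E; by rewrite -(Hh i) -(Hh j) E.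
rewrite mn in T_lt T_le T_win T_axis T_neq in_arc' e_inj Tm T_mem m_gt0.
exists e, (fun k => phi (T k)); split => //.
- move=> k l kn ln E; have T_inj : T k = T l.
    by apply: window_eq E; [have [] := ts_mem _ (T_mem _ kn)|have [] := ts_mem _ (T_mem _ ln)].
  have [kl|lk|//] := ltngtP k l.
    by have := T_lt _ _ kl (ltnW ln); rewrite T_inj ltxx.
  by have := T_lt _ _ lk (ltnW kn); rewrite T_inj ltxx.
- move=> k kn; have kk := T_lt _ _ (ltnSn k) kn.
  have -> : phi (T (k.+1 %% n)%N) = phi (T k.+1).
    have [kn'|kn'] := ltnP k.+1 n; first by rewrite modn_small.
    have -> : k.+1 = n by apply/eqP; rewrite eqn_leq kn kn'.
    rewrite modnn T0 Tm; apply/phi_eq.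
    by rewrite opprD addrA subrr add0r cosN mulr_natl cos2pi.
  have kk1 : T k <= T k <= T k.+1 by rewrite lexx ltW.
  have kk2 : T k <= T k.+1 <= T k.+1 by rewrite lexx ltW.
  have [u] := in_arc' _ _ kn kk1; have [v] := in_arc' _ _ kn kk2.
  rewrite /= !in_itv /= => v01 vE u01 uE.
  have ne := T_neq k kn.
  have hu : u = 0 \/ u = 1 by apply: (@gamma_axis (e k)) => //; rewrite uE; exact: T_axis (ltnW kn).
  have hv : v = 0 \/ v = 1 by apply: (@gamma_axis (e k)) => //; rewrite vE; exact: T_axis.
  case: hu => h; case: hv => h'; rewrite h in uE; rewrite h' in vE.
  - by exfalso; apply: ne; rewrite -uE -vE.
  - by left.
  - by right.
  - by exfalso; apply: ne; rewrite -uE -vE.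
- move=> k kn; rewrite T0; have [[i b] ->] := axis_end _ (T_axis _ (ltnW kn)).
  exact: t0_low.
Qed.
End Cycle.

(** * Ranks of the vertices on the axis *)

Section Ranks.
Variables (R : realType) (n : nat) (ht : nat -> R).
Hypothesis ht_inj : forall k l, (k < n)%N -> (l < n)%N -> ht k = ht l -> k = l.
Hypothesis ht_low : forall k, (k < n)%N -> ht 0 <= ht k.

Definition level (r : R) := count (fun l => ht l < r) (iota 0 n).
Definition ranks := [seq level (ht k) | k <- iota 0 n].

Lemma level_le r r' : r <= r' -> (level r <= level r')%N.
Proof. by move=> rr; apply: sub_count => l /= /lt_le_trans; apply. Qed.

Lemma level_gt k r : (k < n)%N -> ht k < r -> (level (ht k) < level r)%N.
Proof.
move=> kn kr.
have -> : level r = (count (fun l => ht l < r) (rem k (iota 0 n))).+1.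
  have kin : k \in iota 0 n by rewrite mem_iota.
  rewrite /level; have /seq.permP -> := perm_to_rem kin; by rewrite /= kr.
have -> : level (ht k) = count (fun l => ht l < ht k) (rem k (iota 0 n)).
  have kin : k \in iota 0 n by rewrite mem_iota.
  rewrite /level; have /seq.permP -> := perm_to_rem kin; by rewrite /= ltxx.
by rewrite ltnS; apply: sub_count => l /= /lt_trans; apply.
Qed.

Lemma level_ltE k r : (k < n)%N -> r != ht k -> (ht k < r) = (level (ht k) < level r)%N.
Proof.
move=> kn rk; apply/idP/idP => [|h]; first exact: level_gt.
rewrite ltNge; apply/negP => /level_le; by rewrite leqNgt h.
Qed.

Lemma level_lt_size k : (k < n)%N -> (level (ht k) < n)%N.
Proof.
move=> kn; apply: leq_trans (level_gt kn (_ : ht k < ht k + 1)) _; first by lra.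
by have := count_size (fun l => ht l < ht k + 1) (iota 0 n); rewrite size_iota.
Qed.

Lemma nth_ranks k : (k < n)%N -> nth 0%N ranks k = level (ht k).
Proof. by move=> kn; rewrite (nth_map 0%N) ?size_iota// nth_iota. Qed.

Lemma level_inj k l : (k < n)%N -> (l < n)%N -> level (ht k) = level (ht l) -> k = l.
Proof.
move=> kn ln E; apply: ht_inj => //; have [kl|lk|//] := ltgtP (ht k) (ht l).
  by have := level_gt kn kl; rewrite E ltnn.
by have := level_gt ln lk; rewrite E ltnn.
Qed.

Lemma ranks_perm : perm_eq ranks (iota 0 n).
Proof.
have u : uniq ranks.
  rewrite map_inj_in_uniq ?iota_uniq// => k l; rewrite !mem_iota /=; exact: level_inj.
have sub : {subset ranks <= iota 0 n}.
  by move=> j /mapP[k]; rewrite !mem_iota /= => kn ->; exact: level_lt_size.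
have sz : (size (iota 0 n) <= size ranks)%N by rewrite size_map.
have [_ E] := uniq_min_size u sub sz.
by apply: uniq_perm => //; exact: iota_uniq.
Qed.

Lemma ranks0 : (0 < n)%N -> nth 0%N ranks 0 = 0%N.
Proof.
move=> n0; rewrite nth_ranks//; apply/eqP; rewrite -leqn0 leqNgt -has_count.
apply/hasPn => l; rewrite mem_iota /= => ln; by rewrite -leNgt ht_low.
Qed.

Lemma level_exists j : (j < n)%N -> exists2 k, (k < n)%N & level (ht k) = j.
Proof.
move=> jn; have : j \in ranks by rewrite (perm_mem ranks_perm) mem_iota.
by move=> /mapP[k]; rewrite mem_iota => kn ->; exists k.
Qed.

(** Gap [k] lies between the vertices of ranks [k] and [k + 1], so its points have [k + 1] vertices
    below them. *)
Lemma gap_exists k : (k < n.-1)%N ->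
  exists2 r, level r = k.+1 & forall l, (l < n)%N -> r != ht l.
Proof.
move=> kn; have [a an aE] := @level_exists k ltac:(lia).
have [b bn bE] := @level_exists k.+1 ltac:(lia).
have ab : ht a < ht b by rewrite level_ltE ?aE ?bE//; apply/eqP => E; move: aE; rewrite -E bE; lia.
have h1 : ht a < (ht a + ht b) / 2 by lra.
have h2 : (ht a + ht b) / 2 < ht b by lra.
have lE : level ((ht a + ht b) / 2) = k.+1.
  apply/eqP; rewrite eqn_leq -{1}bE level_le ?ltW//= -aE; exact: level_gt.
exists ((ht a + ht b) / 2) => // l ln; apply/eqP => E.
have : l = b by apply: level_inj => //; rewrite -E lE bE.
by move=> lb; move: h2; rewrite E lb ltxx.
Qed.
End Ranks.

(** * Monodromy of a four-page arrangement *)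

Section FourPages.
Variable R : realType.

Definition in_page (t : R) (z : R * R) : E3 R := (z.1 * cos t, z.1 * sin t, z.2).

Variables (n : nat) (th : nat -> R) (B : 'I_n -> R -> R * R) (pg : 'I_n -> nat) (ht : nat -> R).
Hypothesis n45 : (n == 4%N) || (n == 5%N).
Hypothesis th_lt : [/\ th 0 < th 1, th 1 < th 2, th 2 < th 3 & th 3 < th 0 + 2 * pi].
Hypothesis cB : forall k, continuous (B k).
Hypothesis clampB : forall k s, B k s = B k (clamp s).
Hypothesis B_ge0 : forall k s, 0 <= (B k s).1.
Hypothesis B_axis : forall k s, 0 <= s <= 1 -> (B k s).1 = 0 -> s = 0 \/ s = 1.
Hypothesis B_inj : forall k s t, 0 <= s <= 1 -> 0 <= t <= 1 -> B k s = B k t -> s = t.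
Hypothesis B_disj : forall k l s t, pg k = pg l -> B k s = B l t -> k = l.
Hypothesis B_ends : forall k : 'I_n,
  (B k 0 = (0, ht k) /\ B k 1 = (0, ht (k.+1 %% n)%N)) \/
  (B k 0 = (0, ht (k.+1 %% n)%N) /\ B k 1 = (0, ht k)).
Hypothesis pg_lt : forall k, (pg k < 4)%N.
Hypothesis pg_surj : forall j, (j < 4)%N -> exists k, pg k = j.
Hypothesis ht_inj : forall k l, (k < n)%N -> (l < n)%N -> ht k = ht l -> k = l.
Hypothesis ht_low : forall k, (k < n)%N -> ht 0 <= ht k.

Let K : set (E3 R) := [set p | exists k s, p = in_page (th (pg k)) (B k s)].
Variable Q : E3 R -> R[i] -> Prop.
Hypothesis covQ : covering (@cdist R) (~` K) Q.
Hypothesis rootsQ : forall b, ~ K b -> exists t : 'I_3 -> R[i],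
  injective t /\ forall T, Q b T <-> exists i, T = t i.

(** Two consecutive pages may enclose an angle of [pi] or more. Interposing the bisectors gives
    eight half-planes whose sectors are narrower than [pi]. *)
Definition angles k : R :=
  if odd k then th k./2
  else if k == 0%N then (th 3 - 2 * pi + th 0) / 2
  else if k == 8%N then (th 3 - 2 * pi + th 0) / 2 + 2 * pi
  else (th k./2.-1 + th k./2) / 2.

Let angles_step k : (k < 8)%N -> angles k < angles k.+1 < angles k + pi.
Proof.
have [h1 h2 h3 h4] := th_lt; have p0 := @pi_gt0 R.
by case: k => [|[|[|[|[|[|[|[|]]]]]]]] // _; rewrite /angles /=; lra.
Qed.

Let angles_last : angles 8 = angles 0 + 2 * pi. Proof. by []. Qed.

(* The pages that carry arcs are those of odd index; [page_code] is 4 for the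
   intermediate pages. *)
Let page_code k := if odd k then k./2 else 4%N.

Let n_gt0 : (0 < n)%N. Proof. by case/orP: n45 => /eqP ->. Qed.

Let in_page_axis (t t' : R) h : in_page t (0, h) = in_page t' (0, h).
Proof. by rewrite /in_page /= !mul0r. Qed.

Let vertexK l t : (l < n)%N -> K (in_page t (0, ht l)).
Proof.
move=> ln; have [[E _]|[_ E]] := B_ends (Ordinal ln).
  by exists (Ordinal ln), 0; rewrite E; exact: in_page_axis.
by exists (Ordinal ln), 1; rewrite E; exact: in_page_axis.
Qed.

Let B_axis_vertex k s : (B k s).1 = 0 ->
  [/\ B k s = B k 0 \/ B k s = B k 1 & B k s = (0, ht k) \/ B k s = (0, ht (k.+1 %% n)%N)].
Proof.
rewrite clampB => /(B_axis (clamp01 s)) [] ->.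
  by split; [left|case: (B_ends k) => -[-> _]; [left|right]].
by split; [right|case: (B_ends k) => -[_ ->]; [right|left]].
Qed.

(* The axis points at which arcs of other pages end puncture the page: they are
   treated as constant curves. *)
Let present j (u : 'I_n + 'I_n) := match u with
  | inl k => pg k == j
  | inr l => [forall k, (pg k == j) ==> (ht l != ht k) && (ht l != ht (k.+1 %% n)%N)]
  end.
Let mk j u (pu : present j u) : {u | present j u} := exist (fun u => present j u) u pu.
Let curve j (u : {u | present j u}) s := match val u with inl k => B k s | inr l => (0, ht l) end.
Arguments curve j u s : clear implicits.

Let trace j z := exists u s, curve j u s = z.

Let ccurve j u : continuous (curve j u).
Proof. by rewrite /curve; case: (val u) => [k|l]; [exact: cB|cts]. Qed.

Let clamp_curve j u s : curve j u s = curve j u (clamp s).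
Proof. by rewrite /curve; case: (val u). Qed.

Let curve_ge0 j u s : 0 <= (curve j u s).1.
Proof. by rewrite /curve; case: (val u). Qed.

Let curve_ends j u : (curve j u 0).1 = 0 /\ (curve j u 1).1 = 0.
Proof. by rewrite /curve; case: (val u) => [k|l] //; case: (B_ends k) => -[-> ->]. Qed.

Let curve_axis j u s : (curve j u s).1 = 0 ->
  curve j u s = curve j u 0 \/ curve j u s = curve j u 1.
Proof. by rewrite /curve; case: (val u) => [k|l]; [case/B_axis_vertex|left]. Qed.

Let curve_inj j u s t : 0 <= s <= 1 -> 0 <= t <= 1 -> curve j u s = curve j u t ->
  s = t \/ forall r, curve j u r = curve j u s.
Proof.
by rewrite /curve; case: (val u) => [k|l]; [move=> s1 t1 /(B_inj s1 t1); left|right].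
Qed.

Let curve_disj j u u' s t : curve j u s = curve j u' t -> u = u'.
Proof.
have mixed k l s' : pg k == j -> present j (inr l) -> B k s' = (0, ht l) -> False.
  move=> kj /forallP /(_ k); rewrite kj /= => /andP[h1 h2] E.
  have [|_ []] := @B_axis_vertex k s'; first by rewrite E.
    by rewrite E => -[h]; rewrite h eqxx in h1.
  by rewrite E => -[h]; rewrite h eqxx in h2.
case: u => [[k|l] pu]; case: u' => [[k'|l'] pu']; rewrite /curve /= => E; apply/val_inj => /=.
- by congr inl; apply: B_disj E; rewrite (eqP pu) (eqP pu').
- by case: (mixed _ _ _ pu pu' E).
- by case: (mixed _ _ _ pu' pu (esym E)).
- case: E => E; congr inr; apply/val_inj; exact: (ht_inj (ltn_ord l) (ltn_ord l') E).
Qed.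

Let angle_code k l : (0 < k <= 8)%N -> (l < 4)%N -> cos (angles k - th l) = 1 -> k = l.*2.+1.
Proof.
move=> /andP[k0 k8] l4 c1.
have aE : th l = angles l.*2.+1 by rewrite /angles /= odd_double /= uphalf_double.
rewrite aE in c1.
have b1 := eta_lt angles_step k0 k8.
have b2 := eta_le angles_step k8 (leqnn 8).
have b3 : angles 0 < angles l.*2.+1 by apply: (eta_lt angles_step) => //; lia.
have b4 : angles l.*2.+1 < angles 8 by apply: (eta_lt angles_step) => //; lia.
have : angles k - angles l.*2.+1 = 0.
  by apply: cos_eq1_small => //; rewrite ltr_norml; move: angles_last b1 b2 b3 b4; lra.
have [kl|lk|//] := ltngtP k l.*2.+1.
  by have := eta_lt angles_step kl ltac:(lia) => h1 h2; exfalso; lra.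
by have := eta_lt angles_step lk k8 => h1 h2; exfalso; lra.
Qed.

(** A point of [K] in this half-plane is on an arc of the page or else on the axis, where it is a
    vertex: an end of an arc of the page, or one of the punctures. *)
Let traceP k z : (k < 8)%N -> 0 <= z.1 ->
  K (in_page (angles k.+1) z) <-> trace (page_code k.+1) z.
Proof.
move=> k8 z0; split=> [[l [s E]]|[u [s <-]]]; last first.
  case: u => [[l|l] pu]; rewrite /curve /=; last exact: vertexK.
  exists l, s; congr in_page; move: (pg_lt l); rewrite (eqP pu) /page_code.
  by rewrite /angles /=; case: ifP.
have zE : z = B l s.
  have E1 : z.2 = (B l s).2 by case: E.
  have E2 : z.1 = (B l s).1.
    rewrite -(vlen_polar (angles k.+1) z0) -(vlen_polar (th (pg l)) (B_ge0 l s)).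
    by case: E => -> ->.
  by rewrite [z]surjective_pairing E1 E2 -surjective_pairing.
rewrite zE; have [lj|lj] := eqVneq (pg l) (page_code k.+1).
  have pl : present (page_code k.+1) (inl l) by rewrite /= lj.
  by exists (mk pl), s.
have r0 : (B l s).1 = 0.
  apply/eqP/negPn/negP => rN0; move: E; rewrite /in_page zE => -[Ec Es].
  have c1 : cos (angles k.+1 - th (pg l)) = 1.
    rewrite cosB -[RHS](cos2Dsin2 (th (pg l))).
    by rewrite (mulfI rN0 Ec) (mulfI rN0 Es); ring.
  have := angle_code (k := k.+1) k8 (pg_lt l) c1 => kE.
  by move: lj; rewrite /page_code kE /= odd_double /= uphalf_double eqxx.
have [v vn vE] : exists2 v, (v < n)%N & B l s = (0, ht v).
  have [_ [->|->]] := B_axis_vertex r0; first by exists l.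
  by exists (l.+1 %% n)%N => //; rewrite ltn_mod.
rewrite vE; have [pv|] := boolP (present (page_code k.+1) (inr (Ordinal vn))).
  by exists (mk pv), 0.
rewrite negb_forall => /existsP[l']; rewrite negb_imply => /andP[pl'].
have pl : present (page_code k.+1) (inl l') by [].
rewrite negb_and !negbK /= => /orP[] /eqP ->; rewrite /trace.
  case: (B_ends l') => -[E0 E1]; first by exists (mk pl), 0.
  by exists (mk pl), 1.
case: (B_ends l') => -[E0 E1]; first by exists (mk pl), 1.
by exists (mk pl), 0.
Qed.

Let pgn k := if insub k is Some o then pg o else 0%N.
Let pgnE (k : 'I_n) : pgn k = pg k. Proof. by rewrite /pgn valK. Qed.
Let lvl := level n ht.
Let v := ranks n ht.
Let P := [seq pgn k | k <- iota 0 n].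
Let sizev : size v = n. Proof. by rewrite size_map size_iota. Qed.
Let nthP' (k : 'I_n) : nth 0%N P k = pg k.
Proof. by rewrite (nth_map 0%N) ?size_iota// nth_iota// pgnE. Qed.
Let off r := forall l, (l < n)%N -> r != ht l.
Let axis_pt (r : R) : E3 R := (0, 0, r).
Let in_page_axis_pt t r : in_page t (0, r) = axis_pt r.
Proof. by rewrite /in_page /= !mul0r. Qed.

Let offK r : off r -> ~ K (axis_pt r).
Proof.
move=> ro [k [s [E1 E2 E3]]].
have B0 : (B k s).1 = 0.
  by rewrite -(vlen_polar (th (pg k)) (B_ge0 k s)) -E1 -E2 /vlen expr0n /= addr0 sqrtr0.
have [_ [] E] := B_axis_vertex B0; move: E3; rewrite E /= => rE.
  by have := ro k (ltn_ord k); rewrite rE eqxx.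
by have := ro (k.+1 %% n)%N; rewrite ltn_mod rE eqxx => /(_ n_gt0).
Qed.

Let Koff r : ~ K (axis_pt r) -> off r.
Proof. by move=> nK l ln; apply/eqP => E; apply: nK; rewrite E -(in_page_axis_pt 0); exact: vertexK. Qed.

Let spanned (k : 'I_n) r := (r - ht k) * (r - ht (k.+1 %% n)%N) < 0.

Let prod_lt0 (x y : R) : x != 0 -> y != 0 -> (x * y < 0) = ((0 < x) != (0 < y)).
Proof.
move=> x0 y0; case: ltrgt0P x0 => // hx _; case: ltrgt0P y0 => // hy _ /=.
- by apply/negbTE; rewrite -leNgt; nra.
- by have -> : x * y < 0 by nra.
- by have -> : x * y < 0 by nra.
- by apply/negbTE; rewrite -leNgt; nra.
Qed.

Let spannedE k r : off r ->
  spanned k r = ((lvl (ht k) < lvl r)%N != (lvl (ht (k.+1 %% n)) < lvl r)%N).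
Proof.
move=> ro; have k'n : (k.+1 %% n < n)%N by rewrite ltn_mod.
rewrite /spanned prod_lt0 ?subr_eq0 ?ro// !subr_gt0.
by rewrite (level_ltE (ltn_ord k) (ro _ (ltn_ord k))) (level_ltE k'n (ro _ k'n)).
Qed.

Let spanned_spans k r i : off r -> lvl r = i.+1 -> spanned k r = spans (arc_of v P k) i.
Proof.
move=> ro ri; rewrite spannedE// ri /spans /arc_of /= sizev !nth_ranks ?ltn_mod// -/lvl.
move: (lvl (ht k)) (lvl (ht _)) => x y; lia.
Qed.

Let is_ends k (x y : R) := (x = ht k /\ y = ht (k.+1 %% n)%N) \/ (x = ht (k.+1 %% n)%N /\ y = ht k).

Let oriented (k : 'I_n) x y : is_ends k x y -> exists A : R -> R * R,
  [/\ continuous A, forall s, 0 <= (A s).1, A 0 = (0, x), A 1 = (0, y) &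
      forall s, exists t, A s = B k t].
Proof.
have crev : continuous (fun s : R => B k (1 - s)) by have h := @cB k; cts.
case=> -[-> ->]; case: (B_ends k) => -[E0 E1];
  [exists (B k)|exists (fun s : R => B k (1 - s))|exists (fun s : R => B k (1 - s))|exists (B k)];
  split=> //; first [by rewrite ?subr0 ?subrr|by move=> s; exists s|by move=> s; exists (1 - s)].
Qed.

Let no_cross (k l : 'I_n) x y z w : pg k = pg l -> k != l -> is_ends k x y -> is_ends l z w ->
  x != z /\ ~~ [&& x < z, z < y & y < w].
Proof.
move=> pkl /eqP kl /oriented[A [cA A0 Ax Ay AB]] /oriented[C [cC C0 Cz Cw CB]].
have nE s t : A s <> C t.
  move=> E; have [s' sE] := AB s; have [t' tE] := CB t.
  by apply: kl; apply: (B_disj pkl (s := s') (t := t')); rewrite -sE -tE.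
split; first by apply/eqP => xz; apply: (nE 0 0); rewrite Ax Cz xz.
apply/negP => /and3P[xz zy yw].
have [s [t [_ _ E]]] := arcs_cross cA cC (fun s _ => A0 s) (fun s _ => C0 s) Ax Ay Cz Cw xz zy yw.
exact: nE E.
Qed.

Let config_valid : valid_config v P.
Proof.
apply/andP; split.
  apply/allP => j; rewrite mem_iota /= => j4; have [k kj] := pg_surj j4.
  by rewrite -kj -nthP' mem_nth// size_map size_iota.
apply/allP => e; rewrite mem_iota sizev /= => en; apply/allP => f; rewrite mem_iota ?sizev /= => fn.
pose k : 'I_n := Ordinal en; pose l : 'I_n := Ordinal fn.
have [//|ef] := eqVneq e f.
have [/eqP pkl|//] := boolP (nth 0%N P e == nth 0%N P f).
rewrite (nthP' k) (nthP' l) in pkl.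
rewrite /= /unlinked /arc_of /= sizev !nth_ranks ?ltn_mod// -/lvl.
have k'n : (e.+1 %% n < n)%N by rewrite ltn_mod.
have l'n : (f.+1 %% n < n)%N by rewrite ltn_mod.
have lvl_ne i j : (i < n)%N -> (j < n)%N -> ht i != ht j -> (lvl (ht i) != lvl (ht j))%N.
  by move=> ni nj; apply: contraNneq => E; rewrite (level_inj ht_inj ni nj E).
have ends_ne (i : 'I_n) : ht i != ht (i.+1 %% n)%N.
  apply/eqP => E; have : B i 0 = B i 1 by case: (B_ends i) => -[-> ->]; rewrite E.
  by move/B_inj; rewrite !lexx ler01 => /(_ isT isT) /eqP; rewrite eq_sym oner_eq0.
have sub_lt x y : (lvl x < lvl y)%N -> x < y.
  by move=> h; rewrite ltNge; apply/negP => /(level_le n ht); rewrite leqNgt h.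
have kl : k != l by rewrite -val_eqE.
have lk : l != k by rewrite eq_sym.
have nc (k0 l0 : 'I_n) x y z w : pg k0 = pg l0 -> k0 != l0 -> is_ends k0 x y -> is_ends l0 z w ->
    ~~ [&& (lvl x < lvl z)%N, (lvl z < lvl y)%N & (lvl y < lvl w)%N].
  move=> p0 n0 h1 h2; have [_ /negP h] := no_cross p0 n0 h1 h2.
  by apply/negP => /and3P[/sub_lt a1 /sub_lt a2 /sub_lt a3]; apply: h; rewrite a1 a2 a3.
have ek1 : is_ends k (ht e) (ht (e.+1 %% n)%N) by left.
have ek2 : is_ends k (ht (e.+1 %% n)%N) (ht e) by right.
have el1 : is_ends l (ht f) (ht (f.+1 %% n)%N) by left.
have el2 : is_ends l (ht (f.+1 %% n)%N) (ht f) by right.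
have [n1 _] := no_cross pkl kl ek1 el1; have [n2 _] := no_cross pkl kl ek1 el2.
have [n3 _] := no_cross pkl kl ek2 el1; have [n4 _] := no_cross pkl kl ek2 el2.
move: (nc _ _ _ _ _ _ pkl kl ek1 el1) (nc _ _ _ _ _ _ pkl kl ek1 el2)
  (nc _ _ _ _ _ _ pkl kl ek2 el1) (nc _ _ _ _ _ _ pkl kl ek2 el2).
move: (nc _ _ _ _ _ _ (esym pkl) lk el1 ek1) (nc _ _ _ _ _ _ (esym pkl) lk el1 ek2)
  (nc _ _ _ _ _ _ (esym pkl) lk el2 ek1) (nc _ _ _ _ _ _ (esym pkl) lk el2 ek2).
move: (lvl_ne _ _ en fn n1) (lvl_ne _ _ en l'n n2) (lvl_ne _ _ k'n fn n3) (lvl_ne _ _ k'n l'n n4).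
move: (lvl_ne _ _ en k'n (ends_ne k)) (lvl_ne _ _ fn l'n (ends_ne l)).
move: (lvl (ht e)) (lvl (ht (e.+1 %% n)%N)) (lvl (ht f)) (lvl (ht (f.+1 %% n)%N)) => a b c d.
clear; lia.
Qed.

Theorem four_page_monodromy :
  (exists r, lift_on (@cdist R) (~` K) Q r) \/
  exists2 r, continuous_to (@cdist R) (~` K) r &
    forall b, ~ K b -> exists t : 'I_3 -> R[i],
      [/\ injective t, forall i, Q b (t i) & r b = vandermonde3 t].
Proof.
have K_pages p : K p -> exists2 l, (l < 8)%N & page (angles l) p.
  move=> [k [s ->]]; exists (pg k).*2.+1; first by move: (pg_lt k); lia.
  by rewrite /angles /= odd_double /= uphalf_double; exists (B k s).1.
(* The base point of the sheets lies below all vertices, so no arc spans it. *)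
have q0_off : off (ht 0 - 1) by move=> l ln; have h := ht_low ln; rewrite lt_eqF//; lra.
have ax_axis r : binding_axis (axis_pt r) by [].
have [T [T_ex T_near [T_base T_prod] T_root T_disc]] := monodromy_exists angles_step
  angles_last K_pages covQ rootsQ (ax_axis (ht 0 - 1)) (offK q0_off).
have page_in t z : 0 <= z.1 -> page t (in_page t z) by move=> z0; exists z.1.
have cin t : continuous (in_page t) by rewrite /in_page; cts.
(* Having transition [s] is locally constant on the page off the traces, the form in which the
   lemmas on half-planes apply. *)
have T_loc k s : (k < 8)%N -> forall z, 0 <= z.1 -> ~ trace (page_code k.+1) z ->
    (T k (in_page (angles k.+1) z) s ->
       \forall y \near z, 0 <= y.1 -> ~ trace (page_code k.+1) y -> T k (in_page (angles k.+1) y) s) /\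
    (~ T k (in_page (angles k.+1) z) s ->
       \forall y \near z, 0 <= y.1 -> ~ trace (page_code k.+1) y -> ~ T k (in_page (angles k.+1) y) s).
  move=> k8 z z0 /(traceP k8 z0) nK.
  have [h1 h2] := T_near k _ s k8 (page_in _ _ z0) nK; split.
    move=> /h1 h; have := @near_comp _ _ _ (fun c => page (angles k.+1) c -> ~ K c -> T k c s) z (cin (angles k.+1)) h.
    by apply: filterS => y H y0 /(traceP k8 y0); apply: H; exact: page_in.
  move=> /h2 h; have := @near_comp _ _ _ (fun c => page (angles k.+1) c -> ~ K c -> ~ T k c s) z (cin (angles k.+1)) h.
  by apply: filterS => y H y0 /(traceP k8 y0); apply: H; exact: page_in.
have off_trace k r : (k < 8)%N -> ~ trace (page_code k.+1) (0, r) <-> off r.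
  move=> k8; have := @traceP k (0, r) k8 (lexx 0); rewrite in_page_axis_pt => tK.
  by split=> [h|/offK h]; [apply: Koff; rewrite tK|rewrite -tK].
have sameT k r r' s : (k < 8)%N -> off r -> off r' ->
    (forall l, pg l = page_code k.+1 -> spanned l r = spanned l r') ->
    T k (axis_pt r) s -> T k (axis_pt r') s.
  move=> k8 ro ro' H; rewrite -!(in_page_axis_pt (angles k.+1)).
  apply: (@page_same_side R _ (curve (page_code k.+1)) (@ccurve _) (@clamp_curve _)
    (@curve_ge0 _) (@curve_ends _) (@curve_axis _) (@curve_disj _)
    (fun z => T k (in_page (angles k.+1) z) s) (T_loc k s k8)).
  - exact/(off_trace k r k8).
  - exact/(off_trace k r' k8).
  - case=> -[l|l] pu; rewrite /inside /curve /=; last first.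
      by rewrite -!expr2; apply/idP/idP; rewrite ltNge sqr_ge0.
    have := H l (eqP pu); rewrite /spanned; case: (B_ends l) => -[-> ->] //=.
    by rewrite mulrC [X in _ = (X < 0)]mulrC.
(* Compares with the base point, which is spanned by no arc either and where the transitions are
   trivial. *)
have trivT k r : (k < 8)%N -> off r ->
    (forall l, pg l = page_code k.+1 -> ~~ spanned l r) -> T k (axis_pt r) 1%g.
  move=> k8 ro H; apply: (sameT k _ _ _ k8 q0_off ro _ (T_base k k8)) => l pl.
  rewrite (negbTE (H l pl)); apply/negbTE.
  have k'n : (l.+1 %% n < n)%N by rewrite ltn_mod.
  have := ht_low (ltn_ord l); have := ht_low k'n; rewrite /spanned -leNgt; nra.
have T_uniq k r s s' : (k < 8)%N -> off r -> T k (axis_pt r) s -> T k (axis_pt r) s' -> s = s'.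
  move=> k8 ro ts ts'; have pr : page (angles k.+1) (axis_pt r).
    by rewrite -(in_page_axis_pt (angles k.+1)); exact: page_in.
  by have [s0 _ U] := T_ex k _ k8 pr (offK ro); rewrite (U _ ts) (U _ ts').
(* A sample point [c i] in each bounded gap of the axis; [g i j] will be the transition there across
   page [j], which separates the wedges [2 j] and [2 j + 1]. *)
have /choice[c Hc] : forall i, exists r, (i < n.-1)%N -> lvl r = i.+1 /\ off r.
  move=> i; have [i1|_] := ltnP i n.-1; last by exists 0.
  by have [r rE ro] := gap_exists ht_inj i1; exists r.
have /choice[g' Hg'] : forall ij : nat * nat, exists s, (ij.1 < n.-1)%N -> (ij.2 < 4)%N ->
    T ij.2.*2 (axis_pt (c ij.1)) s.
  move=> [i j] /=; have [i1|_] := ltnP i n.-1; last by exists 1%g.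
  have [j4|_] := ltnP j 4; last by exists 1%g.
  have j8 : (j.*2 < 8)%N by lia.
  have pr : page (angles j.*2.+1) (axis_pt (c i)).
    by rewrite -(in_page_axis_pt (angles j.*2.+1)); exact: page_in.
  by have [s ts _] := T_ex _ _ j8 pr (offK (Hc i i1).2); exists s.
pose g i j := g' (i, j).
have Hg i j : (i < n.-1)%N -> (j < 4)%N -> T j.*2 (axis_pt (c i)) (g i j) by exact: Hg' (i, j).
have code_even j : page_code j.*2.+1 = j by rewrite /page_code /= odd_double /= uphalf_double.
have code_odd k l : odd k -> pg l = page_code k.+1 -> False.
  by move=> ok; have := pg_lt l; rewrite /page_code /= ok /= => + E; rewrite E.
have T_odd k r : (k < 8)%N -> odd k -> off r -> T k (axis_pt r) 1%g.
  by move=> k8 ok ro; apply: trivT => // l /(code_odd _ _ ok).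
have R1 i : (i < n.-1)%N -> (g i 0%N * g i 1%N * g i 2%N * g i 3%N)%g = 1%g.
  move=> i1; have [_ ro] := Hc i i1.
  have := T_prod (axis_pt (c i)) (fun k => if odd k then 1%g else g i k./2) (ax_axis _) (offK ro).
  rewrite !big_ord_recr big_ord0 /= !mulg1 !mul1g; apply => k k8.
  case: ifPn => [ok|ek]; first exact: T_odd.
  have kE : k = (k./2).*2 by rewrite even_halfK.
  by rewrite {1}kE; apply: Hg => //; lia.
have R2 k l j : (k < n.-1)%N -> (l < n.-1)%N -> (j < 4)%N ->
    (forall e, (e < n)%N -> nth 0%N P e = j ->
       spans (arc_of v P e) k = spans (arc_of v P e) l) -> g k j = g l j.
  move=> k1 l1 j4 H; have [ck ko] := Hc k k1; have [cl lo] := Hc l l1.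
  have j8 : (j.*2 < 8)%N by lia.
  apply: (T_uniq j.*2 (c l)) => //; last exact: Hg.
  apply: (sameT _ (c k)) => //; last exact: Hg.
  move=> e; rewrite code_even => pe.
  by rewrite (spanned_spans _ ko ck) (spanned_spans _ lo cl); apply: H; rewrite // nthP'.
have R3 k j : (k < n.-1)%N -> (j < 4)%N ->
    (forall e, (e < n)%N -> nth 0%N P e = j -> ~~ spans (arc_of v P e) k) -> g k j = 1%g.
  move=> k1 j4 H; have [ck ko] := Hc k k1.
  have j8 : (j.*2 < 8)%N by lia.
  apply: (T_uniq j.*2 (c k)) => //; first exact: Hg.
  apply: trivT => // e; rewrite code_even => pe.
  by rewrite (spanned_spans _ ko ck); apply: H; rewrite // nthP'.
have val := config_valid.
have P4 : all (fun j => (j < 4)%N) P.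
  by apply/allP => j /mapP[k]; rewrite mem_iota => kn ->; rewrite (pgnE (Ordinal kn)).
have sP : size P = n by rewrite size_map size_iota.
have pv := ranks_perm ht_inj; have v0 := ranks0 ht_low n_gt0.
(* The axis point reached from [b] has the same vertices below it as one of the sample points, or it
   lies beyond all vertices, where no arc spans it. *)
have adj k b s : (k < 8)%N -> page (angles k.+1) b -> ~ K b -> T k b s ->
    s = 1%g \/ exists i j, [/\ (i < n.-1)%N, (j < 4)%N & s = g i j].
  move=> k8 [r0 r00 bE] nK ts.
  have bE' : b = in_page (angles k.+1) (r0, b.2) by rewrite /in_page -bE -surjective_pairing.
  rewrite bE' in nK ts.
  have ntr : ~ trace (page_code k.+1) (r0, b.2) by move/(traceP k8 (r00 : 0 <= (r0, b.2).1)).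
  have [r [ro tr]] := @page_clopen_axis R _ (curve (page_code k.+1)) (@ccurve _) (@clamp_curve _)
    (@curve_ge0 _) (@curve_inj _) (@curve_disj _)
    (fun z => T k (in_page (angles k.+1) z) s) (T_loc k s k8) _ (r00 : 0 <= (r0, b.2).1) ntr ts.
  move/(off_trace k r k8): ro => ro; rewrite in_page_axis_pt in tr.
  have [ok|ek] := boolP (odd k); first by left; exact: T_uniq k8 ro tr (T_odd k r k8 ok ro).
  have kE : k = (k./2).*2 by rewrite even_halfK.
  have j4 : (k./2 < 4)%N by lia.
  have lvn : (lvl r <= n)%N by have := count_size (fun l => ht l < r) (iota 0 n); rewrite size_iota.
  have [lr|lr] : (lvl r == 0%N) || (lvl r == n) \/ (0 < lvl r < n)%N by lia.
    left; apply: (T_uniq k r) => //; apply: trivT => // l _.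
    have l'n : (l.+1 %% n < n)%N by rewrite ltn_mod.
    rewrite spannedE//; case/orP: lr => /eqP ->; first by [].
    by rewrite /lvl !level_lt_size.
  right; exists (lvl r).-1, k./2; have i1 : ((lvl r).-1 < n.-1)%N by lia.
  have [ck ko] := Hc _ i1.
  split=> //; apply: (T_uniq k r) => //; rewrite {1}kE; apply: (sameT _ (c (lvl r).-1)) => //.
  - by lia.
  - move=> l _; rewrite !spannedE// ck prednK//; lia.
  - exact: Hg.
have [[i0 Hi]|ev] := monodromy_abelian n45 sizev pv v0 sP P4 val R1 R2 R3.
  left; apply: (T_root i0) => k b s k8 pb nK ts.
  by have [->|[i [j [i1 j4 ->]]]] := adj k b s k8 pb nK ts; [rewrite perm1|exact: Hi].
right; apply: T_disc => k b s k8 pb nK ts.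
by have [->|[i [j [i1 j4 ->]]]] := adj k b s k8 pb nK ts; [rewrite odd_perm1|exact: ev].
Qed.
End FourPages.

Lemma continuous_clamped (R : realType) (T : topologicalType) (f : R -> T) :
  {within `[0, 1], continuous f} -> continuous (fun s => f (clamp s)).
Proof.
move=> /subspace_continuousP cf s.
have inc (t : R) : `[0, 1]%classic (clamp t) by rewrite /= in_itv /= clamp01.
move=> U /(cf _ (inc s)) fU.
have := @near_comp R R (@clamp R) (fun y : R => `[0, 1]%classic y -> U (f y)) s (@continuous_clamp R) fU.
by apply: filterS => t; apply.
Qed.

Lemma cos_double (R : realType) (d : R) : cos (2 * d) = 2 * cos d ^+ 2 - 1.
Proof.
have -> : 2 * d = d + d by ring.
rewrite cosD; have := cos2Dsin2 d; lra.
Qed.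

Lemma sin_double (R : realType) (d : R) : sin (2 * d) = 2 * sin d * cos d.
Proof.
have -> : 2 * d = d + d by ring.
by rewrite sinD; ring.
Qed.

Lemma cos_triple (R : realType) (d : R) : cos (3 * d) = 4 * cos d ^+ 3 - 3 * cos d.
Proof.
have -> : 3 * d = 2 * d + d by ring.
rewrite cosD cos_double sin_double.
have s2 : sin d ^+ 2 = 1 - cos d ^+ 2 by have := cos2Dsin2 d; lra.
have -> : 2 * sin d * cos d * sin d = 2 * cos d * sin d ^+ 2 by ring.
rewrite s2; ring.
Qed.

Definition trefoil (R : realType) (t : R) : E3 R :=
  ((2 + cos (3 * t)) * cos (2 * t), (2 + cos (3 * t)) * sin (2 * t), sin (3 * t)).

(** At equal points both [2 * (s - t)] and [3 * (s - t)] are multiples of [2 * pi], hence so is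
    [s - t]; the double and triple angle formulas express this through cosines. *)
Lemma trefoil_eq (R : realType) (s t : R) : trefoil s = trefoil t <-> cos (s - t) = 1.
Proof.
have dE (c : R) : c * s - c * t = c * (s - t) by ring.
split=> [[E1 E2 E3]|c1].
  have rho (u : R) : 0 <= 2 + cos (3 * u) by have := cos_geN1 (3 * u); lra.
  have rhoE : 2 + cos (3 * s) = 2 + cos (3 * t).
    by rewrite -(vlen_polar (2 * s) (rho s)) -(vlen_polar (2 * t) (rho t)) E1 E2.
  have rN0 : 2 + cos (3 * t) != 0 by have := cos_geN1 (3 * t); rewrite gt_eqF//; lra.
  rewrite rhoE in E1 E2; have {}E1 := mulfI rN0 E1; have {}E2 := mulfI rN0 E2.
  have c3 : cos (3 * (s - t)) = 1.
    have E0 : cos (3 * s) = cos (3 * t) by lra.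
    by rewrite -dE cosB E0 E3 -!expr2 cos2Dsin2.
  have c2 : cos (2 * (s - t)) = 1 by rewrite -dE cosB E1 E2 -!expr2 cos2Dsin2.
  move: c2 c3; rewrite cos_double cos_triple; set c := cos (s - t) => c2 c3.
  have h2 : c ^+ 2 = 1 by lra.
  by move: c3; rewrite exprSr h2 mul1r; lra.
have c2 : cos (2 * s - 2 * t) = 1 by rewrite dE cos_double c1 expr1n; ring.
have c3 : cos (3 * s - 3 * t) = 1 by rewrite dE cos_triple c1 !expr1n; ring.
have [C2 S2] := cos_sin_eq c2; have [C3 S3] := cos_sin_eq c3.
by rewrite /trefoil C2 S2 C3 S3.
Qed.

Lemma continuous_trefoil (R : realType) : continuous (@trefoil R).
Proof. by rewrite /trefoil; cts. Qed.

Lemma page_eq (R : realType) (s t : R) : page s = page t <-> cos (s - t) = 1.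
Proof.
split=> [E|/cos_sin_eq[c1 s1]]; last by rewrite /page c1 s1.
have [r r0 [c1 s1]] : page t (1 * cos s, 1 * sin s, 0).
  by rewrite -E; exists 1; [exact: ler01|].
rewrite !mul1r in c1 s1.
have r1 : r = 1.
  have := cos2Dsin2 s; rewrite c1 s1 !exprMn -mulrDr cos2Dsin2 mulr1 => r2.
  by apply/eqP; rewrite -(@eqrXn2 _ 2%N)// r2 expr1n.
by rewrite cosB c1 s1 r1 !mul1r -!expr2 cos2Dsin2.
Qed.

Lemma sorted_pages (R : realType) (pages : 'I_4 -> set (E3 R)) :
  injective pages -> (forall j, is_page (pages j)) ->
  exists (th : nat -> R) (c : 'I_4 -> nat),
    [/\ [/\ th 0 < th 1, th 1 < th 2, th 2 < th 3 & th 3 < th 0 + 2 * pi],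
        forall j, (c j < 4)%N /\ pages j = page (th (c j)),
        injective c & forall i, (i < 4)%N -> exists j, c j = i].
Proof.
move=> pinj ppage; have p0 := @pi_gt0 R.
have /choice[a Ha] : forall j, exists t, 0 <= t < 2 * pi /\ pages j = page t.
  move=> j; have [t ->] := ppage j; have [t' [t'w c1]] := angle_window_lt 0 t.
  by rewrite add0r in t'w; exists t'; split=> //; apply/esym/page_eq.
have a_inj : injective a by move=> i j E; apply: pinj; rewrite (Ha i).2 (Ha j).2 E.
pose s := sort <=%R (map a (enum 'I_4)).
have ss : size s = 4%N by rewrite size_sort size_map size_enum_ord.
have su : uniq s by rewrite sort_uniq map_inj_uniq// enum_uniq.
have s_lt : sorted <%R s by rewrite lt_sorted_uniq_le su sort_le_sorted.
have mem_s j : a j \in s by rewrite mem_sort map_f// mem_enum.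
have s_win i : (i < 4)%N -> 0 <= nth 0 s i < 2 * pi.
  move=> i4; have : nth 0 s i \in s by rewrite mem_nth ?ss.
  by rewrite mem_sort => /mapP[j _ ->]; exact: (Ha j).1.
have lt_s i : (i.+1 < 4)%N -> nth 0 s i < nth 0 s i.+1.
  by move=> i4; apply: (sorted_ltn_nth lt_trans) => //; rewrite inE ss// ltnW.
exists (nth 0 s), (fun j => index (a j) s); split.
- split; [exact: lt_s|exact: lt_s|exact: lt_s|].
  by have := s_win 0%N isT; have := s_win 3 isT; lra.
- by move=> j; rewrite -ss index_mem mem_s nth_index// (Ha j).2.
- move=> i j E; apply: a_inj; by rewrite -(nth_index 0 (mem_s i)) -(nth_index 0 (mem_s j)) E.
- move=> i i4; have : nth 0 s i \in s by rewrite mem_nth ?ss.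
  by rewrite {1}mem_sort => /mapP[j _ E]; exists j; rewrite -E index_uniq ?ss.
Qed.

Lemma presentation_ge4 (R : realType) (L : set (E3 R)) n : four_page_presentation L n -> (4 <= n)%N.
Proof.
move=> [pages [pg [arc [_ surj _ _ _]]]]; have /choice[f Hf] := surj.
by rewrite -(card_ord 4) -(card_ord n); apply: (leq_card f) => i j E; rewrite -(Hf i) -(Hf j) E.
Qed.

Lemma page_inter (R : realType) (s t : R) p : page s p -> page t p ->
  cos (s - t) = 1 \/ binding_axis p.
Proof.
move=> [r r0 E] [r' r0' E'].
have rr : r = r' by rewrite -(vlen_polar s r0) -(vlen_polar t r0') -E -E'.
have [rE|rN0] := eqVneq r 0; first by right; rewrite /binding_axis /= E rE !mul0r.
left; move: E; rewrite E' -rr => -[/(mulfI rN0) c1 /(mulfI rN0) s1].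
by rewrite cosB c1 s1 -!expr2 cos2Dsin2.
Qed.

(** The cubic has no quadratic term. The proof subtracts the relations [u^2 + u v + v^2 = 3 a] of
    two pairs of roots. *)
Lemma cubic_root_sum (R : realType) (a w x y z : R[i]) :
  cubic_root a w x -> cubic_root a w y -> cubic_root a w z ->
  x != y -> x != z -> y != z -> z = - (x + y).
Proof.
rewrite /cubic_root => xa ya za xy xz yz.
have quad u v : u != v -> u ^+ 3 - 3 * a * u + 2 * w = 0 -> v ^+ 3 - 3 * a * v + 2 * w = 0 ->
    u ^+ 2 + u * v + v ^+ 2 = 3 * a.
  move=> uv hu hv; have uv0 : u - v != 0 by rewrite subr_eq0.
  apply: (mulfI uv0); apply/eqP; rewrite -subr_eq0; apply/eqP.
  have -> : (u - v) * (u ^+ 2 + u * v + v ^+ 2) - (u - v) * (3 * a) =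
    (u ^+ 3 - 3 * a * u + 2 * w) - (v ^+ 3 - 3 * a * v + 2 * w) by ring.
  by rewrite hu hv subr0.
have yz0 : y - z != 0 by rewrite subr_eq0.
apply/eqP; rewrite -subr_eq0; apply/eqP; apply: (mulfI yz0); rewrite mulr0.
have -> : (y - z) * (z - - (x + y)) = (x ^+ 2 + x * y + y ^+ 2) - (x ^+ 2 + x * z + z ^+ 2) by ring.
by rewrite !quad// subrr.
Qed.

(** * Exclusion of four and five arcs for the trefoil *)

Section LowerBound.
Variable R : realType.

Definition half_plane (t : R) (p : E3 R) : R * R := (p.1.1 * cos t + p.1.2 * sin t, p.2).

Lemma half_planeK (t : R) p : page t p -> 0 <= (half_plane t p).1 /\ p = in_page t (half_plane t p).
Proof.
move=> [r r0]; case: p => -[x y] z /= [-> ->]; rewrite /half_plane /in_page /=.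
have -> : r * cos t * cos t + r * sin t * sin t = r.
  by rewrite -!mulrA -mulrDr -!expr2 cos2Dsin2 mulr1.
by [].
Qed.

Lemma trefoil_no_presentation n : (n == 4%N) || (n == 5%N) ->
  four_page_presentation (trefoil_knot R) n -> False.
Proof.
move=> n45 [pages [pg [arc [[pinj ppage] surj parc disj [H [_ Hhomeo _ HK]]]]]].
have [ch [g [cg hK gK]]] : homeomorphism (fun p => H (1, p)) by apply: Hhomeo; rewrite ler01 lexx.
set h := fun p => H (1, p) in ch hK gK HK.
have [th [c [th_lt cP c_inj c_surj]]] := sorted_pages pinj ppage.
have /choice[gam Hgam] := parc.
have n_gt0 : (0 < n)%N by case/orP: n45 => /eqP ->.
pose gamma i s := gam i (clamp s).
have cgamma i : continuous (gamma i).
  by have [cgi _ _ _ _] := Hgam i; exact: continuous_clamped.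
have gammaE i s : 0 <= s <= 1 -> gamma i s = gam i s by move=> s1; rewrite /gamma clamp_id.
have gamma_inj i s t : 0 <= s <= 1 -> 0 <= t <= 1 -> gamma i s = gamma i t -> s = t.
  move=> s1 t1; rewrite !gammaE//; have [_ inj _ _ _] := Hgam i; apply: inj;
  by rewrite in_itv.
have gamma_axis i s : 0 <= s <= 1 -> binding_axis (gamma i s) -> s = 0 \/ s = 1.
  by move=> s1; rewrite gammaE//; have [_ _ _ _ ax] := Hgam i; move/ax: s1 => [].
have in0 : 0 <= (0 : R) <= 1 by rewrite lexx ler01.
have in1 : 0 <= (1 : R) <= 1 by rewrite lexx ler01.
have gamma_ends i : binding_axis (gamma i 0) /\ binding_axis (gamma i 1).
  have [_ _ _ _ ax] := Hgam i; rewrite !gammaE//.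
  by split; [apply/(ax 0 in0); left|apply/(ax 1 in1); right].
have gamma_arc i s : arc i (gamma i s).
  have [_ _ -> _ _] := Hgam i; exists (clamp s) => //; by rewrite /= in_itv /= clamp01.
have arc_gamma i p : arc i p -> exists2 s, 0 <= s <= 1 & p = gamma i s.
  by have [_ _ -> _ _] := Hgam i; move=> [s]; rewrite /= in_itv /= => s1 <-; exists s; rewrite ?gammaE.
have gamma_page i s : page (th (c (pg i))) (gamma i s).
  by rewrite -(cP (pg i)).2; have [_ _ _ sub _] := Hgam i; apply: sub; exact: gamma_arc.
pose B i s := half_plane (th (c (pg i))) (gamma i s).
have B_ge0 i s : 0 <= (B i s).1 by exact: (half_planeK (gamma_page i s)).1.
have gammaB i s : gamma i s = in_page (th (c (pg i))) (B i s) by exact: (half_planeK (gamma_page i s)).2.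
have gamma_same i j s t : gamma i s = gamma j t -> pg i = pg j -> i = j.
  move=> E pij; apply/eqP/negPn/negP => ij.
  have : (arc i `&` arc j) (gamma i s) by split; [|rewrite E]; exact: gamma_arc.
  by rewrite (disj i j ij pij).
have gamma_disj i j s t : 0 <= s <= 1 -> 0 <= t <= 1 ->
    gamma i s = gamma j t -> i = j \/ binding_axis (gamma i s).
  move=> s1 t1 E; have [pij|pij] := eqVneq (pg i) (pg j); first by left; exact: gamma_same E pij.
  have pj : page (th (c (pg j))) (gamma i s) by rewrite E; exact: gamma_page.
  have [/page_eq E'|] := page_inter (gamma_page i s) pj; last by right.
  by move: pij; rewrite -(cP _).2 -(cP _).2 in E'; rewrite (pinj _ _ E') eqxx.
pose phi t := h (trefoil t).
have cphi : continuous phi by move=> t; apply: continuous_comp; [exact: continuous_trefoil|exact: ch].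
have phi_eq s t : phi s = phi t <-> cos (s - t) = 1.
  by rewrite -trefoil_eq /phi; split=> [/(can_inj hK)|->].
have phi_gamma t : exists i, exists2 s, 0 <= s <= 1 & phi t = gamma i s.
  have : (h @` trefoil_knot R) (phi t) by exists (trefoil t) => //; exists t.
  by rewrite HK => -[i _ /arc_gamma]; exists i.
have gamma_phi i s : 0 <= s <= 1 -> exists t, gamma i s = phi t.
  move=> _; have : (\bigcup_i arc i) (gamma i s) by exists i.
  by rewrite -HK => -[p [t _ <-] <-]; exists t.
have [e [x [e_inj x_inj x_ends x_low]]] := cycle_structure cphi phi_eq cgamma gamma_inj
  gamma_axis gamma_ends gamma_disj phi_gamma gamma_phi n_gt0.
pose e' (k : 'I_n) := e k.
have e'_inj : injective e'.
  by move=> k l E; apply/val_inj; exact: (e_inj _ _ (ltn_ord k) (ltn_ord l) E).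
pose pgk (k : 'I_n) := c (pg (e k)).
pose ht k := (x k).2.
have x_axis k : (k < n)%N -> x k = (0, 0, ht k).
  move=> kn; have : binding_axis (x k).
    by case: (x_ends k kn) => -[-> _]; [exact: (gamma_ends _).1|exact: (gamma_ends _).2].
  by rewrite /ht; case: (x k) => -[a b] d [/= -> ->].
pose K' := [set p | exists (k : 'I_n) s, p = in_page (th (pgk k)) (B (e k) s)].
have ge' : forall i, exists k, e' k = i.
  by move=> i; exists (invF e'_inj i); rewrite f_invF.
have K'E p : K' p <-> trefoil_knot R (g p).
  have K'h : K' p <-> (h @` trefoil_knot R) p.
    rewrite HK; split=> [[k [s ->]]|[i _ /arc_gamma[s _ ->]]].
      by rewrite -gammaB; exists (e k).
    by have [k <-] := ge' i; exists k, s; rewrite gammaB.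
  by rewrite K'h; split=> [[q tq <-]|tq]; [rewrite hK|exists (g p) => //; exact: gK].
pose Q p T := cubic_root (knot_a (g p)) (knot_w (g p)) T.
have covQ : covering (@cdist R) (~` K') Q.
  by apply: (covering_comp cg _ (@knot_covering R)) => p nK /K'E; exact: nK.
have rootsQ b : ~ K' b -> exists t : 'I_3 -> R[i], injective t /\ forall T, Q b T <-> exists i, T = t i.
  move=> nK; have /cubic_roots[t [t_inj tP]] : knot_a (g b) ^+ 3 != knot_w (g b) ^+ 2.
    by apply/eqP => /knot_disc; rewrite -K'E.
  by exists t; split=> //; exact: cubic_root_prod.
have axisB i s : binding_axis (gamma i s) -> B i s = (0, (gamma i s).2).
  by rewrite /B /half_plane => -[-> ->]; rewrite !mul0r addr0.
have axis_of i s : 0 <= s <= 1 -> (B i s).1 = 0 -> binding_axis (gamma i s).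
  by rewrite gammaB; move: (B i s) => b _ b0; rewrite /binding_axis /= b0 !mul0r.
have cB (k : 'I_n) : continuous (B (e k)).
  by have cg' := @cgamma (e k); rewrite /B /half_plane; cts.
have clampB (k : 'I_n) s : B (e k) s = B (e k) (clamp s).
  by rewrite /B /gamma (clamp_id (clamp01 s)).
have B_axis (k : 'I_n) s : 0 <= s <= 1 -> (B (e k) s).1 = 0 -> s = 0 \/ s = 1.
  by move=> s1 /(axis_of _ _ s1); exact: gamma_axis.
have B_inj (k : 'I_n) s t : 0 <= s <= 1 -> 0 <= t <= 1 -> B (e k) s = B (e k) t -> s = t.
  by move=> s1 t1 E; apply: (gamma_inj (e k)) => //; rewrite !gammaB E.
have B_disj (k l : 'I_n) s t : pgk k = pgk l -> B (e k) s = B (e l) t -> k = l.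
  rewrite /pgk => pkl E; apply: e'_inj; apply: (gamma_same _ _ s t); last exact: c_inj.
  by rewrite !gammaB E pkl.
have B_ends (k : 'I_n) : (B (e k) 0 = (0, ht k) /\ B (e k) 1 = (0, ht (k.+1 %% n)%N)) \/
    (B (e k) 0 = (0, ht (k.+1 %% n)%N) /\ B (e k) 1 = (0, ht k)).
  have [a0 a1] := gamma_ends (e k); rewrite !axisB// /ht.
  by case: (x_ends k (ltn_ord k)) => -[-> ->]; [left|right].
have pg_lt (k : 'I_n) : (pgk k < 4)%N by exact: (cP _).1.
have pg_surj j : (j < 4)%N -> exists k, pgk k = j.
  by move=> /c_surj[i <-]; have [i' <-] := surj i; have [k <-] := ge' i'; exists k.
have ht_inj k l : (k < n)%N -> (l < n)%N -> ht k = ht l -> k = l.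
  by move=> kn ln E; apply: x_inj => //; rewrite !x_axis// E.
have Kn p : ~ trefoil_knot R p -> ~ K' (h p) by move=> np /K'E; rewrite hK.
have [[r lr]|[r cr rE]] := four_page_monodromy n45 th_lt cB clampB (fun k => B_ge0 (e k))
  B_axis B_inj B_disj B_ends pg_lt pg_surj ht_inj x_low covQ rootsQ.
  apply: (@no_global_root R (r \o h)).
  have := lift_comp ch Kn lr; rewrite /Q.
  by move=> [h1 h2]; split=> // p /h2 /=; rewrite hK.
apply: (@no_global_sqrt R (r \o h)); first exact: continuous_to_comp ch Kn cr.
move=> p np /=; have [t [t_inj tQ ->]] := rE _ (Kn _ np).
have n01 : t ord0 != t (inord 1) by rewrite (inj_eq t_inj) -val_eqE /= inordK.
have Q0 := tQ ord0; have Q1 := tQ (inord 1); have Q2 := tQ (inord 2).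
rewrite /Q hK in Q0 Q1 Q2.
(* Once the third root is replaced by minus the sum of the others, the square of [vandermonde3] is
   the discriminant. *)
rewrite -(cubic_disc Q0 Q1 n01) /vandermonde3.
have n02 : t ord0 != t (inord 2) by rewrite (inj_eq t_inj) -val_eqE /= inordK.
have n12 : t (inord 1) != t (inord 2) by rewrite (inj_eq t_inj) -val_eqE /= !inordK.
have -> : t (inord 2) = - (t ord0 + t (inord 1)) by exact: cubic_root_sum Q0 Q1 Q2 n01 n02 n12.
by ring.
Qed.
End LowerBound.

(** * Presentations of the Hopf link and the trefoil *)

Section Isotopies.
Variable R : realType.
Implicit Types F G : R -> E3 R -> E3 R.

(** The inverse family is also jointly continuous, a condition under which two such deformations
    compose. *)
Definition isotopy F := exists G,
  [/\ continuous (fun q : R * E3 R => F q.1 q.2), continuous (fun q : R * E3 R => G q.1 q.2),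
      forall t, cancel (F t) (G t), forall t, cancel (G t) (F t) & forall p, F 0 p = p].

Lemma continuous_slice (F : R -> E3 R -> E3 R) t :
  continuous (fun q : R * E3 R => F q.1 q.2) -> continuous (F t).
Proof.
move=> cF; have c2 : continuous (fun p : E3 R => (t, p)) by cts.
by move=> p; exact: (continuous_comp (c2 p) (cF (t, p))).
Qed.

Lemma isotopy_comp F F' : isotopy F -> isotopy F' -> isotopy (fun t p => F' t (F t p)).
Proof.
move=> [G [cF cG FK GK F0]] [G' [cF' cG' FK' GK' F0']].
exists (fun t p => G t (G' t p)); split.
- have c2 : continuous (fun q : R * E3 R => (q.1, F q.1 q.2)) by cts.
  by move=> q; exact: (continuous_comp (c2 q) (cF' _)).
- have c2 : continuous (fun q : R * E3 R => (q.1, G' q.1 q.2)) by cts.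
  by move=> q; exact: (continuous_comp (c2 q) (cG _)).
- by move=> t p; rewrite FK' FK.
- by move=> t p; rewrite GK GK'.
- by move=> p; rewrite F0 F0'.
Qed.

Lemma isotopy_image F (K L : set (E3 R)) : isotopy F -> F 1 @` K = L -> ambient_isotopic K L.
Proof.
move=> [G [cF cG FK GK F0]] KL; exists (fun q => F q.1 q.2); split => //=.
- by apply: continuous_subspaceT.
- move=> t _; split; first exact: continuous_slice.
  by exists (G t); split; [exact: continuous_slice|exact: FK|exact: GK].
Qed.

Definition shear_x (f : R * R -> R) (t : R) (p : E3 R) : E3 R :=
  (p.1.1 + t * f (p.1.2, p.2), p.1.2, p.2).
Definition shear_y (f : R * R -> R) (t : R) (p : E3 R) : E3 R :=
  (p.1.1, p.1.2 + t * f (p.1.1, p.2), p.2).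
Definition shear_z (f : R * R -> R) (t : R) (p : E3 R) : E3 R :=
  (p.1.1, p.1.2, p.2 + t * f p.1).

Lemma shear_isotopy f : continuous f ->
  [/\ isotopy (shear_x f), isotopy (shear_y f) & isotopy (shear_z f)].
Proof.
move=> cf; split.
- exists (shear_x (fun z => - f z)); split.
  + by rewrite /shear_x; cts.
  + by rewrite /shear_x; cts.
  + by move=> t [[x y] z]; rewrite /shear_x /=; congr (_, _, _); ring.
  + by move=> t [[x y] z]; rewrite /shear_x /=; congr (_, _, _); ring.
  + by move=> [[x y] z]; rewrite /shear_x /=; congr (_, _, _); ring.
- exists (shear_y (fun z => - f z)); split.
  + by rewrite /shear_y; cts.
  + by rewrite /shear_y; cts.
  + by move=> t [[x y] z]; rewrite /shear_y /=; congr (_, _, _); ring.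
  + by move=> t [[x y] z]; rewrite /shear_y /=; congr (_, _, _); ring.
  + by move=> [[x y] z]; rewrite /shear_y /=; congr (_, _, _); ring.
- exists (shear_z (fun z => - f z)); split.
  + by rewrite /shear_z; cts.
  + by rewrite /shear_z; cts.
  + by move=> t [[x y] z]; rewrite /shear_z /=; congr (_, _, _); ring.
  + by move=> t [[x y] z]; rewrite /shear_z /=; congr (_, _, _); ring.
  + by move=> [[x y] z]; rewrite /shear_z /=; congr (_, _, _); ring.
Qed.

Lemma page_arc (t : R) (C : R -> R * R) : continuous C ->
  (forall s u, 0 <= s <= 1 -> 0 <= u <= 1 -> C s = C u -> s = u) ->
  (forall s, 0 <= s <= 1 -> 0 <= (C s).1) ->
  (forall s, 0 <= s <= 1 -> ((C s).1 = 0 <-> s = 0 \/ s = 1)) ->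
  proper_arc (page t) ((fun s => in_page t (C s)) @` `[0, 1]%classic).
Proof.
move=> cC C_inj C_ge0 C_ax; exists (fun s => in_page t (C s)).
have in_pageE z z' : 0 <= z.1 -> 0 <= z'.1 -> in_page t z = in_page t z' -> z = z'.
  case: z z' => [a b] [a' b'] /= a0 a0' [E1 E2 ->].
  by rewrite -(vlen_polar t a0) -(vlen_polar t a0') E1 E2.
split => //.
- by apply: continuous_subspaceT; rewrite /in_page; cts.
- move=> s u; rewrite !in_itv /= => s1 u1 E; apply: C_inj => //.
  by apply: in_pageE E; exact: C_ge0.
- by move=> p [s]; rewrite /= in_itv /= => s1 <-; exists (C s).1 => //; exact: C_ge0.
- move=> s s1; rewrite -C_ax// /binding_axis /in_page /=; split=> [[E1 E2]|->].
    by rewrite -(vlen_polar t (C_ge0 s s1)) E1 E2 /vlen expr0n /= addr0 sqrtr0.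
  by rewrite !mul0r.
Qed.
End Isotopies.

(** * The Hopf link with four arcs *)

Section Hopf.
Variable R : realType.

Definition half_circle (c s : R) : R * R := (sin (s * pi), c - cos (s * pi)).

Lemma half_circle_arc (t c : R) :
  proper_arc (page t) ((fun s => in_page t (half_circle c s)) @` `[0, 1]%classic).
Proof.
have p0 := @pi_gt0 R.
have spi (s : R) : 0 <= s <= 1 -> 0 <= s * pi <= pi by move=> s1; nra.
apply: page_arc.
- by rewrite /half_circle; cts.
- move=> s u s1 u1 [_ /addrI /oppr_inj E].
  apply: (mulIf (lt0r_neq0 p0)); apply: cos_inj E; rewrite in_itv /=; exact: spi.
- by move=> s /spi sp; apply: sin_ge0_pi.
- move=> s s1; have sp := spi s s1; rewrite /half_circle /=; split=> [sE|]; last first.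
    by case=> ->; rewrite ?mul0r ?mul1r ?sin0 ?sinpi.
  have [->|s0] := eqVneq s 0; [by left|right].
  apply/eqP/negPn/negP => sN1.
  have h1 : 0 < s by rewrite lt0r s0; case/andP: s1.
  have h2 : s < 1 by rewrite lt_neqAle sN1; case/andP: s1.
  have : 0 < sin (s * pi) by apply: sin_gt0_pi; nra.
  by rewrite sE ltxx.
Qed.

Lemma half_circle_image (t c : R) :
  (fun s => in_page t (half_circle c s)) @` `[0, 1]%classic =
  [set p | exists z, [/\ 0 <= z.1, z.1 ^+ 2 + (z.2 - c) ^+ 2 = 1 & p = in_page t z]].
Proof.
have p0 := @pi_gt0 R; apply/seteqP; split=> [p [s]|p [[r z] /= [r0 rz ->]]].
  rewrite /= in_itv /= => s1 <-; exists (half_circle c s); split => //=.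
    by apply: sin_ge0_pi; nra.
  by rewrite -[RHS](cos2Dsin2 (s * pi)); ring.
have z1 : -1 <= c - z <= 1 by nra.
have [a0 ap] : 0 <= acos (c - z) /\ acos (c - z) <= pi by rewrite acos_ge0 ?acos_lepi.
exists (acos (c - z) / pi).
  by rewrite /= in_itv /= divr_ge0 ?(ltW p0)//= ler_pdivrMr// mul1r.
rewrite /half_circle divfK ?gt_eqF// acosK ?in_itv//= sin_acos//.
congr in_page; congr (_, _); last by ring.
have -> : 1 - (c - z) ^+ 2 = r ^+ 2 by rewrite -rz; ring.
by rewrite sqrtr_sqr ger0_norm.
Qed.

Lemma quarter_turns : [/\ (cos (0%:R * (pi / 2)) = 1 :> R) /\ (sin (0%:R * (pi / 2)) = 0 :> R),
  (cos (1%:R * (pi / 2)) = 0 :> R) /\ (sin (1%:R * (pi / 2)) = 1 :> R),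
  (cos (2%:R * (pi / 2)) = -1 :> R) /\ (sin (2%:R * (pi / 2)) = 0 :> R) &
  (cos (3%:R * (pi / 2)) = 0 :> R) /\ (sin (3%:R * (pi / 2)) = -1 :> R)].
Proof.
split; rewrite ?mul0r ?mul1r ?cos0 ?sin0 ?cos_pihalf ?sin_pihalf//.
  by rewrite mulrC divfK ?pnatr_eq0// cospi sinpi.
have -> : 3%:R * (pi / 2) = pi / 2 + pi :> R by field.
by rewrite cosDpi sinDpi cos_pihalf sin_pihalf oppr0.
Qed.

Definition quarter_page (k : nat) : set (E3 R) := page (k%:R * (pi / 2)).

Lemma quarter_page_inj k l : (k < 4)%N -> (l < 4)%N -> quarter_page k = quarter_page l -> k = l.
Proof.
have p0 := @pi_gt0 R.
have lt_case i j : (i < j)%N -> (j < 4)%N -> quarter_page j = quarter_page i -> False.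
  move=> ij j4 /page_eq; have -> : j%:R * (pi / 2) - i%:R * (pi / 2) = (j - i)%N%:R * (pi / 2) :> R.
    by rewrite natrB ?mulrBl// ltnW.
  move=> c1; have h1 : (1 : R) <= (j - i)%N%:R by rewrite ler1n subn_gt0.
  have h2 : ((j - i)%N%:R : R) <= 3%:R by rewrite ler_nat; lia.
  have /eqP : (j - i)%N%:R * (pi / 2) = 0 :> R by apply: cos_eq1_small => //; rewrite ltr_norml; nra.
  by rewrite gt_eqF//; nra.
move=> k4 l4 E; have [kl|lk|//] := ltngtP k l.
  by case: (lt_case _ _ kl l4).
by case: (lt_case _ _ lk k4).
Qed.

(** At time 1 the product of the three shears is a quarter turn; at intermediate times it need not
    be a rotation. *)
Definition rotate_up (t : R) (p : E3 R) : E3 R :=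
  shear_x (fun z => - z.2) t (shear_z (fun z => z.1) t (shear_x (fun z => - z.2) t p)).

Lemma rotate_up_isotopy : isotopy rotate_up.
Proof.
have c1 : continuous (fun z : R * R => - z.2) by cts.
have c2 : continuous (fun z : R * R => z.1) by cts.
have [h1 _ _] := shear_isotopy c1; have [_ _ h2] := shear_isotopy c2.
exact: (isotopy_comp (isotopy_comp h1 h2) h1).
Qed.

Lemma rotate_up1 p : rotate_up 1 p = (- p.2, p.1.2, p.1.1).
Proof.
case: p => -[x y] z; rewrite /rotate_up /shear_x /shear_z /= !mul1r.
by congr (_, _, _); ring.
Qed.

Lemma hopf_presentation : four_page_presentation (hopf_link R) 4.
Proof.
(* The quarter turn puts the line through both centres on the binding. Each circle becomes two
   half-circles in opposite pages: that with centre at height 0 in pages 1 and 3, that with centre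
   at height 1 in pages 0 and 2. *)
pose c (i : 'I_4) : R := if odd i then 0 else 1.
pose arc (i : 'I_4) := (fun s => in_page (i%:R * (pi / 2)) (half_circle (c i) s)) @` `[0, 1]%classic.
exists (fun i : 'I_4 => quarter_page i), id, arc; split.
- split=> [i j E|i]; last by eexists.
  by apply/val_inj; exact: quarter_page_inj E.
- by move=> j; exists j.
- by move=> i; exact: half_circle_arc.
- by move=> i k /eqP.
apply: (isotopy_image rotate_up_isotopy).
have [[c0 s0] [c1 s1] [c2 s2] [c3 s3]] := quarter_turns.
apply/seteqP; split=> [q [p hp <-]|q [i _]]; last first.
  rewrite /arc half_circle_image => -[[r z] /= [r0 rz ->]].
  exists (z, (in_page (i%:R * (pi / 2)) (r, z)).1.2, - (in_page (i%:R * (pi / 2)) (r, z)).1.1).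
    case: i rz => -[|[|[|[|]]]] //= i4; rewrite /c /in_page /= ?c0 ?s0 ?c1 ?s1 ?c2 ?s2 ?c3 ?s3 => rz.
    - by right; split=> /=; lra.
    - by left; split=> /=; lra.
    - by right; split=> /=; lra.
    - by left; split=> /=; lra.
  by rewrite rotate_up1 /= opprK.
rewrite rotate_up1.
have in_arc (i : 'I_4) (r z : R) : 0 <= r -> r ^+ 2 + (z - c i) ^+ 2 = 1 ->
    (\bigcup_i arc i) (in_page (i%:R * (pi / 2)) (r, z)).
  by move=> r0 rz; exists i => //; rewrite /arc half_circle_image; exists (r, z).
case: p hp => -[x y] z; rewrite /hopf_link /= => -[[h ->]|[h ->]].
  have [y0|y0] := leP 0 y.
    have := in_arc (@Ordinal 4 1 isT) y x y0; rewrite /in_page /c /= c1 s1.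
    by rewrite !subr0 mulr0 mulr1 oppr0; apply; lra.
  have := in_arc (@Ordinal 4 3 isT) (- y) x; rewrite /in_page /c /= c3 s3.
  by rewrite !subr0 mulr0 mulrN1 opprK oppr0; apply; lra.
have [z0|z0] := leP z 0.
  have := in_arc (@Ordinal 4 0 isT) (- z) x; rewrite /in_page /c /= c0 s0.
  by rewrite mulr0 mulr1; apply; lra.
have := in_arc (@Ordinal 4 2 isT) z x; rewrite /in_page /c /= c2 s2.
by rewrite mulr0 mulrN1; apply; lra.
Qed.

End Hopf.

(** * The trefoil with six arcs *)

Section Trefoil.
Variable R : realType.

Let r3 : R := Num.sqrt 3.
Let r3_gt0 : 0 < r3. Proof. by rewrite sqrtr_gt0. Qed.
Let r3_sqr : r3 ^+ 2 = 3. Proof. by rewrite sqr_sqrtr. Qed.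

(* [finger] lifts the outer strand near [t = 0] above the rest of the projection,
   without new crossings, to the height where [fold_x] brings it to the axis; the
   other branches of [fold_x] bring the five other multiples of [pi / 3] there. *)
Definition finger (x : R) : R := Num.max 0 (8 - 16 * Num.sqrt (3 - x)).
Definition fold_x (y : R) : R :=
  Num.min (Num.min (`|y| / Num.sqrt 3) (Num.sqrt 3 * `|y| - 1)) (5 - y).
(** The projection of the deformed knot along its height. At time 0 the point (3, 0) is lifted to
    (3, 8), where [5 - y] is -3. At time [pi] the point is (1, 0) and the second branch of [fold_x]
    is -1. At the other four multiples of [pi / 3] the abscissa is [- |y| / sqrt 3], cancelled by
    the first branch. *)
Definition flat (t : R) : R * R :=
  let x := (2 + cos (3 * t)) * cos (2 * t) in
  let y := (2 + cos (3 * t)) * sin (2 * t) + finger x in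
  (x + fold_x y, y).

(** With [c = cos (2 * t)] the product [sin (3 * t) * sin t] is [(1 - c) * (2 * c + 1) / 2]. So the
    sign of the abscissa has to be found for [c] on either side of -1/2 and at the values -1/2 and
    1. *)
Lemma flat_x_sign (t : R) :
  [/\ 0 < sin (3 * t) * sin t -> 0 < (flat t).1,
      sin (3 * t) * sin t < 0 -> (flat t).1 < 0 &
      sin (3 * t) = 0 -> (flat t).1 = 0].
Proof.
have EE : sin (3 * t) * sin t = (1 - cos (2 * t)) * (2 * cos (2 * t) + 1) / 2.
  have -> : 3 * t = 2 * t + t by ring.
  rewrite sinD cos_double sin_double; have := cos2Dsin2 t.
  move: (sin t) (cos t) => a b ab.
  have a2 : a ^+ 2 = 1 - b ^+ 2 by lra.
  have -> : (2 * a * b * b + (2 * b ^+ 2 - 1) * a) * a = (4 * b ^+ 2 - 1) * a ^+ 2 by ring.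
  by rewrite a2; field.
have c1_cases : cos (2 * t) = 1 -> cos (3 * t) = 1 \/ cos (3 * t) = -1.
  rewrite cos_double cos_triple => h; have h2 : cos t ^+ 2 = 1 by lra.
  have : (cos t - 1) * (cos t + 1) == 0 by apply/eqP; rewrite -subr_sqr h2 expr1n subrr.
  rewrite mulf_eq0 => /orP[] /eqP h3; [left|right].
    have -> : cos t = 1 by lra.
    by rewrite expr1n; ring.
  have -> : cos t = -1 by lra.
  by ring.
have S0 : sin (3 * t) = 0 -> cos (2 * t) = 1 \/ cos (2 * t) = -1/2.
  move=> s0; have := EE; rewrite s0 mul0r => E0.
  have : (1 - cos (2 * t)) * (2 * cos (2 * t) + 1) == 0 by apply/eqP; lra.
  by rewrite mulf_eq0 => /orP[] /eqP h; [left|right]; lra.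
have rho1 : 1 <= 2 + cos (3 * t) <= 3 by have := cos_geN1 (3 * t); have := cos_le1 (3 * t); lra.
have rhoE : cos (2 * t) = 1 -> 2 + cos (3 * t) = 3 \/ 2 + cos (3 * t) = 1.
  by move/c1_cases => [->|->]; [left|right]; ring.
have cs := cos2Dsin2 (2 * t).
have [cle cge] := (cos_le1 (2 * t), cos_geN1 (2 * t)).
rewrite EE /flat /=; clear EE c1_cases.
suff H : [/\ -1/2 < cos (2 * t) < 1 -> 0 < (flat t).1, cos (2 * t) < -1/2 -> (flat t).1 < 0 &
    cos (2 * t) = 1 \/ cos (2 * t) = -1/2 -> (flat t).1 = 0].
  have [h1 h2 h3] := H; rewrite /flat /= in h1 h2 h3; split.
  - by move=> h; apply: h1; nra.
  - by move=> h; apply: h2; nra.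
  - by move/S0/h3.
rewrite /flat /=; clear S0.
move: cs rho1 rhoE cle cge; move: (2 + cos (3 * t)) (cos (2 * t)) (sin (2 * t)) => rho c s.
move=> cs /andP[rho1 rho3] rhoE cle cge.
(* The finger is inactive when [rho * c <= 11 / 4]. Then, with [q = |s| / sqrt 3], the third branch
   is not the least, and the abscissa is the smaller of [rho * (c + q)] and
   [rho * (c + 3 * q) - 1]. *)
have [f0|f0] := leP (8 - 16 * Num.sqrt (3 - rho * c)) 0.
  have -> : finger (rho * c) = 0 by rewrite /finger; apply/max_idPl.
  rewrite addr0.
  pose q := `|s| / r3.
  have q0 : 0 <= q by rewrite divr_ge0 ?normr_ge0// ltW.
  have sq : `|s| = r3 * q by rewrite /q mulrC divfK// gt_eqF.
  have q2 : 3 * q ^+ 2 = 1 - c ^+ 2.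
    have : `|s| ^+ 2 = s ^+ 2 by rewrite real_normK// num_real.
    by rewrite sq exprMn r3_sqr; lra.
  have y1 : `|rho * s| / r3 = rho * q by rewrite normrM (ger0_norm (_ : 0 <= rho)) ?mulrA//; lra.
  have y2 : r3 * `|rho * s| = 3 * (rho * q).
    by rewrite normrM (ger0_norm (_ : 0 <= rho)) ?sq -?r3_sqr; [ring|lra].
  have s1 : `|s| <= 1 by rewrite ler_norml; nra.
  have q1 : q <= 58 / 100 by nra.
  have y3 : rho * s <= 3 by have := ler_norm s; nra.
  have -> : fold_x (rho * s) = Num.min (rho * q) (3 * (rho * q) - 1).
    rewrite /fold_x -/r3 y1 y2; apply/min_idPl; rewrite ge_min; apply/orP; left; nra.
  rewrite addr_minr; split=> [/andP[c1 c2]|c1|[cE|cE]].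
  - rewrite lt_min; apply/andP; split.
      have : 0 < c + q by rewrite ltNge; apply/negP => h; nra.
      by nra.
    have : 1 < c + 3 * q by rewrite ltNge; apply/negP => h; nra.
    by nra.
  - rewrite gt_min; apply/orP; left.
    have : c + q < 0 by rewrite ltNge; apply/negP => h; nra.
    by nra.
  - have q00 : q = 0 by move: q2; rewrite cE; nra.
    have rE : rho = 1.
      case: (rhoE cE) => // rE; move: f0.
      by rewrite rE cE mulr1 subrr sqrtr0 mulr0 subr0; lra.
    have h : 1 * 1 + (3 * (1 * 0) - 1) <= 1 * 1 + 1 * 0 :> R by lra.
    by rewrite cE q00 rE (min_idPr h); ring.
  - have q05 : q = 1 / 2 by rewrite cE in q2; nra.
    have h : rho * (-1 / 2) + rho * (1 / 2) <= rho * (-1 / 2) + (3 * (rho * (1 / 2)) - 1) by lra.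
    by rewrite cE q05 (min_idPl h); ring.
(* On the finger the first two branches leave the abscissa positive. The third gives
   [16 * D - rho * s - D ^ 2], which is positive for [D > 0] since [|rho * s| <= 5 / 2 * D], and
   vanishes at the tip. *)
set D := Num.sqrt (3 - rho * c) in f0.
have D0 : 0 <= D by exact: sqrtr_ge0.
have D2 : D ^+ 2 = 3 - rho * c by rewrite sqr_sqrtr//; nra.
have D1 : D < 1 / 2 by lra.
have x275 : 275 / 100 < rho * c by nra.
have -> : finger (rho * c) = 8 - 16 * D by rewrite /finger -/D; apply/max_idPr; exact: ltW.
set Y := rho * s + (8 - 16 * D).
have yD : `|rho * s| <= 25 / 10 * D.
  rewrite ler_norml; have : (rho * s) ^+ 2 <= 6 * D ^+ 2.
    have -> : (rho * s) ^+ 2 = rho ^+ 2 * (1 - c ^+ 2) by rewrite exprMn; congr (_ * _); lra.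
    nra.
  move: (rho * s) => y y2; nra.
have Yn : 0 <= `|Y| / r3 by rewrite divr_ge0 ?normr_ge0// ltW.
have Ym : 0 <= r3 * `|Y| by rewrite mulr_ge0 ?normr_ge0// ltW.
have third : rho * c + (5 - Y) = 16 * D - rho * s - D ^+ 2 by rewrite D2 /Y; ring.
have yle : rho * s <= 25 / 10 * D by apply: le_trans yD; exact: ler_norm.
rewrite /fold_x -/r3 !addr_minr; split=> [/andP[c1 c2]|c1|[cE|cE]].
- rewrite !lt_min third; apply/andP; split; first by apply/andP; split; lra.
  have : 0 < D by rewrite lt0r D0 andbT; apply/eqP => DE; move: D2; rewrite DE; nra.
  nra.
- by exfalso; nra.
- have rE : rho = 3 by case: (rhoE cE) => // rE; exfalso; move: x275; rewrite rE cE; lra.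
  have s0 : s = 0 by move: cs; rewrite cE; nra.
  have DE : D = 0 by rewrite /D rE cE mulr1 subrr sqrtr0.
  have -> : rho * c + (5 - Y) = 0 by rewrite third s0 DE; ring.
  by apply/min_idPr; rewrite le_min; apply/andP; split; lra.
- by exfalso; rewrite cE in x275; lra.
Qed.

Lemma continuous_finger : continuous finger. Proof. by rewrite /finger; cts. Qed.

Lemma continuous_fold_x : continuous fold_x.
Proof. by rewrite /fold_x; cts. Qed.

Lemma continuous_flat : continuous flat.
Proof.
have h1 := continuous_finger; have h2 := continuous_fold_x.
by rewrite /flat /=; cts.
Qed.

Lemma flat_inj (s t : R) : flat s = flat t -> cos (2 * (s - t)) = 1 /\ cos (3 * s) = cos (3 * t).
Proof.
rewrite /flat => -[E1 E2]; rewrite E2 in E1.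
have {}E1 := addIr _ E1; rewrite E1 in E2; have {}E2 := addIr _ E2.
have rho u : 0 <= 2 + cos (3 * u) :> R by have := cos_geN1 (3 * u); lra.
have rhoE : 2 + cos (3 * s) = 2 + cos (3 * t).
  by rewrite -(vlen_polar (2 * s) (rho s)) -(vlen_polar (2 * t) (rho t)) E1 E2.
have rN0 : 2 + cos (3 * t) != 0 by have := cos_geN1 (3 * t); rewrite gt_eqF//; lra.
rewrite rhoE in E1 E2; have {}E1 := mulfI rN0 E1; have {}E2 := mulfI rN0 E2.
split; last by lra.
have -> : 2 * (s - t) = 2 * s - 2 * t by ring.
by rewrite cosB E1 E2 -!expr2 cos2Dsin2.
Qed.

(* The slopes 1/2 and 1/3 of the pages match the height difference 2 of the two
   strands at the crossings, which lie at abscissae 2, -3 and 2. *)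
Definition slope (x : R) : R := Num.max x 0 / 2 + Num.min x 0 / 3.

Lemma slope0 : slope 0 = 0. Proof. by rewrite /slope maxxx minxx; lra. Qed.

Lemma sin_triple (t : R) : sin (3 * t) = sin t * (4 * cos t ^+ 2 - 1).
Proof.
have -> : 3 * t = 2 * t + t by ring.
rewrite sinD cos_double sin_double; ring.
Qed.

(** These times include the double points of the projection. There the slope of the page already
    equals the height, up to the sign attached to each half of the knot, so that the height needs no
    correction. *)
Lemma flat_crossing (t : R) : cos (3 * t) = 0 ->
  slope (flat t).1 = (if 0 <= sin t then 1 else -1) * sin (3 * t).
Proof.
move=> c3; rewrite /flat /= c3 addr0 sin_triple cos_double sin_double.
have := cos2Dsin2 t; move: c3; rewrite cos_triple.
move: (cos t) (sin t) => c s c3 cs.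
have sqrt_half (x : R) : x <= 1 -> finger x = 0.
  move=> x1; apply/max_idPl.
  have : Num.sqrt 1 <= Num.sqrt (3 - x) by apply: ler_wsqrtr; lra.
  by rewrite sqrtr1; lra.
have : c * (4 * c ^+ 2 - 3) == 0 by apply/eqP; rewrite -c3; ring.
rewrite mulf_eq0 => /orP[/eqP c0|/eqP c2].
  rewrite c0 expr0n /= !mulr0 sqrt_half; last by lra.
  have s1 : s ^+ 2 = 1 by move: cs; rewrite c0 expr0n /= add0r.
  have -> : 2 * (0 - 1) + fold_x (0 + 0) = -3.
    rewrite /fold_x !addr0 normr0 mul0r mulr0 (min_idPr (_ : 0 - 1 <= 0)); last by lra.
    by rewrite (min_idPl (_ : 0 - 1 <= 5 - 0)); lra.
  have -> : slope (-3) = -1.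
    by rewrite /slope (max_idPr (_ : -3 <= 0)) ?(min_idPl (_ : -3 <= 0)); lra.
  have : (s - 1) * (s + 1) == 0 by apply/eqP; rewrite -subr_sqr s1 expr1n subrr.
  by rewrite mulf_eq0; have [s0|s0] := leP 0 s => /orP[] /eqP h /=; lra.
have s2 : s ^+ 2 = 1 / 4 by lra.
set y := 2 * (2 * s * c).
have -> : 2 * (2 * c ^+ 2 - 1) = 1 by lra.
have yE : `|y| = r3.
  rewrite -sqrtr_sqr; congr Num.sqrt.
  by have -> : y ^+ 2 = 4 * s ^+ 2 * (4 * c ^+ 2); [rewrite /y; ring|rewrite s2; lra].
have r3_lt : r3 < 2 by have := r3_sqr; have := r3_gt0; nra.
have yle : y <= r3 by rewrite -yE; exact: ler_norm.
rewrite sqrt_half// addr0.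
have -> : fold_x y = 1.
  rewrite /fold_x -/r3 yE divff ?gt_eqF// -expr2 r3_sqr.
  rewrite (min_idPl (_ : 1 <= 3 - 1)); last by lra.
  by apply/min_idPl; lra.
have -> : slope (1 + 1) = 1.
  by rewrite /slope (max_idPl (_ : 0 <= 1 + 1)) ?(min_idPr (_ : 0 <= 1 + 1)); lra.
have : (2 * s - 1) * (2 * s + 1) == 0 by apply/eqP; rewrite -subr_sqr exprMn s2; lra.
by rewrite mulf_eq0; have [s0|s0] := leP 0 s => /orP[] /eqP h /=; nra.
Qed.

Lemma crossing_cases (s t : R) : cos (2 * (s - t)) = 1 -> cos (3 * s) = cos (3 * t) ->
  cos (s - t) = 1 \/ [/\ cos (s - t) = -1, cos (3 * s) = 0 & sin (3 * t) = - sin (3 * s)].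
Proof.
rewrite cos_double => c2 c3.
have h2 : cos (s - t) ^+ 2 = 1 by lra.
have : (cos (s - t) - 1) * (cos (s - t) + 1) == 0 by apply/eqP; rewrite -subr_sqr h2 expr1n subrr.
rewrite mulf_eq0 => /orP[] /eqP h3; [left|right]; first by lra.
have cN : cos (s - t) = -1 by lra.
have c3d : cos (3 * s - 3 * t) = -1.
  have -> : 3 * s - 3 * t = 3 * (s - t) by ring.
  by rewrite cos_triple cN; ring.
have s3d : sin (3 * s - 3 * t) = 0.
  have := cos2Dsin2 (3 * s - 3 * t); rewrite c3d => h.
  by apply/eqP; rewrite -sqrf_eq0; apply/eqP; lra.
have := cosD (3 * t) (3 * s - 3 * t); have := sinD (3 * t) (3 * s - 3 * t).
rewrite c3d s3d addrC subrK => hs hc; split => //; lra.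
Qed.

(** Adding [beta] to the height puts the first half of the knot on the graph of [slope] and the
    second half on that of its negative. To be a shear, the correction must depend on the projection
    alone; at a crossing both strands ask for the value 0. It is thus well defined on the projected
    curve and extends to the plane. *)
Lemma slope_extension : exists2 beta : R * R -> R, continuous beta &
  forall t, (0 <= t <= pi -> beta (flat t) = slope (flat t).1 - sin (3 * t)) /\
            (pi <= t <= 2 * pi -> beta (flat t) = - slope (flat t).1 - sin (3 * t)).
Proof.
have p0 := @pi_gt0 R; have cf := continuous_flat.
have csl : continuous slope by rewrite /slope; cts.
pose g (b : bool) (s : R) := flat (if b then pi * s else pi + pi * s).
pose f (b : bool) (s : R) := let t := if b then pi * s else pi + pi * s in
  (if b then slope (flat t).1 else - slope (flat t).1) - sin (3 * t).
have [||b c s t s1 t1|beta cbeta Hbeta] := @curve_extension R bool g f.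
- by case; rewrite /g /=; cts. 
- by have h1 := continuous_finger; have h2 := continuous_fold_x; case; rewrite /f /=; cts.
- pose T (b : bool) (s : R) := if b then pi * s else pi + pi * s.
  have gE b' s' : g b' s' = flat (T b' s') by rewrite /g /T; case: b'.
  have Tsin (b' : bool) (s' : R) : 0 <= s' <= 1 -> (b' -> 0 <= sin (T b' s')) /\ (~~ b' -> sin (T b' s') <= 0).
    move=> s1'; have h : 0 <= sin (pi * s') by apply: sin_ge0_pi; nra.
    by case: b'; split=> // _; rewrite /T /= addrC sinDpi oppr_le0.
  have fE (b' : bool) (s' : R) : f b' s' = (if b' then 1 else -1) * slope (flat (T b' s')).1 - sin (3 * T b' s').
    by rewrite /f /T; case: b'; rewrite ?mul1r ?mulN1r.
  have f0 (b' : bool) (s' : R) : 0 <= s' <= 1 -> cos (3 * T b' s') = 0 -> f b' s' = 0.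
    move=> s1' c3; rewrite fE (flat_crossing c3); have [h1 h2] := Tsin b' s' s1'.
    case: b' h1 h2 {c3} => h1 h2; first by rewrite (h1 isT) !mul1r subrr.
    have h4 := h2 isT; have [h3|h3] := leP 0 (sin (T false s')).
      have s0 : sin (T false s') = 0 by lra.
      by rewrite sin_triple s0 !mul0r !mulr0 subrr.
    by rewrite !mulN1r opprK subrr.
  have s3 (u v : R) : cos (u - v) = 1 -> sin (3 * u) = sin (3 * v) /\ sin u = sin v :> R.
    move=> cuv; have [_ ->] := cos_sin_eq cuv; split => //.
    have : cos (3 * u - 3 * v) = 1.
      have -> : 3 * u - 3 * v = 3 * (u - v) by ring.
      by rewrite cos_triple cuv !expr1n; ring.
    by case/cos_sin_eq.
  rewrite !gE => E; have [c2 c3] := flat_inj E.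
  have [c1|[_ c0 _]] := crossing_cases c2 c3; last by rewrite !f0 // -c3.
  have [s3E sE] := s3 _ _ c1; rewrite !fE E s3E.
  (* The same point of the knot seen from both halves is at time 0 or [pi] modulo [2 * pi]; its
     abscissa vanishes there, and so does the slope. *)
  have [<-//|bc] := eqVneq b c.
  have s0 : sin (T c t) = 0.
    have [h1 h2] := Tsin b s s1; have [h3 h4] := Tsin c t t1.
    by case: b c bc {E c2 c3 c1 s3E} h1 h2 h3 h4 sE => -[] //= _ h1 h2 h3 h4 sE;
      [have := h1 isT; have := h4 isT|have := h2 isT; have := h3 isT]; lra.
  have [_ _ x0] := flat_x_sign (T c t).
  by rewrite x0 ?slope0 ?mulr0// sin_triple s0 mul0r.
exists beta => // t; split=> t01.
  have t1 : 0 <= t / pi <= 1 by rewrite divr_ge0 ?ler_pdivrMr//; lra.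
  by have := Hbeta true _ t1; rewrite /g /f /= mulrCA divff ?gt_eqF// mulr1.
have t1 : 0 <= (t - pi) / pi <= 1 by rewrite divr_ge0 ?ler_pdivrMr//; lra.
have := Hbeta false _ t1; rewrite /g /f /=.
by rewrite mulrCA divff ?gt_eqF// mulr1 addrC subrK.
Qed.

Definition arc_time (k : nat) (s : R) : R := (k%:R + s) * (pi / 3).

Lemma sin_addn_pi (k : nat) (x : R) : sin (k%:R * pi + x) = (-1) ^+ k * sin x.
Proof.
elim: k => [|k IHk]; first by rewrite mul0r add0r expr0 mul1r.
have -> : k.+1%:R * pi + x = (k%:R * pi + x) + pi by rewrite -natr1; ring.
by rewrite sinDpi IHk exprS mulN1r mulNr.
Qed.

Lemma flat_arc (k : nat) (s : R) : (k < 6)%N -> 0 <= s <= 1 ->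
  ((flat (arc_time k s)).1 = 0 <-> s = 0 \/ s = 1) /\
  (if (k == 1%N) || (k == 4%N) then (flat (arc_time k s)).1 <= 0 else 0 <= (flat (arc_time k s)).1).
Proof.
move=> k6 s01; have p0 := @pi_gt0 R.
have s3E : sin (3 * arc_time k s) = (-1) ^+ k * sin (s * pi).
  by rewrite -sin_addn_pi; congr sin; rewrite /arc_time; field.
have [hp hn h0] := flat_x_sign (arc_time k s).
have [send|smid] := pselect (s = 0 \/ s = 1).
  have x0 : (flat (arc_time k s)).1 = 0.
    by apply: h0; rewrite s3E; case: send => ->; rewrite ?mul0r ?mul1r ?sin0 ?sinpi mulr0.
  by rewrite x0 lexx; split => //; case: ifP.
have s01' : 0 < s < 1.
  have [h1 h2] : s != 0 /\ s != 1 by split; apply/eqP => E; apply: smid; [left|right].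
  by rewrite lt0r h1 lt_neqAle h2; case/andP: s01 => -> ->.
have sp : 0 < sin (s * pi) by apply: sin_gt0_pi; nra.
have st : if (k < 3)%N then 0 < sin (arc_time k s) else sin (arc_time k s) < 0.
  case: ltnP => k3.
    have k2 : (k%:R : R) <= 2 by rewrite ler_nat -ltnS.
    have k0 : 0 <= (k%:R : R) by [].
    by apply: sin_gt0_pi; rewrite /arc_time; nra.
  have k3' : 3 <= (k%:R : R) by rewrite ler_nat.
  have k5 : (k%:R : R) <= 5 by rewrite ler_nat -ltnS.
  rewrite -(subrK pi (arc_time k s)) sinDpi oppr_lt0; apply: sin_gt0_pi.
  by rewrite /arc_time; nra.
rewrite s3E in hp hn.
move: (sin (arc_time k s)) st hp hn => u st hp hn.
suff [x0 xs] : (flat (arc_time k s)).1 <> 0 /\ (if (k == 1%N) || (k == 4%N)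
    then (flat (arc_time k s)).1 <= 0 else 0 <= (flat (arc_time k s)).1).
  by split=> //; split=> [/x0|/smid].
have neg : (-1) ^+ k * sin (s * pi) * u < 0 ->
    (flat (arc_time k s)).1 <> 0 /\ (flat (arc_time k s)).1 <= 0.
  by move=> /hn h; split; [apply/eqP; rewrite lt_eqF|exact: ltW].
have pos : 0 < (-1) ^+ k * sin (s * pi) * u ->
    (flat (arc_time k s)).1 <> 0 /\ 0 <= (flat (arc_time k s)).1.
  by move=> /hp h; split; [apply/eqP; rewrite gt_eqF|exact: ltW].
have up : 0 < sin (s * pi) * `|u|.
  by rewrite mulr_gt0// normr_gt0; case: ifP st => _ h; [rewrite gt_eqF|rewrite lt_eqF].
case: k k6 st neg pos {s3E hp hn h0} => [|[|[|[|[|[|]]]]]] //= _ st neg pos;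
  rewrite -signr_odd /= ?expr0 ?expr1 ?mul1r ?mulN1r ?mulNr in neg pos;
  rewrite ?(gtr0_norm st) ?(ltr0_norm st) ?mulrN in up.
- exact: pos.
- by apply: neg; rewrite oppr_lt0.
- exact: pos.
- exact: pos.
- by apply: neg; rewrite -oppr_gt0.
- exact: pos.
Qed.

(** The directions of the pages, from the slopes 1/2 and 1/3. Numbers 0 and 2 serve the first half
    of the knot, 1 and 3 the second; the quarter turn about the x-axis reverses the sign of the
    height. *)
Definition dirs (j : nat) : R * R :=
  match j with 0%N => (2, -1) | 1%N => (2, 1) | 2%N => (-3, 1) | _ => (-3, -1) end.
Definition arc_page (k : nat) : nat :=
  match k with 0%N | 2%N => 0%N | 1%N => 2%N | 4%N => 3%N | _ => 1%N end.

Definition rotate_yz (t : R) (p : E3 R) : E3 R :=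
  shear_y (fun z => - z.2) t (shear_z (fun z => z.2) t (shear_y (fun z => - z.2) t p)).

Lemma rotate_yz1 p : rotate_yz 1 p = (p.1.1, - p.2, p.1.2).
Proof.
case: p => -[x y] z; rewrite /rotate_yz /shear_y /shear_z /= !mul1r.
by congr (_, _, _); ring.
Qed.

Lemma rotate_yz_isotopy : isotopy rotate_yz.
Proof.
have c1 : continuous (fun z : R * R => - z.2) by cts.
have c2 : continuous (fun z : R * R => z.2) by cts.
have [_ h1 _] := shear_isotopy c1; have [_ _ h2] := shear_isotopy c2.
exact: (isotopy_comp (isotopy_comp h1 h2) h1).
Qed.

Definition unfold_trefoil (beta : R * R -> R) (t : R) (p : E3 R) : E3 R :=
  rotate_yz t (shear_z beta t (shear_x (fun z => fold_x z.1) t (shear_y (fun z => finger z.1) t p))).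

Lemma unfold_isotopy beta : continuous beta -> isotopy (unfold_trefoil beta).
Proof.
move=> cb; have c1 := continuous_finger; have c2 := continuous_fold_x.
have cf : continuous (fun z : R * R => finger z.1) by cts.
have cg : continuous (fun z : R * R => fold_x z.1) by cts.
have [_ h1 _] := shear_isotopy cf; have [h2 _ _] := shear_isotopy cg.
have [_ _ h3] := shear_isotopy cb.
exact: (isotopy_comp (isotopy_comp (isotopy_comp h1 h2) h3) rotate_yz_isotopy).
Qed.

Lemma unfold1 beta t :
  unfold_trefoil beta 1 (trefoil t) = ((flat t).1, - (sin (3 * t) + beta (flat t)), (flat t).2).
Proof. by rewrite /unfold_trefoil rotate_yz1 /shear_z /shear_x /shear_y /trefoil /= !mul1r. Qed.

Lemma dirs_angle_inj (th : nat -> R) i j : (forall j, is_angle (dirs j) (th j)) ->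
  (i < 4)%N -> (j < 4)%N -> cos (th i - th j) = 1 -> i = j.
Proof.
move=> Hth i4 j4 /cos_sin_eq[cE sE].
have v0 k : 0 < vlen (dirs k).
  by apply: vlen_gt0; case: k => [|[|[|k]]]; apply/eqP => -[] /=; lra.
have [Ec Es] : (dirs i).1 * vlen (dirs j) = (dirs j).1 * vlen (dirs i) /\
    (dirs i).2 * vlen (dirs j) = (dirs j).2 * vlen (dirs i).
  by rewrite (Hth i) (Hth j) /= -(Hth i) -(Hth j) cE sE; split; ring.
have := v0 i; have := v0 j; move: Ec Es; move: (vlen (dirs i)) (vlen (dirs j)) => a b; clear cE sE Hth v0.
by case: i i4 => [|[|[|[|]]]] // _; case: j j4 => [|[|[|[|]]]] //= _ *; exfalso; nra.
Qed.

Lemma trefoil_presentation : four_page_presentation (trefoil_knot R) 6.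
Proof.
have p0 := @pi_gt0 R.
have [beta cbeta Hbeta] := slope_extension.
have iso := unfold_isotopy cbeta.
pose F := unfold_trefoil beta 1.
have F_inj : injective F by case: iso => G [_ _ FK _ _]; exact: can_inj (FK 1).
have /choice[th Hth] : forall j, exists t, is_angle (dirs j) t by move=> j; exact: angle_exists.
have v0 k : 0 < vlen (dirs k).
  by apply: vlen_gt0; case: k => [|[|[|k]]]; apply/eqP => -[] /=; lra.
have cflat := continuous_flat.
(* The absolute first coordinate of [dirs j], so that [|x| / wd j] is the factor by which that
   vector is scaled. *)
pose wd (j : nat) : R := if (j < 2)%N then 2 else 3.
pose C (k : nat) (s : R) := (`|(flat (arc_time k s)).1| / wd (arc_page k) * vlen (dirs (arc_page k)),
  (flat (arc_time k s)).2).
have wd_gt0 j : 0 < wd j by rewrite /wd; case: ifP.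
have CF k s : (k < 6)%N -> 0 <= s <= 1 -> in_page (th (arc_page k)) (C k s) = F (trefoil (arc_time k s)).
  move=> k6 s01; rewrite /F unfold1 /in_page /=.
  have dE := Hth (arc_page k).
  have d1 : vlen (dirs (arc_page k)) * cos (th (arc_page k)) = (dirs (arc_page k)).1 by rewrite {2}dE.
  have d2 : vlen (dirs (arc_page k)) * sin (th (arc_page k)) = (dirs (arc_page k)).2 by rewrite {2}dE.
  rewrite -!mulrA d1 d2.
  have [_ xs] := flat_arc k6 s01; have [bp bn] := Hbeta (arc_time k s).
  have tw : (if (k < 3)%N then 0 <= arc_time k s <= pi else pi <= arc_time k s <= 2 * pi).
    case: ltnP => k3.
      have k2 : (k%:R : R) <= 2 by rewrite ler_nat -ltnS.
      have k0 : 0 <= (k%:R : R) by [].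
      by rewrite /arc_time; nra.
    have k3' : 3 <= (k%:R : R) by rewrite ler_nat.
    have k5 : (k%:R : R) <= 5 by rewrite ler_nat -ltnS.
    by rewrite /arc_time; nra.
  have slp (x : R) : 0 <= x -> slope x = x / 2.
    by move=> x0; rewrite /slope (max_idPl x0) (min_idPr x0); lra.
  have sln (x : R) : x <= 0 -> slope x = x / 3.
    by move=> x0; rewrite /slope (max_idPr x0) (min_idPl x0); lra.
  case: k k6 xs tw bp bn {dE d1 d2} => [|[|[|[|[|[|]]]]]] //= _ xs tw bp bn;
    rewrite /wd /=; rewrite ?(ger0_norm xs) ?(ler0_norm xs);
    first [rewrite (bp tw)|rewrite (bn tw)]; first [rewrite (slp _ xs)|rewrite (sln _ xs)];
    (congr (_, _, _); by field).
have C_ge0 k s : 0 <= (C k s).1.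
  by apply: mulr_ge0; [apply: divr_ge0; [exact: normr_ge0|exact: ltW]|exact: ltW].
(* The bound on the indices keeps the difference of the two times below the period [2 * pi]. *)
have time_inj (k k' : nat) (s s' : R) : -3 <= (k%:R - k'%:R : R) <= 3 -> 0 <= s <= 1 -> 0 <= s' <= 1 ->
    F (trefoil (arc_time k s)) = F (trefoil (arc_time k' s')) -> k%:R + s = k'%:R + s' :> R.
  move=> kk s1 s1' /F_inj /trefoil_eq c1.
  have dE : arc_time k s - arc_time k' s' = (k%:R - k'%:R + s - s') * (pi / 3).
    by rewrite /arc_time; ring.
  rewrite dE in c1; have /eqP : (k%:R - k'%:R + s - s') * (pi / 3) = 0.
    by apply: cos_eq1_small => //; move: kk; rewrite ltr_norml => /andP[h1 h2]; nra.
  have pi3 : pi / 3 != 0 :> R by rewrite gt_eqF// divr_gt0.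
  by rewrite mulf_eq0 (negbTE pi3) orbF => /eqP; lra.
have pg4 k : (arc_page k < 4)%N by case: k => [|[|[|[|[|k]]]]].
pose arc (k : 'I_6) := (fun s => in_page (th (arc_page k)) (C k s)) @` `[0, 1]%classic.
exists (fun j : 'I_4 => page (th j)), (fun k : 'I_6 => inord (arc_page k)), arc; split.
- split=> [i j /page_eq c1|j]; last by eexists.
  by apply/val_inj; apply: (dirs_angle_inj Hth _ _ c1).
- move=> -[[|[|[|[|]]]] // j4]; [exists (inord 0)|exists (inord 3)|exists (inord 1)|exists (inord 4)];
  by apply/val_inj; rewrite /= !inordK.
- move=> k; rewrite inordK//; have k6 := ltn_ord k; apply: page_arc.
  + by have := cflat; rewrite /C /arc_time => h; cts; rewrite gt_eqF.
  + move=> s u s1 u1 E; apply: (@addrI _ k%:R); apply: time_inj => //.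
      by rewrite subrr; lra.
    by rewrite -!CF// E.
  + by move=> s _; exact: C_ge0.
  + move=> s s1; have [<- _] := flat_arc k6 s1; rewrite /C /=.
    split=> [/eqP|->]; last by rewrite normr0 !mul0r.
    rewrite mulf_eq0 (gt_eqF (v0 _)) orbF mulf_eq0 invr_eq0 (gt_eqF (wd_gt0 _)) orbF normr_eq0.
    by move/eqP.
(* Arcs that share a page are 0 and 2, or 3 and 5; they are not consecutive and hence have no common
   end. *)
- move=> k l kl /(congr1 val); rewrite /= !inordK// => pkl.
  apply/seteqP; split=> // p [[s s1 <-] [u u1]]; move: s1 u1; rewrite /= !in_itv /= => s1 u1.
  rewrite !CF// => /time_inj E; have := E _ u1 s1.
  case: k l kl pkl {E} => -[|[|[|[|[|[|]]]]]] //= k6 [[|[|[|[|[|[|]]]]]] //= l6] // kl _ E; exfalso;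
  by have h := E ltac:(lra); lra.
apply: (isotopy_image iso); rewrite -/F.
apply/seteqP; split=> [q [p [t _ pE] <-]|q [k _ [s s1 <-]]]; last first.
  rewrite CF//; exists (trefoil (arc_time k s)) => //; by exists (arc_time k s).
have [t' [t0 c1]] := angle_window_lt 0 t.
have {p pE}-> : p = trefoil t' by rewrite -pE; apply/esym/trefoil_eq.
have [k [k6 ks]] : exists k, (k < 6)%N /\ k%:R <= t' / (pi / 3) <= k%:R + 1.
  have u0 : 0 <= t' / (pi / 3) by apply: divr_ge0; lra.
  have u6 : t' / (pi / 3) < 6%:R by rewrite ltr_pdivrMr ?divr_gt0//; lra.
  elim: (6%N) u6 => [|n IHn] un; first by exfalso; lra.
  have [/IHn[k [kn h]]|nu] := ltP (t' / (pi / 3)) n%:R.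
    by exists k; rewrite ltnW// ltnS.
  by exists n; rewrite ltnS leqnn nu natr1 ltW.
exists (Ordinal k6) => //; exists (t' / (pi / 3) - k%:R).
  by rewrite /= in_itv /=; lra.
rewrite CF//; last by lra.
have pi3 : pi / 3 != 0 :> R by rewrite gt_eqF// divr_gt0.
by rewrite /= /arc_time addrC subrK divfK.
Qed.
End Trefoil.

Lemma four_page_index_eq (R : realType) (K : set (E3 R)) m :
  four_page_presentation K m -> (forall n, four_page_presentation K n -> (m <= n)%N) ->
  four_page_index K = m.
Proof.
move=> Km min; rewrite /four_page_index; case: pselect => [ex|[]]; last first.
  by exists m; apply/asboolP.
case: ex_minnP => n /asboolP Kn n_min; apply/eqP; rewrite eqn_leq min// andbT.
by apply: n_min; apply/asboolP.
Qed.

Theorem corollary8 (R : realType) :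
  four_page_index (hopf_link R) = 4%N /\
  four_page_index (trefoil_knot R) = 6%N.
Proof.
split; apply: four_page_index_eq.
- exact: hopf_presentation.
- by move=> n; exact: presentation_ge4.
- exact: trefoil_presentation.
- move=> n Kn; have n4 := presentation_ge4 Kn; rewrite leqNgt; apply/negP => n6.
  by apply: (@trefoil_no_presentation R n) => //; lia.
Qed.
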